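(* Let $\rho\in\mathcal S(\mathbb R^{2n+1})$ satisfy $\int\rho(x)\,dx=1$ and $\int x^\alpha\rho(x)\,dx=0$ for every nonzero multi-index $\alpha\in\mathbb N^{2n+1}$, and let $\rho_\varepsilon(x)=\varepsilon^{-(2n+1)}\rho(x/\varepsilon)$ for $\varepsilon\in(0,1)$. Then the map $$\mathcal E'(H_n)\to\mathcal G^s(H_n),\qquad u\mapsto\langle\rho_\varepsilon*_{H_n}u\rangle,$$ extends to a morphism of sheaves from the sheaf of distributions $\mathcal D'$ on $H_n$ to the sheaf $\mathcal G^s$ on $H_n$, and this morphism is an algebra homomorphism on $C^\infty(H_n)$.
   Context: $H_n=\mathbb R^{2n}\times\mathbb R$ is the Heisenberg group with group law $(x,\xi,t)\circ(y,\eta,s)=\big(x+y,\xi+\eta,t+s+\tfrac12(x\cdot\eta-y\cdot\xi)\big)$; Lebesgue measure is left and right invariant. Convolution is $(g*_{H_n}f)(p)=\int_{H_n}g(q)f(q^{-1}p)\,dq$, extended to $g\in\mathcal S(\mathbb R^{2n+1})$ and $f\in\mathcal E'(H_n)$ (compactly supported distributions). For an open set $U\subseteq H_n=\mathbb R^{2n+1}$, a smooth net $(0,1)\ni\varepsilon\mapsto f_\varepsilon\in C^\infty(U)$ is moderate if for every continuous seminorm $p$ on $C^\infty(U)$ there is $N\in\mathbb Z$ with $p(f_\varepsilon)=O(\varepsilon^N)$ as $\varepsilon\to0$, and negligible if for every $p$ this holds for all $N\in\mathbb Z$. $\mathcal G^s(U)$ is the algebra of moderate nets modulo negligible nets, with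 classes $\langle f_\varepsilon\rangle$; $U\mapsto\mathcal G^s(U)$ is a sheaf of algebras under restriction. *)

(* Defs.v *)
From HB Require Import structures.
From mathcomp Require Import all_boot all_order all_algebra.
From mathcomp Require Import complex.
From mathcomp Require Import all_classical all_reals all_analysis.

Set Implicit Arguments.
Unset Strict Implicit.
Unset Printing Implicit Defensive.

Import Order.TTheory GRing.Theory Num.Theory.
Import numFieldNormedType.Exports.

Local Open Scope classical_set_scope.
Local Open Scope ring_scope.
Local Open Scope complex_scope.

Section LebesgueTuple.
Context {R : realType}.
Local Notation mR := (measurableTypeR R).

Definition tuple_cons m (p : mR * m.-tuple mR) : m.+1.-tuple mR :=
  [tuple of p.1 :: p.2].

Lemma measurable_tuple_cons m : measurable_fun setT (@tuple_cons m).
Proof. exact: measurable_cons. Qed.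

Section Step.
Variables (m : nat) (mu : {sigma_finite_measure set (m.-tuple mR) -> \bar R}).

Definition lebesgue_tupleS : set (m.+1.-tuple mR) -> \bar R :=
  pushforward (lebesgue_measure \x mu)%E (@tuple_cons m).

Let mcons : measurable_fun setT (@tuple_cons m) := @measurable_tuple_cons m.

Let lebesgue_tupleS0 : lebesgue_tupleS set0 = 0%E.
Proof. exact: measure0. Qed.

Let lebesgue_tupleS_ge0 A : (0 <= lebesgue_tupleS A)%E.
Proof. exact: measure_ge0. Qed.

Let lebesgue_tupleS_sigma_additive : semi_sigma_additive lebesgue_tupleS.
Proof. exact: measure_semi_sigma_additive. Qed.

HB.instance Definition _ := isMeasure.Build _ _ _ lebesgue_tupleS
  lebesgue_tupleS0 lebesgue_tupleS_ge0 lebesgue_tupleS_sigma_additive.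

Lemma lebesgue_tupleS_sigma_finite : sigma_finite setT lebesgue_tupleS.
Proof.
have /sigma_finiteP[F [FT ndF Fo]] := sigma_finiteT (@lebesgue_measure R).
have /sigma_finiteP[G [GT ndG Go]] := sigma_finiteT mu.
pose g (t : m.+1.-tuple mR) : mR * m.-tuple mR :=
  (tnth t ord0, [tuple of behead t]).
have mg : measurable_fun setT g.
  by apply/measurable_fun_pair; [exact: measurable_tnth|exact: measurable_behead].
have gK p : g (tuple_cons p) = p.
  by case: p => a t; congr pair; apply/val_inj.
exists (fun k => g @^-1` (F k `*` G k)).
  apply/esym/seteqP; split => // t _.
  have [i _ Fi] : (\bigcup_k F k) (g t).1 by rewrite -FT.
  have [j _ Gj] : (\bigcup_k G k) (g t).2 by rewrite -GT.
  exists (maxn i j) => //; split.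
    by move: Fi; exact/subsetPset/ndF/leq_maxl.
  by move: Gj; exact/subsetPset/ndG/leq_maxr.
move=> k; have [mF Ff] := Fo k; have [mG Gf] := Go k; split.
  by rewrite -[X in measurable X]setTI; apply: mg => //; exact: measurableX.
rewrite /lebesgue_tupleS /pushforward.
rewrite (_ : _ @^-1` _ = F k `*` G k); last first.
  by rewrite -comp_preimage (_ : g \o _ = id)//; apply/funext.
by rewrite product_measure1E// lte_mul_pinfty// ge0_fin_numE.
Qed.

HB.instance Definition _ :=
  @Measure_isSigmaFinite.Build _ _ _ lebesgue_tupleS
    lebesgue_tupleS_sigma_finite.

End Step.

(* The m-fold product of the Lebesgue measure on R. *)
Fixpoint lebesgue_tuple m : {sigma_finite_measure set (m.-tuple mR) -> \bar R} :=
  match m with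
  | 0 => @dirac _ (0.-tuple mR) [tuple] R
  | m'.+1 => lebesgue_tupleS (lebesgue_tuple m')
  end.

End LebesgueTuple.

Section Generalized.
Context {R : realType} {d : nat}.

Local Notation E := 'rV[R]_d.
Local Notation at0 := (0^'+ : set_system R).
Local Notation C := R[i].

Definition Rintegral_rV (f : E -> R) : R :=
  \int[@lebesgue_tuple R d]_t f (\row_i tnth t i).

Definition Cintegral (f : E -> C) : C :=
  Rintegral_rV (fun x => complex.Re (f x))
    +i* Rintegral_rV (fun x => complex.Im (f x)).

Definition cpartial (i : 'I_d) (f : E -> C) : E -> C := fun x =>
  ('D_(delta_mx 0 i) (fun y => complex.Re (f y)) x)
    +i* ('D_(delta_mx 0 i) (fun y => complex.Im (f y)) x).

Definition cpartials (s : seq 'I_d) (f : E -> C) : E -> C :=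
  foldr cpartial f s.

(* Functions are total; only their values on the open set U matter. *)
Definition smooth (U : set E) (f : E -> C) : Prop :=
  forall (s : seq 'I_d) (x : E), U x ->
    [/\ {for x, continuous (fun y => complex.Re (cpartials s f y))},
        {for x, continuous (fun y => complex.Im (cpartials s f y))} &
        forall i : 'I_d,
          derivable (fun y => complex.Re (cpartials s f y)) x (delta_mx 0 i) /\
          derivable (fun y => complex.Im (cpartials s f y)) x (delta_mx 0 i)].

Definition cmod (z : C) : R := Normc.normc z.

Definition Ck_seminorm (K : set E) (k : nat) (f : E -> C) : R :=
  sup [set r | exists s : seq 'I_d, exists x : E,
    [/\ (size s <= k)%N, K x & r = cmod (cpartials s f x)]].

(* The seminorms Ck_seminorm K k, for K compact in U, are directed, so a
   seminorm is continuous for the topology that they generate iff it is bounded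
   by a multiple of one of them. *)
Definition continuous_seminorm (U : set E) (p : (E -> C) -> R) : Prop :=
  [/\ forall f g, smooth U f -> smooth U g -> p (f \+ g) <= p f + p g,
      forall (a : C) f, smooth U f -> p (a \*o f) = cmod a * p f &
      exists (K : set E) (k : nat) (M : R), [/\ compact K, K `<=` U &
        forall f, smooth U f -> p f <= M * Ck_seminorm K k f]].

Definition monomial (alpha : 'I_d -> nat) (x : E) : C :=
  (\prod_(i < d) x 0 i ^+ alpha i)%:C.

Definition schwartz (f : E -> C) : Prop :=
  smooth setT f /\
  forall (alpha : 'I_d -> nat) (s : seq 'I_d), exists M : R, forall x : E,
    cmod (monomial alpha x * cpartials s f x) <= M.

Definition supp (f : E -> C) : set E := closure [set x | f x != 0].

Definition test_fun (U : set E) (f : E -> C) : Prop :=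
  [/\ smooth setT f, compact (supp f) & supp f `<=` U].

(* A distribution on U is a functional on test functions, extended by 0 to all
   functions, so that equality of distributions on U is Leibniz equality. *)
Definition distribution (U : set E) (u : (E -> C) -> C) : Prop :=
  [/\ forall (a : C) f g, test_fun U f -> test_fun U g ->
        u ((a \*o f) \+ g) = a * u f + u g,
      forall K : set E, compact K -> K `<=` U ->
        exists (k : nat) (M : R), forall f, test_fun U f -> supp f `<=` K ->
          cmod (u f) <= M * Ck_seminorm K k f &
      forall f, ~ test_fun U f -> u f = 0].

Definition dist_res (V : set E) (u : (E -> C) -> C) : (E -> C) -> C :=
  fun f => if `[< test_fun V f >] then u f else 0.

Definition dist_of (U : set E) (f : E -> C) : (E -> C) -> C :=
  fun g => if `[< test_fun U g >] then Cintegral (f \* g) else 0.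

Definition dist_supp (u : (E -> C) -> C) : set E :=
  ~` \bigcup_(V in [set V | open V /\ forall f, test_fun V f -> u f = 0]) V.

Definition compact_distribution (u : (E -> C) -> C) : Prop :=
  distribution setT u /\ compact (dist_supp u).

(* The value of a compactly supported distribution u on a smooth function f is
   u (chi f) for any cutoff chi equal to 1 near the support of u. *)
Definition dist_pair (u : (E -> C) -> C) (f : E -> C) : C :=
  xget 0 [set z | exists chi : E -> C, exists W : set E,
    [/\ test_fun setT chi, open W, dist_supp u `<=` W,
        (forall x, W x -> chi x = 1) & z = u (chi \* f)]].

(* A net assigns a function to each parameter; only parameters in ]0, 1[
   matter. *)
Definition net : Type := R -> E -> C.

(* g is the derivative of the curve f : ]0, 1[ -> C^oo(U). *)
Definition net_derivative (U : set E) (f g : net) : Prop :=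
  forall e : R, 0 < e < 1 -> forall p, continuous_seminorm U p ->
    (fun h : R => p (fun x => (h^-1)%:C * (f (e + h) x - f e x) - g e x))
      @ 0^' --> (0 : R).

Definition smooth_net (U : set E) (f : net) : Prop :=
  exists D : nat -> net, [/\ D 0%N = f,
    forall k e, 0 < e < 1 -> smooth U (D k e) &
    forall k, net_derivative U (D k) (D k.+1)].

Definition moderate (U : set E) (f : net) : Prop :=
  smooth_net U f /\
  forall p, continuous_seminorm U p -> exists N : int,
    (fun e : R => p (f e)) =O_at0 (fun e : R => e ^ N).

Definition negligible_net (U : set E) (f : net) : Prop :=
  smooth_net U f /\
  forall p, continuous_seminorm U p -> forall N : int,
    (fun e : R => p (f e)) =O_at0 (fun e : R => e ^ N).

(* The class of f as a set of nets: the coset of f modulo negligible nets. *)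
Definition gs_class (U : set E) (f : net) : set net :=
  [set g | moderate U g /\ negligible_net U (fun e x => f e x - g e x)].

Definition Gs (U : set E) : set (set net) :=
  [set A | exists2 f, moderate U f & A = gs_class U f].

(* On classes these are the operations induced by representatives. *)
Definition gs_add (U : set E) (A B : set net) : set net :=
  \bigcup_(f in A) \bigcup_(g in B) gs_class U (fun e x => f e x + g e x).

Definition gs_mul (U : set E) (A B : set net) : set net :=
  \bigcup_(f in A) \bigcup_(g in B) gs_class U (fun e x => f e x * g e x).

Definition gs_scale (U : set E) (a : C) (A : set net) : set net :=
  \bigcup_(f in A) gs_class U (fun e x => a * f e x).

Definition gs_one (U : set E) : set net := gs_class U (fun _ _ => 1).

Definition gs_res (V : set E) (A : set net) : set net :=
  \bigcup_(f in A) gs_class V f.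

(* phi U is the component over U of a morphism from D' to G^s, both sheaves of
   complex vector spaces; phi is only relevant on open sets and distributions. *)
Definition sheaf_morphism (phi : set E -> ((E -> C) -> C) -> set net) : Prop :=
  [/\ forall U, open U -> forall u, distribution U u -> Gs U (phi U u),
      forall U, open U -> forall (a : C) u v,
        distribution U u -> distribution U v ->
        phi U ((a \*o u) \+ v) = gs_add U (gs_scale U a (phi U u)) (phi U v) &
      forall U V, open U -> open V -> V `<=` U -> forall u, distribution U u ->
        phi V (dist_res V u) = gs_res V (phi U u)].

Definition algebra_hom_smooth (U : set E) (F : (E -> C) -> set net) : Prop :=
  [/\ forall f, smooth U f -> Gs U (F f),
      forall (a : C) f g, smooth U f -> smooth U g ->
        F ((a \*o f) \+ g) = gs_add U (gs_scale U a (F f)) (F g),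
      forall f g, smooth U f -> smooth U g ->
        F (f \* g) = gs_mul U (F f) (F g) &
      F (fun=> 1) = gs_one U].

End Generalized.

Section Heisenberg.
Context {R : realType} {n : nat}.

Local Notation H := 'rV[R]_(n + n + 1).

Definition hx (p : H) : 'rV[R]_n := lsubmx (lsubmx p).
Definition hxi (p : H) : 'rV[R]_n := rsubmx (lsubmx p).
Definition ht (p : H) : R := rsubmx p 0 0.

Definition hpoint (x xi : 'rV[R]_n) (t : R) : H :=
  row_mx (row_mx x xi) t%:M.

Definition dotrV (x y : 'rV[R]_n) : R := \sum_(i < n) x 0 i * y 0 i.

Definition hmul (p q : H) : H :=
  hpoint (hx p + hx q) (hxi p + hxi q)
    (ht p + ht q + 2^-1 * (dotrV (hx p) (hxi q) - dotrV (hx q) (hxi p))).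

Definition hinv (p : H) : H := - p.

(* For a function u, the change of variables r = q^-1 p in
   \int g(q) u(q^-1 p) dq gives \int g(p r^-1) u(r) dr. *)
Definition hconv (g : H -> R[i]) (u : (H -> R[i]) -> R[i]) : H -> R[i] :=
  fun p => dist_pair u (fun r => g (hmul p (hinv r))).

Definition mollifier (rho : H -> R[i]) (e : R) : H -> R[i] :=
  fun x => (e ^- (n + n + 1))%:C * rho (e^-1 *: x).

Lemma hmulrV p : hmul p (hinv p) = 0.
Proof.
rewrite /hmul /hpoint /hinv /hx /hxi /ht /dotrV !linearN/= !subrr.
set d1 := \sum_(i < n) _; set d2 := \sum_(i < n) _.
have -> : d1 = d2.
  by apply: eq_bigr => i _; rewrite !mxE mulrN mulNr.
have -> : (- rsubmx p) 0 0 = - rsubmx p 0 0 by rewrite mxE.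
by rewrite !subrr mulr0 addr0 raddf0 !row_mx0.
Qed.

End Heisenberg.

(* Main.v *)
From HB Require Import structures.
Require Import Defs.
From mathcomp Require Import all_boot all_order all_algebra.
From mathcomp Require Import complex.
From mathcomp Require Import all_classical all_reals all_analysis.
From mathcomp Require Import measurable_realfun lebesgue_stieltjes_measure.
From mathcomp Require Import ring lra.

(** Let [u] be a distribution on an open set [U], [K] a compact subset of [U] and
    [chi] a test function on [U] equal to [1] near [K]. The net
    [e, p |-> u (r |-> chi r * rho_e (p r^-1))], a regularization of [u], is the
    convolution of [rho_e] with [chi u]. As [rho] decreases rapidly, another choice
    of [chi] changes it on [K] by [O(e^N)] for all [N] ([reg_null], [reg_agree]). A
    moderate net is called associated with [u] if on each [K] it differs from these
    regularizations by such an error, and the morphism sends [u] to the set of the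
    nets associated with [u].

    This set is a class of [G^s(U)]. Two associated nets differ by a moderate net
    whose values are [O(e^N)] for all [N] on compact sets, and such a net is
    negligible: a derivative is bounded by [2 A / h + h B] when [A] bounds the values
    and [B] the second derivatives, and a suitable power [h] of [e] makes this small
    ([landau]). An associated net exists: glue regularizations along a locally finite
    partition of unity ([associated_exists]). Linearity and compatibility with
    restrictions can then be read off associated nets ([phi_sheaf_morphism]).

    If [u] has compact support, then its convolution with [rho_e] is the regularization
    for a cutoff equal to [1] near the support, hence is associated with [u]
    ([hconv_associated]). If [u] is a smooth function [f], the substitution
    [r = (e q)^-1 p = p + e L_p q], with [L_p] linear, turns the regularization into
    the integral of [(chi f) (p + e L_p q) rho q]. Taylor expansion in [e] and the
    vanishing moments of [rho] give [f p + O(e^N)] for all [N]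
    ([mollifier_approx]). So the constant net [f] is associated with [f]
    ([smooth_associated]), and constant nets are multiplied like functions.

    The analysis behind this is done for real functions of row vectors, real and
    imaginary parts being separated. A functional of finite order, applied to a jointly
    smooth family of functions supported in a fixed compact set, gives a smooth function
    of the parameter, with derivatives taken under the functional ([pairing_smooth]).
    With the parameter [(e, p)] this shows that regularizations depend smoothly on [e]
    and [p], and it bounds all their derivatives by those of the kernel
    [rho_e (p r^-1)], which are moderate in general and negligible where [p r^-1] stays
    away from [0] ([kernel_mbnd], [pairing_mbnd]). *)

Set Implicit Arguments.
Unset Strict Implicit.
Unset Printing Implicit Defensive.

Import Order.TTheory GRing.Theory Num.Theory.
Import numFieldNormedType.Exports.

Local Open Scope classical_set_scope.
Local Open Scope ring_scope.

(** * Smooth real functions of several variables *)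

Section RealSmooth.
Context {R : realType}.

Definition rpartial d (i : 'I_d) (f : 'rV[R]_d -> R) : 'rV[R]_d -> R :=
  fun x => 'D_(delta_mx 0 i) f x.

Definition rpartials d (s : seq 'I_d) (f : 'rV[R]_d -> R) : 'rV[R]_d -> R :=
  foldr (@rpartial d) f s.

(** The recursion on the order makes closure under sums, products and composition
    provable by induction; iterated partial derivatives come only afterwards, with
    [rsmoothP]. *)
Fixpoint Ck d (k : nat) (U : set 'rV[R]_d) (f : 'rV[R]_d -> R) : Prop :=
  (forall x, U x -> {for x, continuous f}) /\
  match k with
  | 0 => True
  | k'.+1 => (forall i x, U x -> derivable f x (delta_mx 0 i)) /\
             (forall i, Ck k' U (rpartial i f))
  end.

Definition rsmooth d (U : set 'rV[R]_d) f := forall k, Ck k U f.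

Section Basics.
Context {d : nat}.
Implicit Types (U : set 'rV[R]_d) (f g : 'rV[R]_d -> R).

Lemma Ck_cont k U f : Ck k U f -> forall x, U x -> {for x, continuous f}.
Proof. by case: k => [|k] []. Qed.

Lemma rpartials_rcons s i f : rpartials (rcons s i) f = rpartials s (rpartial i f).
Proof. by rewrite /rpartials foldr_rcons. Qed.

Lemma rpartials_cat s t f : rpartials (s ++ t) f = rpartials s (rpartials t f).
Proof. by rewrite /rpartials foldr_cat. Qed.

Lemma near_openP U x : open U -> U x -> \forall y \near x, U y.
Proof. by move=> oU Ux; apply: open_nbhs_nbhs; split. Qed.

Lemma near_eq_on U f g x : open U -> (forall x, U x -> f x = g x) -> U x ->
  \forall y \near x, f y = g y.
Proof.
move=> oU fg Ux; near=> y; apply: fg; near: y; exact: near_openP.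
Unshelve. all: by end_near. Qed.

Lemma eq_on_rpartial U f g i : open U -> (forall x, U x -> f x = g x) ->
  forall x, U x -> rpartial i f x = rpartial i g x.
Proof.
move=> oU fg x Ux; rewrite /rpartial.
apply: near_eq_derive.
exact: (near_eq_on oU fg Ux).
Qed.

Lemma eq_on_rpartials U f g s : open U -> (forall x, U x -> f x = g x) ->
  forall x, U x -> rpartials s f x = rpartials s g x.
Proof.
move=> oU fg; elim: s => [|i s IH] /=; first exact: fg.
exact: eq_on_rpartial oU IH.
Qed.

Lemma eq_on_continuous U f g x : open U -> (forall x, U x -> f x = g x) ->
  U x -> {for x, continuous f} -> {for x, continuous g}.
Proof.
move=> oU fg Ux fc; rewrite /prop_for /continuous_at -(fg _ Ux).
by apply: cvg_trans fc; exact: (@near_eq_cvg _ _ (nbhs x) _ f g (near_eq_on oU fg Ux)).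
Qed.

Lemma eq_on_derivable U f g x i : open U -> (forall x, U x -> f x = g x) ->
  U x -> derivable f x (delta_mx 0 i) -> derivable g x (delta_mx 0 i).
Proof.
move=> oU fg Ux; apply: near_eq_derivable.
exact: (near_eq_on oU fg Ux).
Qed.

Lemma Ck_eq k U f g : open U -> (forall x, U x -> f x = g x) ->
  Ck k U f -> Ck k U g.
Proof.
move=> oU; elim: k f g => [|k IH] f g fg /= [fc fd]; split => //.
- by move=> x Ux; apply: (eq_on_continuous oU fg Ux); exact: fc.
- by move=> x Ux; apply: (eq_on_continuous oU fg Ux); exact: fc.
case: fd => fd fk; split.
  by move=> i x Ux; apply: (eq_on_derivable oU fg Ux); exact: fd.
move=> i; apply: (IH _ _ _ (fk i)); exact: eq_on_rpartial.
Qed.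

Lemma CkW k U f : Ck k.+1 U f -> Ck k U f.
Proof.
elim: k f => [|k IH] f [fc [fd fk]]; first by split.
by split => //; split => // i; exact: IH.
Qed.

Lemma CkS k U V f : V `<=` U -> Ck k U f -> Ck k V f.
Proof.
move=> VU; elim: k f => [|k IH] f [fc fd]; split => //.
- by move=> x /VU /fc.
- by move=> x /VU /fc.
case: fd => fd fk; split => [i x /VU /fd//|i]; exact: IH (fk i).
Qed.

Lemma rsmoothS U V f : V `<=` U -> rsmooth U f -> rsmooth V f.
Proof. move=> VU fs k; exact: (CkS VU (fs k)). Qed.

Lemma rsmooth_partial U f i : rsmooth U f -> rsmooth U (rpartial i f).
Proof. by move=> fs k; have [_ [_ H]] := fs k.+1; exact: H. Qed.

Lemma rsmooth_partials U f s : rsmooth U f -> rsmooth U (rpartials s f).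
Proof. by move=> fs; elim: s => //= i s IH; exact: rsmooth_partial. Qed.

Lemma rsmooth_cont U f x : rsmooth U f -> U x -> {for x, continuous f}.
Proof. by move=> /(_ 0%N) /Ck_cont; apply. Qed.

Lemma rsmooth_derivable U f x i : rsmooth U f -> U x ->
  derivable f x (delta_mx 0 i).
Proof. by move=> /(_ 1%N) [_ [+ _]] => /[apply]. Qed.

Lemma rsmooth_eq U f g : open U -> (forall x, U x -> f x = g x) ->
  rsmooth U f -> rsmooth U g.
Proof. by move=> oU fg fs k; exact: Ck_eq oU fg (fs k). Qed.

Lemma rsmoothP U f : rsmooth U f <-> forall s x, U x ->
  {for x, continuous (rpartials s f)} /\
  forall i, derivable (rpartials s f) x (delta_mx 0 i).
Proof.
split=> [fs s x Ux|H k].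
  have := rsmooth_partials s fs; split; first exact: rsmooth_cont Ux.
  by move=> i; exact: rsmooth_derivable Ux.
elim: k f H => [|k IH] f H; split => //.
- by move=> x Ux; have [] := H [::] x Ux.
- by move=> x Ux; have [] := H [::] x Ux.
split=> [i x Ux|i]; first by have [_] := H [::] x Ux; apply.
by apply: IH => s x Ux; rewrite -rpartials_rcons; exact: H.
Qed.

Lemma Ck_cst k U (c : R) : Ck k U (cst c).
Proof.
elim: k c => [|k IH] c; split => //; try by move=> x _; exact: cst_continuous.
split=> [i x _|i]; first exact: derivable_cst.
rewrite (_ : rpartial i _ = cst 0); first exact: IH.
by apply/funext => x; rewrite /rpartial derive_cst.
Qed.

Lemma Ck_coord k U (j : 'I_d) : Ck k U (fun x => x 0 j).
Proof.
case: k => [|k]; split => //; try by move=> x _; exact: coord_continuous.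
have df x i : is_derive x (delta_mx 0 i) (fun x : 'rV[R]_d => x 0 j)
    ((delta_mx 0 i : 'rV[R]_d) 0 j).
  split.
    by apply: diff_derivable; exact: differentiable_coord.
  rewrite /derive; apply: lim_near_cst => //=.
  near=> h; rewrite !mxE addrK [LHS]mulKf//.
  by near: h; exact: nbhs_dnbhs_neq.
split=> [i x _|i]; first by have [] := df x i.
rewrite (_ : rpartial i _ = cst ((delta_mx 0 i : 'rV[R]_d) 0 j)).
  exact: Ck_cst.
by apply/funext => x; rewrite /rpartial (@derive_val _ _ _ _ _ _ _ (df x i)).
Unshelve. all: by end_near. Qed.

Lemma CkD k U f g : open U -> Ck k U f -> Ck k U g -> Ck k U (fun x => f x + g x).
Proof.
move=> oU; elim: k f g => [|k IH] f g [fc fd] [gc gd]; split => //.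
- by move=> x Ux; exact: (cvgD (fc x Ux) (gc x Ux)).
- by move=> x Ux; exact: (cvgD (fc x Ux) (gc x Ux)).
case: fd gd => fd fk [gd gk]; split=> [i x Ux|i].
  by apply: derivableD; [exact: fd|exact: gd].
apply: (Ck_eq oU _ (IH _ _ (fk i) (gk i))) => x Ux.
by rewrite /rpartial [RHS]deriveD//; [exact: fd|exact: gd].
Qed.

Lemma CkM k U f g : open U -> Ck k U f -> Ck k U g -> Ck k U (fun x => f x * g x).
Proof.
move=> oU; elim: k f g => [|k IH] f g.
  move=> [fc fd] [gc gd]; split => //.
  by move=> x Ux; exact: (cvgM (fc x Ux) (gc x Ux)).
move=> fk1 gk1; have fk0 := CkW fk1; have gk0 := CkW gk1.
case: fk1 => fc [fd fk]; case: gk1 => gc [gd gk]; split.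
  by move=> x Ux; exact: (cvgM (fc x Ux) (gc x Ux)).
split=> [i x Ux|i].
  by apply: derivableM; [exact: fd|exact: gd].
apply: (Ck_eq oU _ (CkD oU (IH _ _ fk0 (gk i)) (IH _ _ gk0 (fk i)))) => x Ux.
by rewrite /rpartial [RHS]deriveM//; [exact: fd|exact: gd].
Qed.

Lemma Ck_sum k U (I : Type) (r : seq I) (F : I -> 'rV[R]_d -> R) : open U ->
  (forall i, Ck k U (F i)) -> Ck k U (fun x => \sum_(i <- r) F i x).
Proof.
move=> oU FC; elim: r => [|i r IH].
  by under eq_fun do rewrite big_nil; exact: Ck_cst.
by under eq_fun do rewrite big_cons; exact: CkD.
Qed.

Lemma Ck_prod k U (I : Type) (r : seq I) (F : I -> 'rV[R]_d -> R) : open U ->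
  (forall i, Ck k U (F i)) -> Ck k U (fun x => \prod_(i <- r) F i x).
Proof.
move=> oU FC; elim: r => [|i r IH].
  by under eq_fun do rewrite big_nil; exact: Ck_cst.
by under eq_fun do rewrite big_cons; exact: CkM.
Qed.

Lemma rsmooth_cst U c : rsmooth U (cst c).
Proof. by move=> k; exact: Ck_cst. Qed.
Lemma rsmooth_coord U j : rsmooth U (fun x => x 0 j).
Proof. by move=> k; exact: Ck_coord. Qed.
Lemma rsmoothD U f g : open U -> rsmooth U f -> rsmooth U g ->
  rsmooth U (fun x => f x + g x).
Proof. by move=> oU fs gs k; exact: CkD. Qed.
Lemma rsmoothM U f g : open U -> rsmooth U f -> rsmooth U g ->
  rsmooth U (fun x => f x * g x).
Proof. by move=> oU fs gs k; exact: CkM. Qed.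
Lemma rsmoothZ U c f : open U -> rsmooth U f -> rsmooth U (fun x => c * f x).
Proof. by move=> oU fs; apply: rsmoothM => //; exact: rsmooth_cst. Qed.
Lemma rsmoothN U f : open U -> rsmooth U f -> rsmooth U (fun x => - f x).
Proof.
move=> oU fs; apply: (rsmooth_eq oU _ (rsmoothZ (-1) oU fs)) => x _.
by rewrite mulN1r.
Qed.
Lemma rsmoothB U f g : open U -> rsmooth U f -> rsmooth U g ->
  rsmooth U (fun x => f x - g x).
Proof. by move=> oU fs gs; apply: rsmoothD => //; exact: rsmoothN. Qed.
Lemma rsmooth_sum U (I : Type) (r : seq I) (F : I -> 'rV[R]_d -> R) : open U ->
  (forall i, rsmooth U (F i)) -> rsmooth U (fun x => \sum_(i <- r) F i x).
Proof. by move=> oU FC k; apply: Ck_sum => // i; exact: FC. Qed.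
Lemma rsmooth_prod U (I : Type) (r : seq I) (F : I -> 'rV[R]_d -> R) : open U ->
  (forall i, rsmooth U (F i)) -> rsmooth U (fun x => \prod_(i <- r) F i x).
Proof. by move=> oU FC k; apply: Ck_prod => // i; exact: FC. Qed.

Lemma rpartialsD U f g s : open U -> rsmooth U f -> rsmooth U g ->
  forall x, U x -> rpartials s (fun x => f x + g x) x =
  rpartials s f x + rpartials s g x.
Proof.
move=> oU fs gs; elim: s => //= i s IH x Ux.
rewrite (eq_on_rpartial i oU IH Ux) {1}/rpartial deriveD//.
- exact: rsmooth_derivable (rsmooth_partials s fs) Ux.
- exact: rsmooth_derivable (rsmooth_partials s gs) Ux.
Qed.

Lemma rpartialsZ U c f s : open U -> rsmooth U f ->
  forall x, U x -> rpartials s (fun x => c * f x) x = c * rpartials s f x.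
Proof.
move=> oU fs; elim: s => //= i s IH x Ux.
rewrite (eq_on_rpartial i oU IH Ux) {1}/rpartial.
rewrite (_ : (fun x => _) = c *: rpartials s f) // deriveZ//.
exact: rsmooth_derivable (rsmooth_partials s fs) Ux.
Qed.

Lemma rpartialsN U f s : open U -> rsmooth U f ->
  forall x, U x -> rpartials s (fun x => - f x) x = - rpartials s f x.
Proof.
move=> oU fs x Ux.
rewrite -mulN1r -(rpartialsZ _ _ oU fs Ux); congr (rpartials s _ x).
by apply/funext => y; rewrite mulN1r.
Qed.

Lemma rpartialsB U f g s : open U -> rsmooth U f -> rsmooth U g ->
  forall x, U x -> rpartials s (fun x => f x - g x) x =
  rpartials s f x - rpartials s g x.
Proof.
move=> oU fs gs x Ux; rewrite (rpartialsD _ oU fs (rsmoothN oU gs) Ux).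
by rewrite (rpartialsN _ oU gs Ux).
Qed.

End Basics.
End RealSmooth.

(** * The chain rule and the symmetry of second derivatives *)

Section Calculus.
Context {R : realType}.

Lemma coord_le_norm d (x : 'rV[R]_d) j : `|x 0 j| <= `|x|.
Proof.
rewrite [leRHS]/Num.norm /= mx_normrE.
exact: (le_bigmax _ (fun ij : 'I_1 * 'I_d => `|x ij.1 ij.2|) (0, j)).
Qed.

Lemma row_norm_le d (x : 'rV[R]_d) (B : R) : 0 <= B ->
  (forall j, `|x 0 j| <= B) -> `|x| <= B.
Proof.
move=> B0 H; rewrite [leLHS]/Num.norm /= mx_normrE.
by apply: bigmax_le => // -[i j] _ /=; rewrite (ord1 i).
Qed.

Lemma line_is_derive d (f : 'rV[R]_d -> R) x v (t : R) :
  derivable f (x + t *: v) v ->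
  is_derive t 1 (fun s => f (x + s *: v)) ('D_v f (x + t *: v)).
Proof.
move=> df.
have E : (fun h : R => h^-1 *: (((fun s => f (x + s *: v)) \o shift t) (h *: (1 : R))
     - f (x + t *: v))) =
  (fun h : R => h^-1 *: ((f \o shift (x + t *: v)) (h *: v) - f (x + t *: v))).
  apply/funext => h /=; congr (_ *: (f _ - _)).
  by rewrite [h *: 1]mulr1 scalerDl addrCA.
by split; [rewrite /derivable|rewrite /derive]; rewrite E.
Qed.

Lemma line_MVT d (f : 'rV[R]_d -> R) x v (h : R) :
  (forall t, 0 <= t <= 1 -> derivable f (x + (t * h) *: v) v) ->
  exists2 t, 0 <= t <= 1 &
    f (x + h *: v) - f x = h * 'D_v f (x + (t * h) *: v).
Proof.
move=> H.
pose g s := f (x + s *: v).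
have [->|h0] := eqVneq h 0.
  by exists 0; rewrite ?lexx ?ler01// scale0r addr0 subrr mul0r.
have Hs (s : R) : 0 <= s / h <= 1 -> is_derive s 1 g ('D_v f (x + s *: v)).
  move=> sh; apply: line_is_derive.
  by have := H _ sh; rewrite divfK.
have cg a b : (forall s, s \in `[a, b] -> 0 <= s / h <= 1) ->
    {within `[a, b], continuous g}.
  move=> ab; apply: derivable_within_continuous => s /ab /Hs ds.
  exact: ex_derive.
have oc (a b s : R) : s \in `]a, b[ -> s \in `[a, b].
  by rewrite !in_itv /= => /andP[/ltW -> /ltW ->].
case: (ltgtP h 0) h0 => // hh _.
- have ab s : s \in `[h, 0] -> 0 <= s / h <= 1.
    rewrite in_itv /= => /andP[s1 s2].
    by rewrite ler_ndivlMr// mul0r s2 ler_ndivrMr// mul1r s1.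
  have [c /[dup] /oc cI _] := MVT hh (fun s si => Hs s (ab s (oc _ _ _ si))) (cg _ _ ab).
  rewrite sub0r /g scale0r addr0 => e.
  exists (c / h); first exact: ab.
  by rewrite divfK ?lt_eqF// -[LHS]opprB e mulrN opprK mulrC.
- have ab s : s \in `[0, h] -> 0 <= s / h <= 1.
    rewrite in_itv /= => /andP[s1 s2].
    by rewrite ler_pdivlMr// mul0r s1 ler_pdivrMr// mul1r s2.
  have [c /[dup] /oc cI _] := MVT hh (fun s si => Hs s (ab s (oc _ _ _ si))) (cg _ _ ab).
  rewrite subr0 /g scale0r addr0 => e.
  exists (c / h); first exact: ab.
  by rewrite divfK ?gt_eqF// e mulrC.
Qed.

(** The points [x + head_row h k], for [k] from [0] to [d], join [x] to [x + h] by
    segments parallel to the axes, on which the increments of a function are controlled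
    by its partial derivatives. *)
Definition head_row d (h : 'rV[R]_d) (k : nat) : 'rV[R]_d :=
  \row_j (if (j < k)%N then h 0 j else 0).

Lemma head_row0 d (h : 'rV[R]_d) : head_row h 0 = 0.
Proof. by apply/rowP => j; rewrite !mxE. Qed.

Lemma head_row_full d (h : 'rV[R]_d) : head_row h d = h.
Proof. by apply/rowP => j; rewrite !mxE ltn_ord. Qed.

Lemma head_rowS d (h : 'rV[R]_d) (k : 'I_d) :
  head_row h k.+1 = head_row h k + h 0 k *: delta_mx 0 k.
Proof.
apply/rowP => j; rewrite !mxE ltnS leq_eqVlt; have [/val_inj ->|jk] /= := eqVneq (val j) k.
  by rewrite !eqxx ltnn add0r mulr1.
rewrite (_ : (j == k) = false) ?mulr0 ?addr0//.
by apply/negbTE; apply: contra jk => /eqP ->.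
Qed.

Lemma head_row_near d (h : 'rV[R]_d) (k : 'I_d) t : 0 <= t <= 1 ->
  `|head_row h k + (t * h 0 k) *: delta_mx 0 k| <= `|h|.
Proof.
move=> /andP[t0 t1]; apply: row_norm_le => // j; rewrite !mxE.
have [->|jk] := eqVneq j k.
  rewrite ltnn add0r eqxx mulr1 normrM ger0_norm//.
  by apply: le_trans (coord_le_norm h k); rewrite ler_piMl.
by rewrite andbF mulr0 addr0; case: ifP => _; rewrite ?normr0// coord_le_norm.
Qed.

Lemma norm_near0 d (r : R) : 0 < r -> \forall h \near (0 : 'rV[R]_d), `|h| < r.
Proof.
move=> r0; apply/nbhs_ballP; exists r => //= z.
by rewrite -ball_normE /ball_ /= sub0r normrN.
Qed.

(** The mean value theorem on each segment of the path [head_row]; the partial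
    derivatives are close to their values at [x] because they are continuous. *)
Lemma C1_expand d (U : set 'rV[R]_d) f x : open U -> Ck 1 U f -> U x ->
  forall eps, 0 < eps -> \forall h \near (0 : 'rV[R]_d),
  `|f (h + x) - f x - \sum_j h 0 j * rpartial j f x| <= eps * `|h|.
Proof.
move=> oU [fc [fd fk]] Ux eps eps0.
have e1 : 0 < eps / d.+1%:R by rewrite divr_gt0.
have : \forall y \near x, U y /\ forall j : 'I_d, `|rpartial j f x - rpartial j f y| <= eps / d.+1%:R.
  near=> y; split; first by near: y; exact: near_openP.
  near: y; apply: filter_forall => j.
  have [+ _] := fk j; move=> /(_ _ Ux) /cvgrPdist_le; exact.
move=> /nbhs_ballP[r /= r0 Hr].
near=> h.
have hr : `|h| < r by near: h; exact: norm_near0.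
have inb k : `|k| <= `|h| -> ball x r (x + k).
  move=> kh; rewrite -ball_normE /ball_ /= opprD addNKr normrN.
  exact: le_lt_trans hr.
have -> : f (h + x) - f x = \sum_(j < d) (f (x + head_row h j.+1) - f (x + head_row h j)).
  rewrite -(big_mkord predT (fun j => f (x + head_row h j.+1) - f (x + head_row h j))).
  by rewrite telescope_sumr// head_row0 head_row_full addr0 [h + x]addrC.
rewrite -sumrB.
apply: (@le_trans _ _ (\sum_(j < d) eps / d.+1%:R * `|h|)).
  apply: le_trans (ler_norm_sum _ _ _) _; apply: ler_sum => j _.
  rewrite head_rowS addrA.
  have [t t01 ->] : exists2 t, 0 <= t <= 1 &
      f (x + head_row h j + h 0 j *: delta_mx 0 j) - f (x + head_row h j) =
      h 0 j * 'D_(delta_mx 0 j) f (x + head_row h j + (t * h 0 j) *: delta_mx 0 j).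
    apply: line_MVT => t t01; apply: fd.
    by rewrite -addrA; have [] := Hr _ (inb _ (head_row_near h j t01)).
  rewrite -mulrBr normrM mulrC; apply: ler_pM => //; last exact: coord_le_norm.
  rewrite -addrA distrC.
  by have [_] := Hr _ (inb _ (head_row_near h j t01)); apply.
rewrite sumr_const card_ord -mulrnAl ler_wpM2r// -mulr_natr -mulrA.
by rewrite ger_pMr// mulrC ler_pdivrMr// mul1r ler_nat.
Unshelve. all: by end_near. Qed.

Lemma C1_differentiable d (U : set 'rV[R]_d) f x : open U -> Ck 1 U f -> U x ->
  differentiable f x.
Proof.
move=> oU fC Ux.
pose L (h : 'rV[R]_d) : R := \sum_j h 0 j * rpartial j f x.
have linL : linear L.
  move=> a u v; rewrite /L scaler_sumr -big_split /=; apply: eq_bigr => j _.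
  by rewrite !mxE mulrDl -mulrA.
pose LM := GRing.isLinear.Build _ _ _ _ _ linL.
pose Llin : {linear 'rV[R]_d -> R} := HB.pack L LM.
have Lc : continuous Llin.
  have LC : Ck 0 setT L.
    by apply: Ck_sum openT _ => j; apply: CkM openT _ _; [exact: Ck_coord|exact: Ck_cst].
  by move=> y; exact: (Ck_cont LC).
have E eps : 0 < eps -> \forall h \near (0 : 'rV[R]_d),
    `|f (h + x) - (f x + L h)| <= eps * `|h|.
  move=> eps0; have := C1_expand oU fC Ux eps0; apply: filterS => h.
  by rewrite opprD addrA.
have D : 'd f x = Llin :> ('rV[R]_d -> R).
  by apply: diff_unique => //; apply/eqaddoP => eps eps0; exact: E.
apply/diff_locallyP; rewrite D; split => //.
by apply/eqaddoP => eps eps0; exact: E.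
Qed.

Lemma derive_sum_basis d (U : set 'rV[R]_d) f x v : open U -> Ck 1 U f -> U x ->
  'D_v f x = \sum_j v 0 j * rpartial j f x.
Proof.
move=> oU fC Ux; have df := C1_differentiable oU fC Ux.
rewrite deriveE// {1}(row_sum_delta v) linear_sum; apply: eq_bigr => j _.
by rewrite linearZ /= -deriveE.
Qed.

Lemma is_derive_comp_path m (V : set 'rV[R]_m) f (g : R -> 'rV[R]_m) t :
  open V -> Ck 1 V f -> V (g t) ->
  (forall j, derivable (fun s => g s 0 j) t 1) ->
  is_derive t 1 (fun s => f (g s))
    (\sum_j rpartial j f (g t) * 'D_1 (fun s => g s 0 j) t).
Proof.
move=> oV fC Vg gd.
have dg : derivable g t 1 by apply/derivable_mxP => i j; rewrite (ord1 i).
have dg' : differentiable g t by apply/derivable1_diffP.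
have df := C1_differentiable oV fC Vg.
have dfg : differentiable (f \o g) t by exact: differentiable_comp.
split; first by apply/derivable1_diffP.
rewrite -[fun s => _]/(f \o g) deriveE// diff_comp// /= -(deriveE (1 : R) dg').
rewrite -(deriveE _ df) (derive_sum_basis _ oV fC Vg); apply: eq_bigr => j _.
by rewrite mulrC derive_mx// mxE.
Qed.

Lemma is_derive_comp m d (V : set 'rV[R]_m) f (Y : 'rV[R]_d -> 'rV[R]_m) x v :
  open V -> Ck 1 V f -> V (Y x) ->
  (forall j, derivable (fun z => Y z 0 j) x v) ->
  is_derive x v (fun z => f (Y z))
    (\sum_j rpartial j f (Y x) * 'D_v (fun z => Y z 0 j) x).
Proof.
move=> oV fC Vx dY.
have x0 : x = x + 0 *: v by rewrite scale0r addr0.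
have dY' j : is_derive (0 : R) 1 (fun s => Y (x + s *: v) 0 j) ('D_v (fun z => Y z 0 j) x).
  have := @line_is_derive d (fun z => Y z 0 j) x v 0; rewrite -x0; exact.
have [] := @is_derive_comp_path m V f (fun s => Y (x + s *: v)) 0 oV fC.
- by rewrite -x0.
- by move=> j; have [] := dY' j.
rewrite -x0 => H1 H2.
have E : (fun h : R => h^-1 *: (((fun s => f (Y (x + s *: v))) \o shift 0) (h *: (1 : R))
     - f (Y (x + 0 *: v)))) =
  (fun h : R => h^-1 *: (((fun z => f (Y z)) \o shift x) (h *: v) - f (Y x))).
  apply/funext => h /=; rewrite -x0; congr (_ *: (f (Y _) - _)).
  by rewrite addr0 [h *: 1]mulr1 addrC.
split; first by move: H1; rewrite /derivable E.
move: H2; rewrite {1}/derive E => H2.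
rewrite /derive H2; apply: eq_bigr => j _.
by have [_ ->] := dY' j.
Qed.

Lemma cvg_rowP d (T : Type) (F : set_system T) {FF : Filter F}
    (Y : T -> 'rV[R]_d) (l : 'rV[R]_d) :
  (forall j, (Y z 0 j) @[z --> F] --> l 0 j) -> Y @ F --> l.
Proof.
move=> H; apply/cvgrPdist_le => e e0; near=> y.
apply: row_norm_le; first exact: ltW.
near: y; apply: filter_forall => j.
have /cvgrPdist_le/(_ _ e0) := H j; apply: filterS => y.
by rewrite !mxE.
Unshelve. all: by end_near. Qed.

(** By induction on the order: a partial derivative of the composition is a sum of
    products of functions of order one less. *)
Lemma Ck_comp k m d (V : set 'rV[R]_m) (U : set 'rV[R]_d) f (Y : 'rV[R]_d -> 'rV[R]_m) :
  open V -> open U -> (forall x, U x -> V (Y x)) ->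
  Ck k V f -> (forall j, Ck k U (fun x => Y x 0 j)) -> Ck k U (fun x => f (Y x)).
Proof.
move=> oV oU UV; have Ycont k' : (forall j, Ck k' U (fun x => Y x 0 j)) ->
    forall x, U x -> {for x, continuous Y}.
  move=> YC x Ux; apply: (@cvg_rowP _ _ (nbhs x) _ Y (Y x)) => j; exact: Ck_cont (YC j) _ Ux.
elim: k f => [|k IH] f.
  move=> [fc _] YC; split => // x Ux.
  by apply: continuous_comp; [exact: Ycont YC x Ux|exact: fc (UV _ Ux)].
move=> fC1 YC1.
have YC j := CkW (YC1 j).
have [fc [fd fk]] := fC1; split=> [x Ux|].
  by apply: continuous_comp; [exact: Ycont YC x Ux|exact: fc (UV _ Ux)].
have f1 : Ck 1 V f by elim: {+}k fC1 => // k' IHk /CkW.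
have D i x : U x -> is_derive x (delta_mx 0 i) (fun z => f (Y z))
    (\sum_j rpartial j f (Y x) * rpartial i (fun z => Y z 0 j) x).
  move=> Ux; apply: (is_derive_comp oV f1 (UV _ Ux)) => j.
  by have [_ [+ _]] := YC1 j; exact.
split=> [i x Ux|i]; first by have [] := D i x Ux.
apply: (@Ck_eq _ _ _ _ (fun x => \sum_j rpartial j f (Y x) * rpartial i (fun z => Y z 0 j) x)) => //.
  by move=> x Ux; rewrite /rpartial; case: (D i x Ux) => _ ->.
apply: Ck_sum => // j; apply: CkM => //; first exact: (IH _ (fk j) YC).
by have [_ [_]] := YC1 j; exact.
Qed.

Lemma rsmooth_comp m d (V : set 'rV[R]_m) (U : set 'rV[R]_d) f (Y : 'rV[R]_d -> 'rV[R]_m) :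
  open V -> open U -> (forall x, U x -> V (Y x)) ->
  rsmooth V f -> (forall j, rsmooth U (fun x => Y x 0 j)) -> rsmooth U (fun x => f (Y x)).
Proof. by move=> oV oU VU fs Ys k; apply: (Ck_comp oV oU VU (fs k)) => j; exact: Ys. Qed.

Lemma rpartial_comp m d (V : set 'rV[R]_m) (U : set 'rV[R]_d) f (Y : 'rV[R]_d -> 'rV[R]_m) x i :
  open V -> rsmooth V f -> U x -> V (Y x) ->
  (forall j, rsmooth U (fun x => Y x 0 j)) ->
  rpartial i (fun z => f (Y z)) x =
  \sum_j rpartial j f (Y x) * rpartial i (fun z => Y z 0 j) x.
Proof.
move=> oV fs Ux Vx Ys.
have [] := @is_derive_comp _ _ V f Y x (delta_mx 0 i) oV (fs 1%N) Vx.
  by move=> j; exact: rsmooth_derivable (Ys j) Ux.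
by [].
Qed.

Lemma is_derive_translate d (f : 'rV[R]_d -> R) y v c : derivable f (y + c) v ->
  is_derive y v (fun z => f (z + c)) ('D_v f (y + c)).
Proof.
move=> df.
have E : (fun h : R => h^-1 *: (((fun z => f (z + c)) \o shift y) (h *: v) - f (y + c))) =
         (fun h : R => h^-1 *: ((f \o shift (y + c)) (h *: v) - f (y + c))).
  by apply/funext => h /=; rewrite addrA.
by split; [rewrite /derivable|rewrite /derive]; rewrite E.
Qed.

(** Two applications of the mean value theorem. The left-hand side is symmetric in [i]
    and [j], whence [rpartialC]. *)
Lemma second_difference d (U : set 'rV[R]_d) f x i j h r :
  rsmooth U f -> 0 < h -> 2 * h < r -> ball x r `<=` U ->
  exists2 y, ball x r y &
    f (x + h *: delta_mx 0 i + h *: delta_mx 0 j) - f (x + h *: delta_mx 0 i)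
    - (f (x + h *: delta_mx 0 j) - f x) = h * (h * rpartial j (rpartial i f) y).
Proof.
move=> fs h0 hr xU.
have nd (k : 'I_d) : `|delta_mx 0 k : 'rV[R]_d| <= 1.
  apply: row_norm_le => // l; rewrite mxE eqxx /=.
  by case: eqP => _; rewrite ?normr1 ?normr0.
have inb s t : 0 <= s <= 1 -> 0 <= t <= 1 ->
    ball x r (x + (s * h) *: delta_mx 0 i + (t * h) *: delta_mx 0 j).
  move=> /andP[s0 s1] /andP[t0 t1].
  rewrite -ball_normE /ball_ /= -addrA opprD addNKr normrN.
  apply: le_lt_trans hr; apply: le_trans (ler_normD _ _) _.
  have nb (a : R) k : 0 <= a -> a <= 1 -> `|(a * h) *: (delta_mx 0 k : 'rV[R]_d)| <= h.
    move=> a0 a1; rewrite normrZ ger0_norm ?mulr_ge0 ?(ltW h0)//.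
    apply: (@le_trans _ _ (a * h * 1)); first by rewrite ler_wpM2l ?mulr_ge0 ?(ltW h0).
    by rewrite mulr1 ger_pMl.
  by rewrite mulr_natl mulr2n; apply: lerD; exact: nb.
pose g z := f (z + h *: delta_mx 0 j) - f z.
have dU k (z : 'rV[R]_d) : U z -> derivable f z (delta_mx 0 k).
  by move=> Uz; exact: rsmooth_derivable fs Uz.
have gd z : U z -> U (z + h *: delta_mx 0 j) -> is_derive z (delta_mx 0 i) g
   (rpartial i f (z + h *: delta_mx 0 j) - rpartial i f z).
  move=> Uz Uz'; apply: is_deriveB; first exact/is_derive_translate/dU.
  by apply/derivableP/dU.
have I0 : 0 <= (0 : R) <= 1 by rewrite lexx ler01.
have I1 : 0 <= (1 : R) <= 1 by rewrite lexx ler01.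
have inU0 t : 0 <= t <= 1 -> U (x + (t * h) *: delta_mx 0 i).
  by move=> /inb/(_ I0); rewrite mul0r scale0r addr0; exact: xU.
have inU1 t : 0 <= t <= 1 -> U (x + (t * h) *: delta_mx 0 i + h *: delta_mx 0 j).
  by move=> /inb/(_ I1); rewrite mul1r; exact: xU.
have [t t01] : exists2 t, 0 <= t <= 1 & g (x + h *: delta_mx 0 i) - g x =
    h * 'D_(delta_mx 0 i) g (x + (t * h) *: delta_mx 0 i).
  by apply: line_MVT => t t01; have [] := gd _ (inU0 _ t01) (inU1 _ t01).
have [_ ->] := gd _ (inU0 _ t01) (inU1 _ t01).
have [s s01 ->] : exists2 s, 0 <= s <= 1 &
   rpartial i f (x + (t * h) *: delta_mx 0 i + h *: delta_mx 0 j) -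
   rpartial i f (x + (t * h) *: delta_mx 0 i) =
   h * 'D_(delta_mx 0 j) (rpartial i f) (x + (t * h) *: delta_mx 0 i + (s * h) *: delta_mx 0 j).
  apply: line_MVT => s s01.
  by apply: rsmooth_derivable (rsmooth_partial i fs) _; apply: xU; exact: inb.
by exists (x + (t * h) *: delta_mx 0 i + (s * h) *: delta_mx 0 j); [exact: inb|].
Qed.

Lemma nbhs_ball2 d (x : 'rV[R]_d) (P Q : set 'rV[R]_d) : nbhs x P -> nbhs x Q ->
  exists2 r, 0 < r & forall y, ball x r y -> P y /\ Q y.
Proof.
move=> Px Qx; have : \forall y \near x, P y /\ Q y by exact: filterI.
by move=> /nbhs_ballP[r /= r0 Hr]; exists r.
Qed.

Lemma dist_half (a b c e : R) : `|a - c| <= e / 2 -> `|b - c| <= e / 2 -> `|b - a| <= e.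
Proof.
by rewrite !ler_norml => /andP[? ?] /andP[? ?]; apply/andP; split; lra.
Qed.

(** Both mixed derivatives take a common value at points arbitrarily close to [x],
    by [second_difference], and both are continuous. *)
Lemma rpartialC d (U : set 'rV[R]_d) f x i j : open U -> rsmooth U f -> U x ->
  rpartial i (rpartial j f) x = rpartial j (rpartial i f) x.
Proof.
move=> oU fs Ux; apply/eqP; rewrite -subr_eq0 -normr_le0.
apply/ler_addgt0Pr => e e0; rewrite add0r.
have e2 : 0 < e / 2 by rewrite divr_gt0.
have cont k l := rsmooth_cont (rsmooth_partial k (rsmooth_partial l fs)) Ux.
have /cvgrPdist_le/(_ _ e2) A1 := cont i j.
have /cvgrPdist_le/(_ _ e2) A2 := cont j i.
have [r r0 Hr] := nbhs_ball2 (near_openP oU Ux) (@filterI _ (nbhs x) _ _ _ A1 A2).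
have xU : ball x r `<=` U by move=> y /Hr[].
have h0 : 0 < r / 3 by rewrite divr_gt0.
have hr : 2 * (r / 3) < r by lra.
have [y1 /Hr[_ [_ b1]] E1] := second_difference i j fs h0 hr xU.
have [y2 /Hr[_ [b2 _]] E2] := second_difference j i fs h0 hr xU.
have E : rpartial j (rpartial i f) y1 = rpartial i (rpartial j f) y2.
  move: E1 E2 h0; rewrite [x + _ + _ *: delta_mx 0 j]addrAC.
  move: (r / 3) (rpartial j _ _) (rpartial i _ _) => h a b E1 E2 h0.
  apply: (@mulfI _ h); first by rewrite gt_eqF.
  apply: (@mulfI _ h); first by rewrite gt_eqF.
  by rewrite -E1 -E2; ring.
rewrite E in b1.
exact: dist_half b1 b2.
Qed.

Lemma rpartials_partialC d (U : set 'rV[R]_d) f x i s : open U -> rsmooth U f -> U x ->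
  rpartials s (rpartial i f) x = rpartial i (rpartials s f) x.
Proof.
move=> oU fs; elim: s x => //= j s IH x Ux.
rewrite (eq_on_rpartial j oU IH Ux).
by apply: rpartialC oU (rsmooth_partials s fs) Ux.
Qed.

End Calculus.

(** * A functional applied to a smooth family of test functions *)

Section Joint.
Context {R : realType}.

(** There are finitely many derivatives of order at most [k]. *)
Lemma near_short (d k : nat) (I : Type) (F : set_system I) {FF : Filter F}
    (P : seq 'I_d -> I -> Prop) :
  (forall s, \forall i \near F, P s i) ->
  \forall i \near F, forall s, (size s <= k)%N -> P s i.
Proof.
move=> H.
have : \forall i \near F, forall s : {bseq k of 'I_d}, P s i.
  by apply: filter_forall => s; exact: H.
apply: filterS => i Hi s sk.
exact: (Hi (Bseq sk)).
Qed.

Lemma row_mx_norm m d (z : 'rV[R]_m) (r : 'rV[R]_d) e :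
  `|z| < e -> `|r| < e -> `|row_mx z r| < e.
Proof.
move=> ze re; apply: (@le_lt_trans _ _ (Num.max `|z| `|r|)); last by rewrite gt_max ze re.
apply: row_norm_le => [|j]; first by rewrite le_max normr_ge0.
rewrite mxE; case: (splitP j) => k _.
  by rewrite le_max coord_le_norm.
by rewrite le_max coord_le_norm orbT.
Qed.

Lemma row_mxB m d (z z' : 'rV[R]_m) (r r' : 'rV[R]_d) :
  row_mx z r - row_mx z' r' = row_mx (z - z') (r - r').
Proof. by rewrite opp_row_mx add_row_mx. Qed.

Lemma near_row_mx m d (z : 'rV[R]_m) (r : 'rV[R]_d) (P : set 'rV[R]_(m + d)) :
  (\forall w \near row_mx z r, P w) ->
  \forall r' \near r & z' \near z, P (row_mx z' r').
Proof.
move=> /nbhs_ballP[e /= e0 He].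
exists (ball r e, ball z e) => /=; first by split; exact: nbhsx_ballx.
move=> [r' z'] /= [rr' zz']; apply: He.
move: rr' zz'; rewrite -!ball_normE /ball_ /= => rr' zz'.
by rewrite row_mxB row_mx_norm.
Qed.

(** The tube lemma around the slice [{z} x K]. *)
Lemma tube m d (z : 'rV[R]_m) (K : set 'rV[R]_d) (P : set 'rV[R]_(m + d)) :
  compact K -> (forall r, K r -> \forall w \near row_mx z r, P w) ->
  \forall z' \near z, forall r, K r -> P (row_mx z' r).
Proof.
move=> /compact_near_coveringP cK H.
have := cK _ (nbhs z) (fun z' r => P (row_mx z' r)) _.
by apply=> r /H /near_row_mx.
Qed.

Lemma tube_cvg m d (z : 'rV[R]_m) (K : set 'rV[R]_d) (Phi : 'rV[R]_(m + d) -> R) :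
  compact K -> (forall r, K r -> {for row_mx z r, continuous Phi}) ->
  forall e : R, 0 < e -> \forall z' \near z, forall r, K r ->
    `|Phi (row_mx z' r) - Phi (row_mx z r)| <= e.
Proof.
move=> /compact_near_coveringP cK H e e0.
have e2 : 0 < e / 2 by rewrite divr_gt0.
have := cK _ (nbhs z) (fun z' r => `|Phi (row_mx z' r) - Phi (row_mx z r)| <= e) _.
apply=> r Kr.
have /cvgrPdist_le/(_ _ e2) : Phi w @[w --> row_mx z r] --> Phi (row_mx z r) := H _ Kr.
move=> /near_row_mx [[A B] /= [Ar Bz] AB].
exists (A, B) => //= -[r' z'] /= [Ar' Bz'].
have h1 := AB (r', z') (conj Ar' Bz').
have h2 := AB (r', z) (conj Ar' (nbhs_singleton Bz)).
move: h1 h2 => /=; move: (Phi _) (Phi _) (Phi _) => a b c h1 h2.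
by apply: (@dist_half _ a b c); rewrite distrC.
Qed.

Lemma delta_rshift m d (i : 'I_d) :
  (delta_mx 0 (rshift m i) : 'rV[R]_(m + d)) = row_mx 0 (delta_mx 0 i).
Proof.
apply/rowP => j; rewrite !mxE eqxx /=.
case: (splitP j) => k jk; rewrite ?mxE.
  rewrite (_ : (j == _) = false)//; apply/negbTE/eqP => e.
  by have := ltn_ord k; rewrite -jk e /= ltnNge leq_addr.
by rewrite eqxx /= -!val_eqE /= jk eqn_add2l.
Qed.

Lemma delta_lshift m d (i : 'I_m) :
  (delta_mx 0 (lshift d i) : 'rV[R]_(m + d)) = row_mx (delta_mx 0 i) 0.
Proof.
apply/rowP => j; rewrite !mxE eqxx /=.
case: (splitP j) => k jk; rewrite ?mxE.
  by rewrite eqxx /= -!val_eqE /= jk.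
rewrite (_ : (j == _) = false)//; apply/negbTE/eqP => e.
have := ltn_ord i; rewrite -[X in (X < _)%N]/(nat_of_ord (lshift d i)) -e jk.
by rewrite ltnNge leq_addr.
Qed.

Lemma rpartial_rslice m d (Phi : 'rV[R]_(m + d) -> R) z i (r : 'rV[R]_d) :
  rpartial i (fun r => Phi (row_mx z r)) r = rpartial (rshift m i) Phi (row_mx z r).
Proof.
rewrite /rpartial /derive; congr (lim (_ @ 0^')); apply/funext => h /=.
rewrite delta_rshift scale_row_mx add_row_mx scaler0 add0r.
by [].
Qed.

Lemma rpartial_lslice m d (Phi : 'rV[R]_(m + d) -> R) (z : 'rV[R]_m) i (r : 'rV[R]_d) :
  rpartial i (fun z => Phi (row_mx z r)) z = rpartial (lshift d i) Phi (row_mx z r).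
Proof.
rewrite /rpartial /derive; congr (lim (_ @ 0^')); apply/funext => h /=.
rewrite delta_lshift scale_row_mx add_row_mx scaler0 add0r.
by [].
Qed.

Lemma derivable_lslice m d (Phi : 'rV[R]_(m + d) -> R) (z : 'rV[R]_m) i (r : 'rV[R]_d) :
  derivable Phi (row_mx z r) (delta_mx 0 (lshift d i)) ->
  derivable (fun z => Phi (row_mx z r)) z (delta_mx 0 i).
Proof.
rewrite /derivable => H.
rewrite (_ : (fun h : R => _) = (fun h : R => h^-1 *: ((Phi \o shift (row_mx z r)) (h *: delta_mx 0 (lshift d i)) - Phi (row_mx z r)))) //.
apply/funext => h /=.
by rewrite delta_lshift scale_row_mx add_row_mx scaler0 add0r.
Qed.

Lemma rpartials_rslice m d (Phi : 'rV[R]_(m + d) -> R) z s :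
  rpartials s (fun r => Phi (row_mx z r)) =
  fun r => rpartials (map (@rshift m d) s) Phi (row_mx z r).
Proof.
elim: s => //= i s ->; apply/funext => r; exact: rpartial_rslice.
Qed.

Lemma rsmooth_rslice m d (W : set 'rV[R]_(m + d)) (U : set 'rV[R]_d) Phi z :
  open W -> open U -> (forall r, U r -> W (row_mx z r)) -> rsmooth W Phi ->
  rsmooth U (fun r => Phi (row_mx z r)).
Proof.
move=> oW oU UW Ps; apply: (rsmooth_comp oW oU UW Ps) => j.
rewrite (_ : (fun x => _) = (fun x : 'rV[R]_d => match fintype.split j with inl k => z 0 k | inr k => x 0 k end)).
  by case: (fintype.split j) => k; [exact: rsmooth_cst|exact: rsmooth_coord].
by apply/funext => x; rewrite mxE.
Qed.

Lemma open_lpart m d (Om : set 'rV[R]_m) : open Om ->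
  open [set w : 'rV[R]_(m + d) | Om (lsubmx w)].
Proof.
move=> oO; apply: open_comp => // w _.
apply: (@cvg_rowP _ _ _ (nbhs w) _ (@lsubmx R 1 m d) (lsubmx w)) => j.
rewrite mxE (_ : (fun z => _) = (fun z : 'rV[R]_(m + d) => z 0 (lshift d j))).
  exact: coord_continuous.
by apply/funext => z; rewrite mxE.
Qed.

(** By the mean value theorem the error of the difference quotient is an increment
    of the derivative, which is uniformly small over the compact set [K] of the
    second variable. *)
Lemma diff_quot_cvg m d (W : set 'rV[R]_(m + d)) Phi (z : 'rV[R]_m) (K : set 'rV[R]_d) i :
  open W -> rsmooth W Phi -> compact K -> (forall r, K r -> W (row_mx z r)) ->
  forall e : R, 0 < e -> \forall h \near (0 : R)^', forall r, K r ->
   `|h^-1 * (Phi (row_mx (z + h *: delta_mx 0 i) r) - Phi (row_mx z r))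
      - rpartial (lshift d i) Phi (row_mx z r)| <= e.
Proof.
move=> oW Ps cK KW e e0.
have N1 : \forall z' \near z, forall r, K r -> W (row_mx z' r).
  by apply: (tube cK) => r Kr; apply: near_openP => //; exact: KW.
have N2 := tube_cvg cK (fun r Kr => rsmooth_cont (rsmooth_partial (lshift d i) Ps) (KW r Kr)) e0.
have [rho rho0 H] := nbhs_ball2 N1 N2.
near=> h.
have h0 : h != 0 by near: h; exact: nbhs_dnbhs_neq.
have hr : `|h| < rho by near: h; exact: dnbhs0_lt.
have inb t : 0 <= t <= 1 -> ball z rho (z + (t * h) *: delta_mx 0 i).
  move=> /andP[t0 t1]; rewrite -ball_normE /ball_ /= opprD addNKr normrN.
  apply: le_lt_trans hr; apply: row_norm_le => // j; rewrite !mxE normrM.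
  case: (_ && _); rewrite ?normr0 ?mulr0// normr1 mulr1 normrM ger0_norm//.
  by rewrite ler_piMl.
move=> r Kr.
have [t t01 E] : exists2 t, 0 <= t <= 1 &
   Phi (row_mx (z + h *: delta_mx 0 i) r) - Phi (row_mx z r) =
   h * 'D_(delta_mx 0 i) (fun z => Phi (row_mx z r)) (z + (t * h) *: delta_mx 0 i).
  apply: (@line_MVT _ _ (fun z => Phi (row_mx z r))) => t t01.
  have [/(_ _ Kr) Wt _] := H _ (inb _ t01).
  by apply: derivable_lslice; exact: rsmooth_derivable Ps Wt.
rewrite E mulKf// -[X in `|X - _|]/(rpartial i (fun z => Phi (row_mx z r)) _) rpartial_lslice.
by have [_] := H _ (inb _ t01); apply.
Unshelve. all: by end_near. Qed.

Definition rtest d (K : set 'rV[R]_d) (f : 'rV[R]_d -> R) :=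
  rsmooth setT f /\ forall x, ~ K x -> f x = 0.

(** The real and imaginary parts of a distribution, on the real test functions
    supported in [K]. *)
Definition rfunctional d (K : set 'rV[R]_d) (lam : ('rV[R]_d -> R) -> R) :=
  (forall a f g, rtest K f -> rtest K g ->
     lam (fun x => a * f x + g x) = a * lam f + lam g) /\
  exists k (M : R), 0 <= M /\ forall f (B : R), rtest K f -> 0 <= B ->
    (forall s x, (size s <= k)%N -> K x -> `|rpartials s f x| <= B) -> `|lam f| <= M * B.

Lemma rtestL d (K : set 'rV[R]_d) a f g : rtest K f -> rtest K g ->
  rtest K (fun x => a * f x + g x).
Proof.
move=> [fs f0] [gs g0]; split; first by apply: rsmoothD openT _ _ => //; exact: rsmoothZ openT _.
by move=> x Kx; rewrite f0// g0// mulr0 addr0.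
Qed.

Lemma rfunctionalB d (K : set 'rV[R]_d) lam f g : rfunctional K lam ->
  rtest K f -> rtest K g -> lam (fun x => f x - g x) = lam f - lam g.
Proof.
move=> [lin _] fK gK; rewrite (_ : (fun x => _) = (fun x => (-1) * g x + f x)).
  by rewrite lin// mulN1r addrC.
by apply/funext => x; rewrite mulN1r addrC.
Qed.

Section Pairing.
Variables (m d : nat) (Om : set 'rV[R]_m) (K : set 'rV[R]_d) (lam : ('rV[R]_d -> R) -> R).
Hypotheses (oOm : open Om) (cK : compact K) (lamP : rfunctional K lam).

Let W : set 'rV[R]_(m + d) := [set w | Om (lsubmx w)].

(** The first [m] coordinates are the parameter of a family of test functions of the
    last [d] coordinates, supported in the fixed compact set [K]. *)
Definition joint_test (Phi : 'rV[R]_(m + d) -> R) :=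
  rsmooth W Phi /\ forall z r, Om z -> ~ K r -> Phi (row_mx z r) = 0.

Let oW : open W. Proof. exact: open_lpart. Qed.

Let inW z r : Om z -> W (row_mx z r).
Proof. by rewrite /W /= row_mxKl. Qed.

Lemma joint_test_slice Phi z : joint_test Phi -> Om z -> rtest K (fun r => Phi (row_mx z r)).
Proof.
move=> [Ps P0] Oz; split; last by move=> r; exact: P0.
by apply: (rsmooth_rslice oW openT _ Ps) => r _; exact: inW.
Qed.

Lemma joint_test_partial Phi i : joint_test Phi -> joint_test (rpartial (lshift d i) Phi).
Proof.
move=> [Ps P0]; split; first exact: rsmooth_partial.
move=> z r Oz Kr; rewrite -rpartial_lslice.
rewrite (@eq_on_rpartial _ _ Om _ (cst 0) i oOm _ z Oz).
  by rewrite /rpartial derive_cst.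
by move=> z' Oz'; rewrite P0.
Qed.

(** A functional of finite order is continuous for the uniform convergence on [K] of all
    derivatives. *)
Lemma pairing_cvg (T : Type) (F : set_system T) {FF : Filter F} (g : T -> 'rV[R]_d -> R) g0 :
  rtest K g0 -> (\forall t \near F, rtest K (g t)) ->
  (forall s (e : R), 0 < e -> \forall t \near F, forall r, K r ->
     `|rpartials s (g t) r - rpartials s g0 r| <= e) ->
  lam (g t) @[t --> F] --> lam g0.
Proof.
move=> g0K gK H; apply/cvgrPdist_le => e e0.
have [_ [k [M [M0 HM]]]] := lamP.
have e1 : 0 < e / (M + 1) by rewrite divr_gt0// ltr_wpDl.
have NS := @near_short d k T F FF _ (fun s => H s _ e1).
near=> t.
have gtK : rtest K (g t) by near: t.
have Ht : forall s, (size s <= k)%N -> forall r, K r ->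
  `|rpartials s (g t) r - rpartials s g0 r| <= e / (M + 1) by near: t.
rewrite distrC -(rfunctionalB lamP gtK g0K).
apply: le_trans (HM _ (e / (M + 1)) _ (ltW e1) _) _.
- rewrite (_ : (fun x => _) = (fun x => (-1) * g0 x + g t x)); first exact: rtestL.
  by apply/funext => x; rewrite mulN1r addrC.
- move=> s r sk Kr; rewrite (rpartialsB s openT gtK.1 g0K.1)//.
  exact: Ht.
- by rewrite mulrCA ger_pMr// ler_pdivrMr ?ltr_wpDl// mul1r lerDl.
Unshelve. all: by end_near. Qed.

(** Difference quotients in the parameter converge in the test function topology,
    so that derivatives pass under [lam]. *)
Lemma pairing_derive Phi z i : joint_test Phi -> Om z ->
  is_derive z (delta_mx 0 i) (fun z => lam (fun r => Phi (row_mx z r)))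
    (lam (fun r => rpartial (lshift d i) Phi (row_mx z r))).
Proof.
move=> Pt Oz.
have Pz := joint_test_slice Pt Oz.
have Oh : \forall h \near (0 : R)^', Om (z + h *: delta_mx 0 i).
  have : {for 0, continuous (fun h : R => z + h *: (delta_mx 0 i : 'rV[R]_m))}.
    by apply: cvgD; [exact: cvg_cst|exact: scalel_continuous].
  move=> /(_ Om); rewrite /= scale0r addr0 => /(_ (near_openP oOm Oz)) H.
  exact: nbhs_dnbhs.
have C : (h^-1 * (lam (fun r => Phi (row_mx (z + h *: delta_mx 0 i) r)) - lam (fun r => Phi (row_mx z r))))
   @[h --> 0^'] --> lam (fun r => rpartial (lshift d i) Phi (row_mx z r)).
  apply: (@cvg_trans _ (lam (fun r => h^-1 * (Phi (row_mx (z + h *: delta_mx 0 i) r) - Phi (row_mx z r))) @[h --> 0^'])).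
    apply: near_eq_cvg; move: Oh; apply: filterS => h Oh.
    have Ph := joint_test_slice Pt Oh.
    rewrite -(rfunctionalB lamP Ph Pz).
    have [lin _] := lamP.
    have t0 : rtest K (fun=> 0) by split => // ; exact: rsmooth_cst.
    have t1 : rtest K (fun r => Phi (row_mx (z + h *: delta_mx 0 i) r) - Phi (row_mx z r)).
      rewrite (_ : (fun x => _) = (fun x => (-1) * Phi (row_mx z x) + Phi (row_mx (z + h *: delta_mx 0 i) x))); first exact: rtestL.
      by apply/funext => x; rewrite mulN1r addrC.
    have L0 : lam (fun=> 0) = 0.
      by have := rfunctionalB lamP t0 t0; rewrite subr0 subrr.
    have := lin h^-1 _ _ t1 t0; rewrite L0 addr0 => <-; congr lam.
    by apply/funext => x; rewrite addr0.
  apply: pairing_cvg.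
  - exact: joint_test_slice (joint_test_partial i Pt) Oz.
  - move: Oh; apply: filterS => h Oh; have Ph := joint_test_slice Pt Oh.
    rewrite (_ : (fun r => _) = (fun r => h^-1 * Phi (row_mx (z + h *: delta_mx 0 i) r) + ((- h^-1) * Phi (row_mx z r) + 0))).
      apply: rtestL => //; apply: rtestL => //.
      by split => // ; exact: rsmooth_cst.
    by apply/funext => x; rewrite addr0 mulrBr mulNr.
  move=> s e e0.
  have N := @diff_quot_cvg m d W (rpartials (map (@rshift m d) s) Phi) z K i oW
    (rsmooth_partials _ Pt.1) cK (fun r _ => inW r Oz) e e0.
  near=> h.
  have Oh' : Om (z + h *: delta_mx 0 i) by near: h.
  move=> r Kr.
  have : `|h^-1 * (rpartials (map (@rshift m d) s) Phi (row_mx (z + h *: delta_mx 0 i) r)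
     - rpartials (map (@rshift m d) s) Phi (row_mx z r))
      - rpartial (lshift d i) (rpartials (map (@rshift m d) s) Phi) (row_mx z r)| <= e.
    by move: r Kr; near: h.
  have Ph := joint_test_slice Pt Oh'.
  have Bs : rsmooth setT (fun r => Phi (row_mx (z + h *: delta_mx 0 i) r) - Phi (row_mx z r)).
    by apply: rsmoothB openT _ _; [exact: Ph.1|exact: Pz.1].
  rewrite (rpartialsZ _ _ openT Bs)// (rpartialsB _ openT Ph.1 Pz.1)//.
  rewrite !rpartials_rslice.
  by rewrite (rpartials_partialC _ _ oW Pt.1 (inW r Oz)).
have E : (fun h : R => h^-1 *: (((fun z => lam (fun r => Phi (row_mx z r))) \o shift z) (h *: delta_mx 0 i) -
     lam (fun r => Phi (row_mx z r)))) =
  (fun h => h^-1 * (lam (fun r => Phi (row_mx (z + h *: delta_mx 0 i) r)) - lam (fun r => Phi (row_mx z r)))).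
  by apply/funext => h /=; rewrite [h *: _ + z]addrC.
split; first by rewrite /derivable E; apply/cvg_ex; eexists; exact: C.
by rewrite /derive E; exact: cvg_lim C.
Unshelve. all: by end_near. Qed.

Lemma pairing_cont Phi z : joint_test Phi -> Om z ->
  {for z, continuous (fun z => lam (fun r => Phi (row_mx z r)))}.
Proof.
move=> Pt Oz; apply: (@pairing_cvg _ (nbhs z) _ (fun z r => Phi (row_mx z r))); first exact: joint_test_slice.
  by apply: filterS (near_openP oOm Oz) => z'; exact: joint_test_slice.
move=> s e e0; rewrite rpartials_rslice.
have := tube_cvg cK (fun r Kr => rsmooth_cont
  (rsmooth_partials (map (@rshift m d) s) Pt.1) (inW r Oz)) e0.
by apply: filterS => z' H r Kr; rewrite rpartials_rslice; exact: H.
Qed.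

(** By induction on the order, since the partial derivatives in the parameter again form
    a family of the same kind, with derivative given by [pairing_derive]. *)
Lemma pairing_smooth Phi : joint_test Phi -> rsmooth Om (fun z => lam (fun r => Phi (row_mx z r))).
Proof.
move=> Pt k; elim: k Phi Pt => [|k IH] Phi Pt.
  by split=> // z Oz; exact: pairing_cont.
split; first by move=> z Oz; exact: pairing_cont.
split=> [i z Oz|i]; first by have [] := pairing_derive i Pt Oz.
apply: (Ck_eq oOm _ (IH _ (joint_test_partial i Pt))) => z Oz.
by rewrite /rpartial; case: (pairing_derive i Pt Oz) => _ ->.
Qed.

Lemma joint_test_partials Phi s : joint_test Phi ->
  joint_test (rpartials (map (@lshift m d) s) Phi).
Proof. by move=> Pt; elim: s => //= i s IH; exact: joint_test_partial. Qed.

Lemma rpartials_pairing Phi s z : joint_test Phi -> Om z ->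
  rpartials s (fun z => lam (fun r => Phi (row_mx z r))) z =
  lam (fun r => rpartials (map (@lshift m d) s) Phi (row_mx z r)).
Proof.
move=> Pt; elim: s z => //= i s IH z Oz.
rewrite (eq_on_rpartial i oOm IH Oz) /rpartial.
by case: (pairing_derive i (joint_test_partials s Pt) Oz) => _ ->.
Qed.

End Pairing.
End Joint.

(** * Flat functions and bumps *)

Section Bumps.
Context {R : realType}.

(** By induction on [k]: a class closed under differentiation consists of [C^k]
    functions for all [k] at once. *)
Lemma rsmooth_class (I : set R) (Q : (R -> R) -> Prop) : open I ->
  (forall phi, Q phi -> exists psi, Q psi /\
    forall x, I x -> is_derive x 1 phi (psi x)) ->
  forall phi, Q phi -> rsmooth [set w : 'rV[R]_1 | I (w 0 0)] (fun w => phi (w 0 0)).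
Proof.
move=> oI H; have oW : open [set w : 'rV[R]_1 | I (w 0 0)].
  by apply: open_comp => // w _; exact: coord_continuous.
move=> phi Qp k; elim: k phi Qp => [|k IH] phi Qp.
  split=> // w Iw; have [psi [_ /(_ _ Iw) D]] := H _ Qp.
  have c : {for w 0 0, continuous phi}.
    by apply: differentiable_continuous; apply/derivable1_diffP.
  exact: (@continuous_comp _ _ _ (fun w : 'rV[R]_1 => w 0 0) phi w (@coord_continuous _ _ _ 0 0 w) c).
have [psi [Qpsi D]] := H _ Qp.
have Di i (w : 'rV[R]_1) : I (w 0 0) -> is_derive w (delta_mx 0 i) (fun w => phi (w 0 0)) (psi (w 0 0)).
  move=> Iw; have [D1 D2] := D _ Iw.
  have E : (fun h : R => h^-1 *: (((fun w : 'rV[R]_1 => phi (w 0 0)) \o shift w) (h *: delta_mx 0 i) - phi (w 0 0))) =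
     (fun h : R => h^-1 *: ((phi \o shift (w 0 0)) (h *: (1:R)) - phi (w 0 0))).
    by apply/funext => h /=; rewrite !mxE (ord1 i) eqxx.
  by split; [rewrite /derivable E|rewrite /derive E].
have C : forall w : 'rV[R]_1, I (w 0 0) -> {for w, continuous (fun w : 'rV[R]_1 => phi (w 0 0))}.
  move=> w Iw; have [/= D1 _] := D _ Iw.
  have c : {for w 0 0, continuous phi}.
    by apply: differentiable_continuous; apply/derivable1_diffP.
  exact: (@continuous_comp _ _ _ (fun w : 'rV[R]_1 => w 0 0) phi w (@coord_continuous _ _ _ 0 0 w) c).
split=> [w Iw|]; first exact: C.
split=> [i w Iw|i]; first by have [] := Di i w Iw.
apply: (Ck_eq oW _ (IH _ Qpsi)) => w Iw.
by rewrite /rpartial; case: (Di i w Iw) => _ ->.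
Qed.

Lemma rsmooth_comp1 (I : set R) d (U : set 'rV[R]_d) phi h : open I -> open U ->
  rsmooth [set w : 'rV[R]_1 | I (w 0 0)] (fun w => phi (w 0 0)) ->
  rsmooth U h -> (forall x, U x -> I (h x)) -> rsmooth U (fun x => phi (h x)).
Proof.
move=> oI oU phis hs UI.
have oW : open [set w : 'rV[R]_1 | I (w 0 0)].
  by apply: open_comp => // w _; exact: coord_continuous.
have := @rsmooth_comp R 1 d _ U _ (fun x => \row_j h x) oW oU _ phis _.
rewrite (_ : (fun x => _) = (fun x => phi (h x))); last first.
  by apply/funext => x; rewrite mxE.
apply; first by move=> x Ux; rewrite /= mxE; exact: UI.
move=> j; rewrite (_ : (fun x => _) = h) //.
by apply/funext => x; rewrite mxE.
Qed.

Lemma is_derive_inv (x : R) : x != 0 -> is_derive x 1 (fun y : R => y^-1) (- x^-1 ^+ 2).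
Proof.
move=> x0; split; first by apply: (@derivableV _ _ id).
rewrite (@deriveV _ _ id) // derive_id /= exprVn.
by rewrite [LHS]mulr1.
Qed.

Lemma is_deriveVn c n (x : R) : x != 0 ->
  is_derive x 1 (fun y => c * y^-1 ^+ n) (- (c *+ n) * x^-1 ^+ n.+1).
Proof.
move=> x0.
have DV := is_derive_inv x0.
have DX := is_deriveX n DV.
have -> : (fun y : R => c * y^-1 ^+ n) = cst c * (fun y : R => y^-1) ^+ n.
  by apply/funext => y; rewrite exprfctE.
apply: (is_derive_eq (is_deriveM (is_derive_cst c x 1) DX)).
rewrite scaler0 addr0.
case: n DX => [|n] _; first by rewrite mul0r scale0r scaler0 mulr0n oppr0 mul0r.
rewrite -[LHS]/(c * ((n.+1%:R * x^-1 ^+ n) * (- x^-1 ^+ 2))) -mulr_natl !exprS.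
ring.
Qed.

Lemma rsmooth_inv d (U : set 'rV[R]_d) h : open U -> rsmooth U h ->
  (forall x, U x -> h x != 0) -> rsmooth U (fun x => (h x)^-1).
Proof.
move=> oU hs h0.
pose Q (phi : R -> R) := exists c n, phi = fun y => c * y^-1 ^+ n.
have oI : open [set y : R | y != 0].
  rewrite (_ : [set _ | _] = ~` [set 0]); first exact/closed_openC/closed_eq.
  by apply/seteqP; split => y /= /eqP.
apply: (@rsmooth_comp1 [set y : R | y != 0] d U (fun y => y^-1)) => //.
apply: (@rsmooth_class _ Q) => //.
  move=> _ [c [n ->]]; exists (fun y => - (c *+ n) * y^-1 ^+ n.+1); split.
    by exists (- (c *+ n)), n.+1.
  by move=> x /= x0; exact: is_deriveVn.
by exists 1, 1%N; apply/funext => y; rewrite expr1 mul1r.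
Qed.

(** With [p = 1] this is the flat function [exp (- 1 / x)]; the polynomial factor makes
    the class stable under differentiation. *)
Definition flat (p : {poly R}) (x : R) : R :=
  if 0 < x then p.[x^-1] * expR (- x^-1) else 0.

Lemma poly_le_exp (p : {poly R}) : exists C : R, forall y, 0 <= y -> `|p.[y]| <= C * expR y.
Proof.
have mono n : exists C : R, forall y : R, 0 <= y -> y ^+ n <= C * expR y.
  case: n => [|n].
    by exists 1 => y y0; rewrite expr0 mul1r; apply: le_trans (expR_ge1Dx y); rewrite lerDl.
  exists n.+1`!%:R => y y0; rewrite mulrC -ler_pdivrMr ?ltr0n ?fact_gt0//.
  by apply: le_trans (expR_ge1Dxn n y0); rewrite lerDr.
have [C HC] := choice mono.
exists (\sum_(i < size p) `|p`_i| * C i) => y y0.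
rewrite horner_coef mulr_suml; apply: le_trans (ler_norm_sum _ _ _) _.
apply: ler_sum => i _; rewrite normrM -mulrA ler_wpM2l//.
by rewrite ger0_norm ?exprn_ge0// HC.
Qed.

(** Away from [0] this is computed; at [0] the difference quotient tends to [0] because
    the exponential dominates polynomials. *)
Lemma flat_derive (p : {poly R}) (x : R) :
  is_derive x 1 (flat p) (flat ('X^2 * (p - p^`())) x).
Proof.
have [x0|x0|->] := ltgtP x 0.
- have -> : flat ('X^2 * (p - p^`())) x = 0 by rewrite /flat ltNge (ltW x0).
  apply: (@near_eq_is_derive _ _ _ (cst 0)).
    near=> y; rewrite /flat /= ltNge ltW//.
    by near: y; exact: lt_nbhsl.
- rewrite {2}/flat x0.
  apply: (@near_eq_is_derive _ _ _ (fun y : R => p.[y^-1] * expR (- y^-1) : R)).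
    near=> y; rewrite /flat /= ifT//.
    by near: y; exact: lt_nbhsr.
  have xn : x != 0 by rewrite gt_eqF.
  have DV := is_derive_inv xn.
  have D1 := is_derive1_comp (is_derive_poly p (x^-1)) DV.
  have D2 := @is_derive1_comp _ expR (fun y => - y^-1) x _ _ (is_derive_expR (- x^-1)) (is_deriveN DV).
  apply: (is_derive_eq (is_deriveM D1 D2)).
  rewrite /= !(hornerE, hornerXn) opprK.
  rewrite -![_ *: _]/(_ * _); ring.
have -> : flat ('X^2 * (p - p^`())) 0 = 0 by rewrite /flat ltxx.
have [C HC] := poly_le_exp ('X^2 * p).
have C0 : 0 <= C.
  by have := HC 0 (lexx _); rewrite expR0 mulr1; apply: le_trans.
have H : h^-1 *: (flat p (h *: (1:R) + 0) - flat p 0) @[h --> 0^'] --> (0 : R).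
  apply/cvgrPdist_le => e e0; near=> h.
  have h0 : h != 0 by near: h; exact: nbhs_dnbhs_neq.
  have he : `|h| < e / (C + 1).
    by near: h; apply: dnbhs0_lt; rewrite divr_gt0// ltr_wpDl.
  rewrite sub0r normrN addr0 [h *: 1]mulr1 {2}/flat ltxx subr0 /flat.
  case: ifP => [hp|_]; last by rewrite scaler0 normr0 ltW.
  rewrite -[_ *: _]/(_ * _) !normrM (ger0_norm (expR_ge0 _)) expRN.
  have := HC h^-1; rewrite invr_ge0 ltW// => /(_ isT).
  rewrite !(hornerE, hornerXn) normrM normrX => H.
  rewrite -(ler_pM2l (x := `|h^-1|)) ?normr_gt0 ?invr_eq0//.
  rewrite [X in X <= _](_ : _ = `|h^-1| ^+ 2 * `|p.[h^-1]| / expR h^-1); last by rewrite expr2 !mulrA.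
  rewrite ler_pdivrMr ?expR_gt0//.
  apply: (le_trans H); rewrite ler_wpM2r ?expR_ge0//.
  rewrite normfV mulrC ler_pdivlMr ?normr_gt0//.
  have : C * `|h| <= (C + 1) * `|h| by rewrite ler_wpM2r// lerDl.
  move/le_trans; apply; rewrite mulrC -ler_pdivlMr ?ltr_wpDl//.
  exact: ltW.
split; first by rewrite /derivable; apply/cvg_ex; exists 0.
exact: cvg_lim H.
Unshelve. all: by end_near. Qed.

Definition flat1 : R -> R := flat 1.

Lemma flat1_smooth d (U : set 'rV[R]_d) h : open U -> rsmooth U h ->
  rsmooth U (fun x => flat1 (h x)).
Proof.
move=> oU hs; apply: (@rsmooth_comp1 setT d U flat1) => //; first exact: openT.
apply: (@rsmooth_class setT (fun phi => exists p, phi = flat p)) => //.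
- exact: openT.
- move=> _ [p ->]; exists (flat ('X^2 * (p - p^`()))); split; first by eexists.
  by move=> x _; exact: flat_derive.
- by exists 1.
Qed.

Lemma flat1_gt0 x : 0 < x -> 0 < flat1 x.
Proof. by move=> x0; rewrite /flat1 /flat x0 hornerC mul1r expR_gt0. Qed.

Lemma flat1_le0 x : x <= 0 -> flat1 x = 0.
Proof. by move=> x0; rewrite /flat1 /flat ltNge x0. Qed.

Lemma flat1_ge0 x : 0 <= flat1 x.
Proof. by case: (leP x 0) => [/flat1_le0 ->//|/flat1_gt0/ltW]. Qed.

(** The denominator never vanishes, since [x] or [1 - x] is positive. *)
Definition step (x : R) : R := flat1 x / (flat1 x + flat1 (1 - x)).

Lemma step_den x : 0 < flat1 x + flat1 (1 - x).
Proof.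
case: (leP x 0) => x0.
  by rewrite ltr_wpDl ?flat1_ge0// flat1_gt0// subr_gt0 (le_lt_trans x0).
by rewrite ltr_wpDr ?flat1_ge0// flat1_gt0.
Qed.

Lemma step1 x : 1 <= x -> step x = 1.
Proof.
move=> x1; rewrite /step [flat1 (1 - x)]flat1_le0 ?subr_le0// addr0 divff//.
by rewrite gt_eqF// flat1_gt0// (lt_le_trans _ x1).
Qed.

Lemma step0 x : x <= 0 -> step x = 0.
Proof. by move=> x0; rewrite /step flat1_le0// mul0r. Qed.

Lemma step_smooth d (U : set 'rV[R]_d) h : open U -> rsmooth U h ->
  rsmooth U (fun x => step (h x)).
Proof.
move=> oU hs; have h1 : rsmooth U (fun x => flat1 (h x)) by exact: flat1_smooth.
apply: rsmoothM => //; apply: rsmooth_inv => //; last first.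
  by move=> x _; rewrite gt_eqF// step_den.
apply: rsmoothD => //; apply: flat1_smooth => //; apply: rsmoothB => //.
exact: rsmooth_cst.
Qed.

(** The factor of a coordinate is [1] at distance at most [r] from the centre and [0] at
    distance at least [2 r], by [step1] and [step0]. *)
Definition box_bump d (c : 'rV[R]_d) (r : R) (x : 'rV[R]_d) : R :=
  \prod_(i < d) (step (2 - r^-1 * (x 0 i - c 0 i)) * step (2 + r^-1 * (x 0 i - c 0 i))).

Lemma box_bump_smooth d (c : 'rV[R]_d) r : rsmooth setT (box_bump c r).
Proof.
apply: rsmooth_prod openT _ => i.
have L : rsmooth setT (fun x : 'rV[R]_d => r^-1 * (x 0 i - c 0 i)).
  apply: rsmoothZ openT _; apply: rsmoothB openT _ _; first exact: rsmooth_coord.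
  exact: rsmooth_cst.
apply: rsmoothM openT _ _; apply: step_smooth openT _.
  by apply: rsmoothB openT _ _ => //; exact: rsmooth_cst.
by apply: rsmoothD openT _ _ => //; exact: rsmooth_cst.
Qed.

Lemma box_bump1 d (c x : 'rV[R]_d) r : 0 < r -> `|x - c| <= r -> box_bump c r x = 1.
Proof.
move=> r0 xr; apply: big1 => i _.
have := le_trans (coord_le_norm (x - c) i) xr; rewrite !mxE ler_norml => /andP[h1 h2].
have a : r^-1 * (x 0 i - c 0 i) <= 1 by rewrite mulrC ler_pdivrMr// mul1r.
have b : -1 <= r^-1 * (x 0 i - c 0 i) by rewrite mulrC ler_pdivlMr// mulN1r.
by rewrite !step1 ?mulr1//; move: (r^-1 * _) a b => z; lra.
Qed.

Lemma box_bump0 d (c x : 'rV[R]_d) r : 0 < r -> 2 * r <= `|x - c| -> box_bump c r x = 0.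
Proof.
move=> r0 xr.
have [i Hi] : exists i, 2 * r <= `|x 0 i - c 0 i|.
  apply: contrapT => /forallNP H.
  have : `|x - c| < 2 * r.
    have r2 : 0 < 2 * r by rewrite mulr_gt0.
    rewrite [ltLHS]/Num.norm /= mx_normrE; apply: bigmax_lt => // -[j i] _.
    by rewrite (ord1 j) /= !mxE ltNge; apply/negP; exact: H.
  by rewrite ltNge xr.
rewrite /box_bump (bigD1 i)//= .
move: Hi; rewrite ler_normr => /orP[] Hi.
  rewrite [step (2 - _)]step0 ?mul0r// subr_le0 mulrC ler_pdivlMr//.
rewrite [step (2 + r^-1 * (_ - _))]step0 ?mulr0 ?mul0r//.
rewrite -[r^-1 * _]opprK subr_le0 -mulrN mulrC ler_pdivlMr//.
Qed.

(** * Cutoffs and exhaustions *)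

(** The compact set [L] outside which [chi] vanishes and the neighbourhood [W] of [A] on
    which it is [1] are kept as data, for use when two cutoffs are compared. *)
Definition cutoff_spec d (U A : set 'rV[R]_d) (chi : 'rV[R]_d -> R) (L W : set 'rV[R]_d) :=
  [/\ rsmooth setT chi, compact L, L `<=` U, open W & A `<=` W] /\
  (forall x, W x -> chi x = 1) /\ (forall x, ~ L x -> chi x = 0).

Lemma row_hausdorff d : hausdorff_space 'rV[R]_d.
Proof. exact: norm_hausdorff. Qed.

Lemma norm_dist_continuous d (x : 'rV[R]_d) : continuous (fun y : 'rV[R]_d => `|y - x|).
Proof. move=> y; apply/(@cvgrPdist_le _ _ _ (nbhs y)) => e e0; apply/nbhs_ballP; exists e => //= z.
rewrite -ball_normE /ball_ /= => yz; apply: le_trans (ler_dist_dist _ _) _.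
by rewrite opprB addrA subrK ltW. Qed.

Lemma cutoff_point d (U : set 'rV[R]_d) x : open U -> U x ->
  exists chi L W, cutoff_spec U [set x] chi L W.
Proof.
move=> oU Ux; have /nbhs_ballP[e /= e0 He] := near_openP oU Ux.
pose r := e / 3; have r0 : 0 < r by rewrite divr_gt0.
exists (box_bump x r), [set y | `|y - x| <= 2 * r], (ball x r); split; [split|split].
- exact: box_bump_smooth.
- apply: bounded_closed_compact.
    exists (`|x| + 2 * r); split; first exact: num_real.
    move=> M HM y /= yx; apply: le_trans (ltW HM).
    by rewrite -{1}(subrK x y) addrC; apply: le_trans (ler_normD _ _) _; rewrite lerD2l.
  rewrite (_ : [set _ | _] = (fun y => `|y - x|) @^-1` [set z | z <= 2 * r]); last by [].
  by apply: closed_comp; [move=> y _; exact: norm_dist_continuous|exact: closed_le].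
- move=> y /= yx; apply: He; rewrite -ball_normE /ball_ /= distrC.
  by apply: (le_lt_trans yx); rewrite /r; lra.
- exact: ball_open.
- by move=> _ ->; exact: ballxx.
- move=> y; rewrite -ball_normE /ball_ /= distrC => yx.
  by apply: box_bump1 => //; exact: ltW.
- move=> y /= /negP; rewrite -ltNge => yx.
  by apply: box_bump0 => //; exact: ltW.
Qed.

(** [1 - (1 - chi1) (1 - chi2)] is [1] where one of the two cutoffs is. *)
Lemma cutoffU d (U A B : set 'rV[R]_d) :
  (exists chi L W, cutoff_spec U A chi L W) ->
  (exists chi L W, cutoff_spec U B chi L W) ->
  exists chi L W, cutoff_spec U (A `|` B) chi L W.
Proof.
move=> [c1 [L1 [W1 [[s1 k1 u1 o1 a1] [e1 z1]]]]] [c2 [L2 [W2 [[s2 k2 u2 o2 a2] [e2 z2]]]]].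
exists (fun x => 1 - (1 - c1 x) * (1 - c2 x)), (L1 `|` L2), (W1 `|` W2); split; [split|split].
- have h1 := rsmoothB openT (rsmooth_cst setT 1) s1.
  have h2 := rsmoothB openT (rsmooth_cst setT 1) s2.
  exact: rsmoothB openT (rsmooth_cst setT 1) (rsmoothM openT h1 h2).
- exact: compactU.
- by move=> x [/u1|/u2].
- exact: openU.
- by move=> x [/a1|/a2]; [left|right].
- by move=> x [/e1 ->|/e2 ->]; rewrite subrr ?mulr0 ?mul0r subr0.
- move=> x H; rewrite z1 ?z2 ?subr0 ?mulr1 ?subrr// => ?; apply: H; by [left|right].
Qed.

Lemma cutoff0 d (U : set 'rV[R]_d) : exists chi L W, cutoff_spec U set0 chi L W.
Proof.
exists (fun=> 0), set0, set0; split; [split|split] => //.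
- exact: rsmooth_cst.
- exact: compact0.
Qed.

Lemma cutoff d (U K : set 'rV[R]_d) : open U -> compact K -> K `<=` U ->
  exists chi L W, cutoff_spec U K chi L W.
Proof.
move=> oU; rewrite compact_cover => cK KU.
have /choice[W HW] : forall x, exists W, K x -> [/\ open W, W x & exists chi L, cutoff_spec U W chi L W].
  move=> x; have [Kx|nKx] := pselect (K x); last by exists set0.
  have [chi [L [W [[s1 k1 u1 o1 a1] [e1 z1]]]]] := cutoff_point oU (KU _ Kx).
  exists W => _; split => //; first exact: a1.
  by exists chi, L; split=> //; split.
have [D DK KD] := cK _ K W (fun x Kx => let: And3 o _ _ := HW x Kx in o)
  (fun x Kx => ex_intro2 _ _ x Kx (let: And3 _ w _ := HW x Kx in w)).
set A := cover _ W in KD.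
have [chi [L [W' [[s1 k1 u1 o1 a1] [e1 z1]]]]] :
    exists chi L W', cutoff_spec U A chi L W'.
  rewrite /A /cover bigcup_fset.
  have : forall x, x \in finmap.enum_fset D -> K x by move=> x xD; apply/set_mem/DK.
  elim: (finmap.enum_fset D) => [|x s IH] H; first by rewrite big_nil; exact: cutoff0.
  rewrite big_cons; apply: cutoffU.
    have [_ _ [chi [L ?]]] := HW x (H _ (mem_head _ _)).
    by exists chi, L, (W x).
  by apply: IH => y ys; apply: H; rewrite inE ys orbT.
exists chi, L, W'; split; [split|split] => //.
by move=> x /KD; exact: a1.
Qed.

(** The points of norm at most [j] at distance at least [1 / (j + 1)] from the complement
    of [U]. *)
Lemma exhaustion d (U : set 'rV[R]_d) : open U -> exists K : nat -> set 'rV[R]_d,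
  [/\ forall j, compact (K j), forall j, K j `<=` U, forall i j, (i <= j)%N -> K i `<=` K j &
      forall C, compact C -> C `<=` U -> exists j, C `<=` interior (K j)].
Proof.
move=> oU.
pose K j := [set x : 'rV[R]_d | `|x - 0| <= j%:R] `&`
  \bigcap_(y in ~` U) [set x : 'rV[R]_d | j.+1%:R^-1 <= `|x - y|].
have clK j : closed (K j).
  apply: closedI.
    rewrite (_ : [set _ | _] = (fun y : 'rV[R]_d => `|y - 0|) @^-1` [set z | z <= j%:R]); last by [].
    by apply: closed_comp; [move=> y _; exact: norm_dist_continuous|exact: closed_le].
  apply: closed_bigI => y _.
  rewrite (_ : [set _ | _] = (fun x : 'rV[R]_d => `|x - y|) @^-1` [set z | j.+1%:R^-1 <= z]); last by [].
  by apply: closed_comp; [move=> z _; exact: norm_dist_continuous|exact: closed_ge].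
exists K; split.
- move=> j; apply: bounded_closed_compact => //.
  exists j%:R; split; first exact: num_real.
  by move=> M HM y [/= yj _]; rewrite -(subr0 y); apply: le_trans (ltW HM).
- move=> j x [_ Kx]; apply: contrapT => /Kx /=.
  by rewrite subrr normr0 leNgt invr_gt0 ltr0n.
- move=> i j ij x [xi Kx]; split; first by apply: le_trans xi _; rewrite ler_nat.
  move=> y /Kx /=; apply: le_trans.
  by rewrite lef_pV2 ?posrE ?ltr0n// ler_nat.
move=> C /compact_near_coveringP cC CU.
have : \forall j \near \oo, C `<=` interior (K j).
  apply: (cC _ \oo (fun j x => interior (K j) x)) => x Cx.
  have /nbhs_ballP[e /= e0 He] := near_openP oU (CU _ Cx).
  have e2 : 0 < e / 2 by rewrite divr_gt0.
  exists (ball x (e / 2), [set j | `|x| + e / 2 <= j%:R /\ (e / 2)^-1 <= j%:R]) => /=.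
    split; first exact: nbhsx_ballx.
    by apply: filterI; exact: nbhs_infty_ger.
  move=> [x' j] /= [xx' [j1 j2]].
  have bK : ball x (e / 2) `<=` K j.
    move=> z xz; have {}xz : `|x - z| < e / 2 by move: xz; rewrite -ball_normE.
    split.
      rewrite /= subr0; apply: le_trans j1.
      rewrite -[z](subKr x); apply: le_trans (ler_normB _ _) _.
      by rewrite lerD2l ltW.
    move=> y /= Uy.
    have : e <= `|x - y|.
      rewrite leNgt; apply/negP => xy; apply: Uy; apply: He.
      by rewrite -ball_normE.
    have : `|x - y| <= `|x - z| + `|z - y| by rewrite -[x - y](subrKA z) ler_normD.
    have : j.+1%:R^-1 <= e / 2.
      rewrite invf_ple ?posrE ?ltr0n//; apply: (le_trans j2).
      by rewrite ler_nat.
    by move: xz; move: `|x - z| `|z - y| `|x - y| (j.+1%:R^-1) => a b c f; lra.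
  apply: (filterS bK); apply: open_nbhs_nbhs; split => //; exact: ball_open.
by move=> [j _ Hj]; exists j; exact: (Hj j (leqnn j)).
Qed.

End Bumps.

(** * Moderate and negligible families over a scale *)

Section Scales.
Context {R : realType}.

(** Over the set [Z], and relative to the scale [ep], [A] is negligible for [b = true] and
    moderate for [b = false]. The two notions are treated together, as both are stable
    under multiplication by moderate families, see [bndM]. *)
Definition bnd (T : Type) (b : bool) (ep : T -> R) (Z : set T) (A : T -> R) : Prop :=
  if b then forall N, exists C : R, forall w, Z w -> `|A w| <= C * ep w ^+ N
  else exists N (C : R), forall w, Z w -> `|A w| <= C * (ep w)^-1 ^+ N.

Section Bnd.
Context {T : Type} (ep : T -> R) (Z : set T).
Hypothesis epZ : forall w, Z w -> 0 < ep w <= 1.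

Let ep0 w : Z w -> 0 < ep w. Proof. by move=> /epZ /andP[]. Qed.
Let epV1 w : Z w -> 1 <= (ep w)^-1.
Proof. by move=> /epZ /andP[e0 e1]; rewrite invf_ge1. Qed.

Lemma bnd_false_pos A : bnd false ep Z A -> exists N (C : R), 0 <= C /\
  forall M, (N <= M)%N -> forall w, Z w -> `|A w| <= C * (ep w)^-1 ^+ M.
Proof.
move=> [N [C H]]; exists N, `|C|; split => // M NM w Zw.
apply: (le_trans (H _ Zw)); apply: le_trans (ler_norm _) _.
rewrite normrM ler_wpM2l// ger0_norm; first by apply: ler_weXn2l NM; exact: epV1.
by rewrite exprn_ge0// ltW// invr_gt0 ep0.
Qed.

Lemma bnd_true_pos A : bnd true ep Z A -> forall N, exists2 C : R, 0 <= C &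
  forall w, Z w -> `|A w| <= C * ep w ^+ N.
Proof.
move=> H N; have [C HC] := H N; exists `|C| => // w Zw.
apply: (le_trans (HC _ Zw)); apply: le_trans (ler_norm _) _.
rewrite normrM ler_wpM2l// ger0_norm//.
by rewrite exprn_ge0// ltW// ep0.
Qed.

Lemma bnd_eq b A B : (forall w, Z w -> A w = B w) -> bnd b ep Z A -> bnd b ep Z B.
Proof.
move=> AB; case: b => [H N|[N [C H]]].
  by have [C HC] := H N; exists C => w Zw; rewrite -AB// HC.
by exists N, C => w Zw; rewrite -AB// H.
Qed.

Lemma bnd_cst b : bnd b ep Z (fun=> 0).
Proof.
case: b => [N|]; first by exists 0 => w _; rewrite normr0 mul0r.
by exists 0%N, 0 => w _; rewrite normr0 mul0r.
Qed.

Lemma bnd_bounded A (B : R) : (forall w, Z w -> `|A w| <= B) -> bnd false ep Z A.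
Proof. by move=> H; exists 0%N, B => w Zw; rewrite expr0 mulr1 H. Qed.

Lemma bndD b A B : bnd b ep Z A -> bnd b ep Z B -> bnd b ep Z (fun w => A w + B w).
Proof.
case: b => [HA HB N|/bnd_false_pos[NA [CA [CA0 HA]]] /bnd_false_pos[NB [CB [CB0 HB]]]].
  have [CA hA] := HA N; have [CB hB] := HB N.
  exists (CA + CB) => w Zw; apply: le_trans (ler_normD _ _) _.
  by rewrite mulrDl; apply: lerD; [exact: hA|exact: hB].
exists (NA + NB)%N, (CA + CB) => w Zw; apply: le_trans (ler_normD _ _) _.
rewrite mulrDl; apply: lerD; [apply: HA => //|apply: HB => //].
  exact: leq_addr.
exact: leq_addl.
Qed.

Lemma bndM b A B : bnd b ep Z A -> bnd false ep Z B -> bnd b ep Z (fun w => A w * B w).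
Proof.
case: b => [HA|/bnd_false_pos[NA [CA [CA0 HA]]]] /bnd_false_pos[NB [CB [CB0 HB]]].
  move=> N; have [CA CA0 hA] := bnd_true_pos HA (N + NB).
  exists (CA * CB) => w Zw; rewrite normrM.
  apply: (le_trans (ler_pM (normr_ge0 _) (normr_ge0 _) (hA _ Zw) (HB _ (leqnn _) _ Zw))).
  rewrite mulrACA exprD -[_ * _ * _ ^+ NB]mulrA -exprMn divff ?gt_eqF ?ep0//.
  by rewrite expr1n mulr1.
exists (NA + NB)%N, (CA * CB) => w Zw; rewrite normrM.
apply: (le_trans (ler_pM (normr_ge0 _) (normr_ge0 _) (HA _ (leqnn _) _ Zw) (HB _ (leqnn _) _ Zw))).
by rewrite mulrACA exprD.
Qed.

End Bnd.

(** The constants and exponents of finitely many families are replaced by common ones. *)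
Lemma bnd_unif (T : Type) (I : finType) b (ep : T -> R) Z (A : I -> T -> R) :
  (forall w, Z w -> 0 < ep w <= 1) -> (forall i, bnd b ep Z (A i)) ->
  bnd b (fun iw : I * T => ep iw.2) [set iw | Z iw.2] (fun iw => A iw.1 iw.2).
Proof.
move=> epZ; case: b => H.
  move=> N; have /choice[C HC] : forall i, exists C : R, 0 <= C /\
      forall w, Z w -> `|A i w| <= C * ep w ^+ N.
    by move=> i; have [C C0 h] := bnd_true_pos epZ (H i) N; exists C.
  exists (\sum_i C i) => -[i w] /= Zw; apply: (le_trans ((HC i).2 w Zw)).
  have /andP[e0 _] := epZ _ Zw.
  rewrite ler_wpM2r ?exprn_ge0 ?(ltW e0)// (bigD1 i)//= lerDl sumr_ge0// => j _.
  by have [] := HC j.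
have /choice[N HN] : forall i, exists N (C : R), 0 <= C /\
  forall M, (N <= M)%N -> forall w, Z w -> `|A i w| <= C * (ep w)^-1 ^+ M.
  by move=> i; have := bnd_false_pos epZ (H i).
have {HN} /choice[C HC] := HN.
exists (\sum_i N i)%N, (\sum_i C i) => -[i w] /= Zw.
have NN : (N i <= \sum_i N i)%N by rewrite (bigD1 i)//= leq_addr.
apply: (le_trans ((HC i).2 _ NN w Zw)).
have /andP[e0 _] := epZ _ Zw.
rewrite ler_wpM2r ?exprn_ge0 ?invr_ge0 ?(ltW e0)// (bigD1 i)//= lerDl sumr_ge0// => j _.
by have [] := HC j.
Qed.

Lemma rsmoothX d (U : set 'rV[R]_d) f k : open U -> rsmooth U f ->
  rsmooth U (fun w => f w ^+ k).
Proof.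
move=> oU fs; elim: k => [|k IH].
  by under eq_fun do rewrite expr0; exact: rsmooth_cst.
by under eq_fun do rewrite exprS; exact: rsmoothM.
Qed.

Lemma rpartial_coord d i (j : 'I_d) :
  rpartial i (fun x : 'rV[R]_d => x 0 j) = fun=> (delta_mx 0 i : 'rV[R]_d) 0 j.
Proof.
apply/funext => x; rewrite /rpartial /derive; apply: lim_near_cst => //=.
near=> h; rewrite !mxE addrK [LHS]mulKf//.
by near: h; exact: nbhs_dnbhs_neq.
Unshelve. all: by end_near. Qed.

Section MBnd.
Context {m : nat} (ep : 'rV[R]_m -> R) (W Z : set 'rV[R]_m).
Hypotheses (oW : open W) (ZW : Z `<=` W) (epZ : forall w, Z w -> 0 < ep w <= 1).

Definition mbndn n b f := forall s, (size s <= n)%N -> bnd b ep Z (rpartials s f).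
Definition mbnd b f := forall s, bnd b ep Z (rpartials s f).

Lemma mbndnP b f : mbnd b f <-> forall n, mbndn n b f.
Proof. by split=> [H n s _|H s]; [exact: H|exact: H (leqnn (size s))]. Qed.

Lemma mbndn_partial n b f i : mbndn n.+1 b f -> mbndn n b (rpartial i f).
Proof. by move=> H s sn; rewrite -rpartials_rcons; apply: H; rewrite size_rcons. Qed.

Lemma mbnd_partial b f i : mbnd b f -> mbnd b (rpartial i f).
Proof. by move=> H s; rewrite -rpartials_rcons; exact: H. Qed.

Lemma mbndnW n b f : mbndn n.+1 b f -> mbndn n b f.
Proof. by move=> H s sn; apply: H; exact: leqW. Qed.

Lemma mbndn_eq n b f g : (forall w, W w -> f w = g w) -> mbndn n b f -> mbndn n b g.
Proof.
move=> fg H s sn; apply: bnd_eq (H s sn) => w /ZW Ww.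
exact: (eq_on_rpartials s oW fg Ww).
Qed.

Lemma mbnd_eq b f g : (forall w, W w -> f w = g w) -> mbnd b f -> mbnd b g.
Proof. by move=> fg /mbndnP H; apply/mbndnP => n; exact: (mbndn_eq fg (H n)). Qed.

Lemma mbndnS n b f : bnd b ep Z f -> (forall i, mbndn n b (rpartial i f)) -> mbndn n.+1 b f.
Proof.
move=> f0 fi s; case: (lastP s) => [//|t i]; rewrite size_rcons ltnS rpartials_rcons.
exact: fi.
Qed.

Lemma mbndnD n b f g : rsmooth W f -> rsmooth W g -> mbndn n b f -> mbndn n b g ->
  mbndn n b (fun w => f w + g w).
Proof.
move=> fs gs fb gb s sn; apply: bnd_eq (bndD epZ (fb s sn) (gb s sn)) => w /ZW Ww.
by rewrite (rpartialsD s oW fs gs Ww).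
Qed.

Lemma mbnd0 b : mbnd b (fun=> 0).
Proof.
move=> s; have -> : rpartials s (fun=> 0) = (fun=> 0 : R) :> ('rV[R]_m -> R).
  by elim: s => //= i s ->; apply/funext => z; rewrite /rpartial derive_cst.
exact: bnd_cst.
Qed.

Lemma mbndn_sum n b (I : Type) (r : seq I) (F : I -> 'rV[R]_m -> R) :
  (forall i, rsmooth W (F i)) -> (forall i, mbndn n b (F i)) ->
  mbndn n b (fun w => \sum_(i <- r) F i w).
Proof.
move=> Fs Fb; elim: r => [|i r IH].
  by under eq_fun do rewrite big_nil; move: n {Fb}; apply/mbndnP; exact: mbnd0.
by under eq_fun do rewrite big_cons; apply: mbndnD => //; exact: rsmooth_sum.
Qed.

Lemma mbndnM n b f g : rsmooth W f -> rsmooth W g -> mbndn n b f -> mbndn n false g ->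
  mbndn n b (fun w => f w * g w).
Proof.
elim: n f g => [|n IH] f g fs gs fb gb.
  by move=> s; rewrite leqn0 size_eq0 => /eqP ->; exact: (bndM epZ (fb [::] isT) (gb [::] isT)).
apply: mbndnS => [|i]; first exact: (bndM epZ (fb [::] isT) (gb [::] isT)).
have fis := rsmooth_partial i fs; have gis := rsmooth_partial i gs.
apply: (@mbndn_eq _ _ (fun w => rpartial i f w * g w + f w * rpartial i g w)).
  move=> w Ww; rewrite /rpartial deriveM; last 2 first.
    exact: rsmooth_derivable fs Ww.
    exact: rsmooth_derivable gs Ww.
  by rewrite /GRing.scale /= addrC; congr (_ + _); rewrite mulrC.
apply: mbndnD; [exact: rsmoothM|exact: rsmoothM| |].
- by apply: IH => //; [exact: mbndn_partial|exact: mbndnW].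
- by apply: IH => //; [exact: mbndnW|exact: mbndn_partial].
Qed.

Lemma mbndD b f g : rsmooth W f -> rsmooth W g -> mbnd b f -> mbnd b g ->
  mbnd b (fun w => f w + g w).
Proof. by move=> fs gs /mbndnP fb /mbndnP gb; apply/mbndnP => n; exact: mbndnD. Qed.

Lemma mbndM b f g : rsmooth W f -> rsmooth W g -> mbnd b f -> mbnd false g ->
  mbnd b (fun w => f w * g w).
Proof. by move=> fs gs /mbndnP fb /mbndnP gb; apply/mbndnP => n; exact: mbndnM. Qed.

(** By induction on the order with the chain rule. Bounds on the derivatives of [f] are
    only required at the points [Y w]: for a Schwartz function [f] these decay when
    [Y w] is large. *)
Lemma mbnd_comp k (V : set 'rV[R]_k) b f (Y : 'rV[R]_m -> 'rV[R]_k) :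
  open V -> rsmooth V f -> (forall w, W w -> V (Y w)) ->
  (forall j, rsmooth W (fun w => Y w 0 j)) ->
  (forall j, mbnd false (fun w => Y w 0 j)) ->
  (forall s, bnd b ep Z (fun w => rpartials s f (Y w))) ->
  mbnd b (fun w => f (Y w)).
Proof.
move=> oV fs WV Ys Yb fb; apply/mbndnP => n; elim: n f fs fb => [|n IH] f fs fb.
  by move=> s; rewrite leqn0 size_eq0 => /eqP ->; exact: (fb [::]).
apply: mbndnS; first exact: (fb [::]).
move=> i; apply: (@mbndn_eq _ _ (fun w => \sum_j rpartial j f (Y w) * rpartial i (fun z => Y z 0 j) w)).
  by move=> w Ww; rewrite (rpartial_comp i oV fs Ww (WV w Ww) Ys).
have C j : rsmooth W (fun w => rpartial j f (Y w)).
  exact: (rsmooth_comp oV oW WV (rsmooth_partial j fs) Ys).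
have Yi j : rsmooth W (rpartial i (fun z => Y z 0 j)) by exact: rsmooth_partial.
apply: mbndn_sum => j; first exact: rsmoothM.
apply: mbndnM => //; last exact: (mbndnP _ _).1 (mbnd_partial i (Yb j)) n.
apply: IH; first exact: rsmooth_partial.
by move=> s; have := fb (rcons s j); under eq_fun do rewrite rpartials_rcons.
Qed.

(** The moderate smooth functions form an algebra, to which the coordinates of the argument
    of the mollifier belong ([nice_arg]). *)
Definition nice f := rsmooth W f /\ mbnd false f.

Lemma niceD f g : nice f -> nice g -> nice (fun w => f w + g w).
Proof. by move=> [fs fb] [gs gb]; split; [exact: rsmoothD|exact: mbndD]. Qed.

Lemma niceM f g : nice f -> nice g -> nice (fun w => f w * g w).
Proof. by move=> [fs fb] [gs gb]; split; [exact: rsmoothM|exact: mbndM]. Qed.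

Lemma nice_cst c : nice (fun=> c).
Proof.
split; first exact: rsmooth_cst.
apply/mbndnP => -[|n].
  by move=> s; rewrite leqn0 size_eq0 => /eqP ->; exact: (@bnd_bounded _ _ _ _ `|c|).
apply: mbndnS => [|i]; first exact: (@bnd_bounded _ _ _ _ `|c|).
rewrite (_ : rpartial i _ = fun=> 0); first by move: n; apply/mbndnP; exact: mbnd0.
by apply/funext => w; rewrite /rpartial derive_cst.
Qed.

Lemma niceN f : nice f -> nice (fun w => - f w).
Proof.
move=> Hf; have := niceM (nice_cst (-1)) Hf.
by rewrite (_ : (fun w => _ * _) = (fun w => - f w)) //; apply/funext => w; rewrite mulN1r.
Qed.

Lemma nice_sum (I : Type) (r : seq I) (F : I -> 'rV[R]_m -> R) :
  (forall i, nice (F i)) -> nice (fun w => \sum_(i <- r) F i w).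
Proof.
move=> H; elim: r => [|i r IH].
  by under eq_fun do rewrite big_nil; exact: nice_cst.
by under eq_fun do rewrite big_cons; exact: niceD.
Qed.

Lemma niceX f k : nice f -> nice (fun w => f w ^+ k).
Proof.
move=> H; elim: k => [|k IH].
  by under eq_fun do rewrite expr0; exact: nice_cst.
by under eq_fun do rewrite exprS; exact: niceM.
Qed.

Lemma nice_coord j (B : R) : (forall w, Z w -> `|w 0 j| <= B) -> nice (fun w => w 0 j).
Proof.
move=> H; split; first exact: rsmooth_coord.
apply/mbndnP => -[|n].
  by move=> s; rewrite leqn0 size_eq0 => /eqP ->; exact: bnd_bounded H.
apply: mbndnS => [|i]; first exact: bnd_bounded H.
by rewrite rpartial_coord; move: n; apply/mbndnP; case: (nice_cst ((delta_mx 0 i : 'rV[R]_m) 0 j)).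
Qed.

(** The scale itself is a coordinate, so that its inverse has moderate derivatives. *)
Lemma nice_coordV j : (forall w, W w -> 0 < w 0 j) -> (forall w, Z w -> ep w = w 0 j) ->
  nice (fun w => (w 0 j)^-1).
Proof.
move=> Wj Zj.
have Vs : rsmooth W (fun w => (w 0 j)^-1).
  by apply: rsmooth_inv => //; [exact: rsmooth_coord|move=> w /Wj w0; rewrite gt_eqF].
have V0 : bnd false ep Z (fun w => (w 0 j)^-1).
  exists 1%N, 1 => w Zw; rewrite Zj// expr1 mul1r ger0_norm// invr_ge0 ltW//.
  exact/Wj/ZW.
split => //; apply/mbndnP; elim=> [|n IH].
  by move=> s; rewrite leqn0 size_eq0 => /eqP ->.
apply: mbndnS => // i.
pose c : R := - (delta_mx 0 i : 'rV[R]_m) 0 j.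
have [cs cb] := nice_cst c.
apply: (@mbndn_eq _ _ (fun w => c * ((w 0 j)^-1 * (w 0 j)^-1))).
  move=> w Ww; rewrite /rpartial deriveV; last 2 first.
    by rewrite gt_eqF// Wj.
    exact: rsmooth_derivable (rsmooth_coord W j) Ww.
  rewrite -[X in _ *: X]/(rpartial i (fun x : 'rV[R]_m => x 0 j) w) rpartial_coord.
  by rewrite /GRing.scale /= -exprVn expr2 mulNr mulrC /c mulNr.
apply: mbndnM => //; first exact: rsmoothM.
exact: mbndnM.
Qed.

End MBnd.

End Scales.

Local Open Scope complex_scope.

(** * The mollifier kernel on the Heisenberg group *)

Section RealSchwartz.
Context {R : realType}.

Definition rschwartz d (sigma : 'rV[R]_d -> R) :=
  rsmooth setT sigma /\ forall (alpha : 'I_d -> nat) s, exists M : R, forall x : 'rV[R]_d,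
    `|(\prod_(i < d) x 0 i ^+ alpha i) * rpartials s sigma x| <= M.

(** A nonzero norm is the absolute value of one of the coordinates, hence powers of the
    norm are dominated by sums of powers of coordinates. *)
Lemma rschwartz_decay d (sigma : 'rV[R]_d -> R) N s : rschwartz sigma ->
  exists2 M : R, 0 <= M & forall x, `|x| ^+ N * `|rpartials s sigma x| <= M.
Proof.
move=> [_ H].
have [M0 H0] := H (fun=> 0%N) s.
have /choice[M HM] : forall i : 'I_d, exists M : R, forall x : 'rV[R]_d, `|x 0 i ^+ N * rpartials s sigma x| <= M.
  move=> i; have [M HM] := H (fun j => if j == i then N else 0%N) s; exists M => x.
  have := HM x; rewrite (bigD1 i)//= eqxx big1 ?mulr1// => j /negbTE ->.
  by rewrite expr0.
have HM0 i : 0 <= M i by apply: le_trans (HM i 0); exact: normr_ge0.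
have H00 : 0 <= M0 by apply: le_trans (H0 0); exact: normr_ge0.
have HS : 0 <= \sum_i M i by exact: sumr_ge0.
exists (M0 + \sum_i M i); first exact: addr_ge0.
move=> x; have [x0|x0] := eqVneq (mx_norm x) 0.
  have -> : `|x| = 0 by [].
  apply: (@le_trans _ _ M0); last by rewrite lerDl.
  apply: (@le_trans _ _ `|rpartials s sigma x|).
    by rewrite ler_piMl// expr0n; case: eqP.
  by have := H0 x; rewrite big1 ?mul1r// => i _; rewrite expr0.
have [[j i] /= E] := mx_norm_neq0 x0.
have -> : `|x| = `|x 0 i| by rewrite -(ord1 j).
rewrite -normrX -normrM; apply: (le_trans (HM i x)).
by rewrite (bigD1 i)//= addrCA lerDl addr_ge0// sumr_ge0.
Qed.

Lemma compact_bound d (U : set 'rV[R]_d) f (K : set 'rV[R]_d) : rsmooth U f ->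
  compact K -> K `<=` U -> exists2 B : R, 0 <= B & forall x, K x -> `|f x| <= B.
Proof.
move=> fs cK KU.
have : {within K, continuous f}.
  apply: continuous_in_subspaceT => x /set_mem Kx; exact: rsmooth_cont fs (KU _ Kx).
move=> /continuous_compact/(_ cK)/compact_bounded[M [Mr HM]].
exists `|M + 1| => // x Kx; apply: (@le_trans _ _ (M + 1)); last exact: ler_norm.
by apply: HM; [rewrite ltrDl|exists x].
Qed.

End RealSchwartz.

Section Kernel.
Context {R : realType} {n : nat}.
Local Notation d := (n + n + 1)%N.
Local Notation H := 'rV[R]_d.
Local Notation J := 'rV[R]_(1 + d + d).

(** The coordinates of [w = (e, p, r)] in [R x H x H]. *)
Definition e_idx : 'I_(1 + d + d) := lshift d (lshift d ord0).
Definition p_idx (j : 'I_d) : 'I_(1 + d + d) := lshift d (rshift 1 j).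
Definition r_idx (j : 'I_d) : 'I_(1 + d + d) := rshift (1 + d) j.

(** At [w = (e, p, r)] this is [p r^-1]. *)
Definition quot (w : J) : H := hmul (rsubmx (lsubmx w)) (hinv (rsubmx w)).

(** At [w = (e, p, r)] this is [e^-d sigma (e^-1 (p r^-1))], the mollifier with profile [sigma]
    evaluated at [p r^-1]. *)
Definition kernel (sigma : H -> R) (w : J) : R :=
  (w 0 e_idx)^-1 ^+ d * sigma ((w 0 e_idx)^-1 *: quot w).

Definition x_idx (i : 'I_n) : 'I_d := lshift 1 (lshift n i).
Definition xi_idx (i : 'I_n) : 'I_d := lshift 1 (rshift n i).
Definition t_idx : 'I_d := rshift (n + n) ord0.

(** Coordinatewise form of the group law; only the last coordinate has a bilinear term. *)
Lemma hmulE (p q : H) j : hmul p q 0 j = p 0 j + q 0 j + (j == t_idx)%:R *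
  (2^-1 * \sum_i (p 0 (x_idx i) * q 0 (xi_idx i) - q 0 (x_idx i) * p 0 (xi_idx i))).
Proof.
have dE : dotrV (hx p) (hxi q) - dotrV (hx q) (hxi p) =
    \sum_i (p 0 (x_idx i) * q 0 (xi_idx i) - q 0 (x_idx i) * p 0 (xi_idx i)).
  by rewrite -sumrB; apply: eq_bigr => i _; rewrite !mxE.
rewrite /hmul /hpoint mxE; case: (fintype.splitP j) => k jk.
  have -> : (j == t_idx) = false.
    by apply/negbTE/eqP => e; have := ltn_ord k; rewrite -jk e /= ltnNge leq_addr.
  rewrite mul0r addr0 mxE; case: (fintype.splitP k) => l kl; rewrite !mxE.
    by congr (p 0 _ + q 0 _); apply: val_inj => /=; rewrite jk.
  by congr (p 0 _ + q 0 _); apply: val_inj => /=; rewrite jk.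
have -> : j = t_idx by apply: val_inj => /=; rewrite jk (ord1 k).
by rewrite eqxx mul1r !mxE (ord1 k) eqxx mulr1n /ht !mxE dE.
Qed.

Lemma quotE (w : J) j : quot w 0 j = w 0 (p_idx j) - w 0 (r_idx j) + (j == t_idx)%:R *
  (2^-1 * \sum_i (w 0 (r_idx (x_idx i)) * w 0 (p_idx (xi_idx i)) - w 0 (p_idx (x_idx i)) * w 0 (r_idx (xi_idx i)))).
Proof.
rewrite /quot hmulE /hinv !mxE; congr (_ + _ * (_ * _)).
apply: eq_bigr => i _; rewrite !mxE -/(p_idx _) -/(r_idx _).
by rewrite mulrN mulNr opprK addrC.
Qed.

Definition W0 : set J := [set w | 0 < w 0 e_idx].

Lemma open_W0 : open W0.
Proof.
apply: (@open_comp _ _ (fun w : J => w 0 e_idx) [set x | 0 < x]); last exact: open_gt.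
by move=> w _; exact: coord_continuous.
Qed.

Lemma eq_prop (T : Type) (P : (T -> R) -> Prop) f g : (forall w, g w = f w) -> P f -> P g.
Proof. by move=> fg; rewrite (_ : g = f) //; exact/funext. Qed.

(** If [e^-1 q] is at least [delta / e], decay of order [N] gives a factor [e ^ N]. *)
Lemma decay_quotient (q a M delta e : R) N : 0 < e -> 0 < delta -> 0 <= a ->
  delta <= q -> (e^-1 * q) ^+ N * a <= M -> a <= M * delta^-1 ^+ N * e ^+ N.
Proof.
move=> e0 d0 a0 dq Ha.
have c0 : 0 < e^-1 * delta by rewrite mulr_gt0// invr_gt0.
rewrite -mulrA -exprMn (_ : delta^-1 * e = (e^-1 * delta)^-1); last by rewrite invfM invrK mulrC.
rewrite exprVn ler_pdivlMr ?exprn_gt0// mulrC; apply: le_trans Ha.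
rewrite ler_wpM2r// lerXn2r ?nnegrE ?(ltW c0)//.
  by rewrite mulr_ge0 ?invr_ge0 ?(ltW e0)// (le_trans (ltW d0)).
by rewrite ler_wpM2l// invr_ge0 ltW.
Qed.

Section KernelBounds.
Variables (Z : set J) (B : R).
Hypotheses (Z0 : forall w, Z w -> 0 < w 0 e_idx <= 1) (ZB : forall w j, Z w -> `|w 0 j| <= B).

Local Notation ep := (fun w : J => w 0 e_idx).
Local Notation nice := (nice ep W0 Z).

Let ZW : Z `<=` W0. Proof. by move=> w /Z0 /andP[]. Qed.
Let oW := open_W0.

Lemma nice_quot j : nice (fun w => quot w 0 j).
Proof.
apply: (eq_prop (fun w => quotE w j)).
have C k : nice (fun w => w 0 k) by apply: nice_coord => w; exact: ZB.
apply: niceD => //; first by apply: niceD => //; apply: niceN.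
apply: niceM => //; first exact: nice_cst.
apply: niceM => //; first exact: nice_cst.
apply: nice_sum => // i; apply: niceD => //; first exact: niceM.
by apply: niceN => //; exact: niceM.
Qed.

Lemma nice_epV : nice (fun w => (w 0 e_idx)^-1).
Proof. by apply: nice_coordV => //; exact: open_W0. Qed.

Lemma nice_arg j : nice (fun w => ((w 0 e_idx)^-1 *: quot w) 0 j).
Proof.
apply: (@eq_prop _ nice (fun w : J => (w 0 e_idx)^-1 * quot w 0 j)); first by move=> w; rewrite mxE.
by apply: niceM => //; [exact: nice_epV|exact: nice_quot].
Qed.

(** The argument [e^-1 (p r^-1)] has moderate derivatives, and the derivatives of [sigma]
    are bounded, whence moderateness. If moreover [`|p r^-1| >= delta], the rapid decay of
    [sigma] gives every power of [e]. *)
Lemma kernel_mbnd sigma (b : bool) : rschwartz sigma ->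
  (b -> exists2 delta, 0 < delta & forall w, Z w -> delta <= `|quot w|) ->
  mbnd ep Z b (kernel sigma).
Proof.
move=> Ss Hb; have [ss _] := Ss.
have pw : nice (fun w => (w 0 e_idx)^-1 ^+ d) by apply: niceX => //; exact: nice_epV.
have As j := (nice_arg j).1.
have sc : rsmooth W0 (fun w => sigma ((w 0 e_idx)^-1 *: quot w)).
  exact: (rsmooth_comp openT oW _ ss As).
have : mbnd ep Z b (fun w => sigma ((w 0 e_idx)^-1 *: quot w) * (w 0 e_idx)^-1 ^+ d).
  apply: (mbndM oW ZW Z0) => //; try exact: pw.1; try exact: pw.2.
  apply: (@mbnd_comp R _ ep W0 Z oW ZW Z0 _ setT b sigma (fun w => (w 0 e_idx)^-1 *: quot w)) => //.
  - exact: openT.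
  - by move=> j; have [] := nice_arg j.
  - move=> s; case: b Hb => [/(_ isT)[delta d0 Hd] N|_]; last first.
      have [M M0 HM] := rschwartz_decay 0 s Ss; apply: (@bnd_bounded _ _ _ _ _ M) => w _.
      by have := HM ((w 0 e_idx)^-1 *: quot w); rewrite expr0 mul1r.
    have [M M0 HM] := rschwartz_decay N s Ss; exists (M * delta^-1 ^+ N) => w Zw.
    have /andP[e0 _] := Z0 Zw.
    have := HM ((w 0 e_idx)^-1 *: quot w).
    move: (`|rpartials _ _ _|) (normr_ge0 (rpartials s sigma ((w 0 e_idx)^-1 *: quot w))) => a a0 Ha.
    by move: Ha; rewrite normrZ gtr0_norm ?invr_gt0//; exact: decay_quotient (Hd _ Zw).
apply: (mbnd_eq oW ZW) => w _; exact: mulrC.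
Qed.

Lemma kernel_smooth sigma : rsmooth setT sigma -> rsmooth W0 (kernel sigma).
Proof.
move=> ss; have As j := (nice_arg j).1.
apply: rsmoothM => //; last exact: (rsmooth_comp openT oW _ ss As).
have pw : nice (fun w => (w 0 e_idx)^-1 ^+ d) by apply: niceX => //; exact: nice_epV.
exact: pw.1.
Qed.

End KernelBounds.

Lemma kernel_smooth0 sigma : rsmooth setT sigma -> rsmooth W0 (kernel sigma).
Proof. by apply: (@kernel_smooth set0 0). Qed.

Definition cut_kernel (chi sigma : H -> R) (w : J) : R := chi (rsubmx w) * kernel sigma w.

Lemma rsmooth_rsub (f : H -> R) : rsmooth setT f -> rsmooth W0 (fun w => f (rsubmx w)).
Proof.
move=> fs; apply: (rsmooth_comp openT open_W0 _ fs) => // j.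
by under eq_fun do rewrite mxE; exact: rsmooth_coord.
Qed.

Lemma cut_kernel_smooth chi sigma : rsmooth setT chi -> rsmooth setT sigma ->
  rsmooth W0 (cut_kernel chi sigma).
Proof.
move=> cs ss; apply: rsmoothM; [exact: open_W0|exact: rsmooth_rsub|exact: kernel_smooth0].
Qed.

Lemma cut_kernel_mbnd (Z : set J) (B : R) (K : set H) chi sigma (b : bool) :
  (forall w, Z w -> 0 < w 0 e_idx <= 1) -> (forall w j, Z w -> `|w 0 j| <= B) ->
  compact K -> (forall w, Z w -> K (rsubmx w)) -> rsmooth setT chi -> rschwartz sigma ->
  (b -> exists2 delta, 0 < delta & forall w, Z w -> delta <= `|quot w|) ->
  mbnd (fun w => w 0 e_idx) Z b (cut_kernel chi sigma).
Proof.
move=> Z0 ZB cK ZK cs Ss Hb; have [ss _] := Ss.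
have ZW : Z `<=` W0 by move=> w /Z0 /andP[].
have : mbnd (fun w => w 0 e_idx) Z b (fun w => kernel sigma w * chi (rsubmx w)).
  apply: (mbndM open_W0 ZW Z0).
  - exact: kernel_smooth0.
  - exact: rsmooth_rsub.
  - exact: (kernel_mbnd Z0 ZB).
  - apply: (mbnd_comp open_W0 ZW Z0 openT cs) => //.
    + by move=> j; under eq_fun do rewrite mxE; exact: rsmooth_coord.
    + move=> j; apply: (@eq_prop _ (mbnd (fun w => w 0 e_idx) Z false) (fun w : J => w 0 (r_idx j))); first by move=> w; rewrite mxE.
      by have [] := @nice_coord R _ (fun w : J => w 0 e_idx) W0 Z (rshift (1 + d) j) B (fun w Zw => ZB w (rshift (1 + d) j) Zw).
    move=> s; have [C C0 HC] := compact_bound (rsmooth_partials s cs) cK (fun x _ => I).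
    by apply: (@bnd_bounded _ _ _ _ _ C) => w Zw; apply: HC; exact: ZK.
apply: (mbnd_eq open_W0 ZW) => w _; exact: mulrC.
Qed.

End Kernel.

Section PairingBounds.
Context {R : realType}.

(** A functional of finite order sees finitely many derivatives in the last variables, and
    those are bounded in the same way uniformly on [K]. *)
Lemma pairing_mbnd m d (Om Z0 : set 'rV[R]_m) (K : set 'rV[R]_d) lam Phi ep0 b :
  open Om -> compact K -> rfunctional K lam -> joint_test Om K Phi ->
  Z0 `<=` Om -> (forall z, Z0 z -> 0 < ep0 z <= 1) ->
  mbnd (fun w => ep0 (lsubmx w)) [set w : 'rV[R]_(m + d) | Z0 (lsubmx w) /\ K (rsubmx w)] b Phi ->
  mbnd ep0 Z0 b (fun z => lam (fun r => Phi (row_mx z r))).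
Proof.
move=> oOm cK lamP Pt ZOm epZ Pb s.
have [_ [k [M [M0 HM]]]] := lamP.
set Z := (X in mbnd _ X) in Pb.
(* The finitely many derivatives that the functional of order [k] sees. *)
pose A (t : {bseq k of 'I_d}) := rpartials (map (@rshift m d) t ++ map (@lshift m d) s) Phi.
have HA t : bnd b (fun w => ep0 (lsubmx w)) Z (A t) by exact: Pb.
have epZ' (w : 'rV[R]_(m + d)) : Z w -> 0 < ep0 (lsubmx w) <= 1 by move=> [/epZ].
have U := bnd_unif epZ' HA.
have key (B : R) z : Z0 z -> 0 <= B ->
    (forall (t : {bseq k of 'I_d}) r, K r -> `|A t (row_mx z r)| <= B) ->
    `|rpartials s (fun z => lam (fun r => Phi (row_mx z r))) z| <= M * B.
  move=> Zz B0 HB; rewrite (rpartials_pairing oOm cK lamP s Pt (ZOm _ Zz)).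
  apply: HM => //.
    exact: (joint_test_slice oOm (joint_test_partials oOm s Pt) (ZOm _ Zz)).
  move=> t r tk Kr; rewrite rpartials_rslice -rpartials_cat.
  exact: (HB (Bseq tk) r Kr).
have epZ'' (w : {bseq k of 'I_d} * 'rV[R]_(m + d)) : [set iw | Z iw.2] w -> 0 < ep0 (lsubmx w.2) <= 1.
  by move=> /epZ'.
case: b Pb HA U => Pb HA U.
  move=> N; have [C C0 HC] := bnd_true_pos epZ'' U N.
  exists (M * C) => z Zz; rewrite -mulrA; apply: key => //.
    by have /andP[e0 _] := epZ _ Zz; rewrite mulr_ge0// exprn_ge0// ltW.
  move=> t r Kr; have := HC (t, row_mx z r); rewrite /= row_mxKl; apply.
  by split; rewrite ?row_mxKl ?row_mxKr.
have [N [C [C0 HC]]] := bnd_false_pos epZ'' U.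
exists N, (M * C) => z Zz; rewrite -mulrA; apply: key => //.
  by have /andP[e0 _] := epZ _ Zz; rewrite mulr_ge0// exprn_ge0// invr_ge0 ltW.
move=> t r Kr; have := HC N (leqnn _) (t, row_mx z r); rewrite /= row_mxKl; apply.
by split; rewrite ?row_mxKl ?row_mxKr.
Qed.

End PairingBounds.

(** * Smooth curves of real functions and their growth *)

Section Nets.
Context {R : realType} {d : nat}.
Local Notation E := 'rV[R]_d.
Implicit Types (U K : set E).

Definition near0 (P : R -> Prop) := \forall e \near (0 : R)^'+, P e.

Lemma near01 (r : R) : 0 < r -> near0 (fun e => 0 < e < r).
Proof.
move=> r0; rewrite /near0; near=> e; apply/andP; split; near: e; first exact: nbhs_right_gt.
exact: nbhs_right_lt.
Unshelve. all: by end_near. Qed.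

Lemma near0I (P Q : R -> Prop) : near0 P -> near0 Q -> near0 (fun e => P e /\ Q e).
Proof. by rewrite /near0 => p q; apply: filterI. Qed.

Lemma near0S (P Q : R -> Prop) : (forall e, P e -> Q e) -> near0 P -> near0 Q.
Proof. by rewrite /near0 => PQ; apply: filterS. Qed.

(** Uniformly on [K] and for [e] near [0], [A] is rapidly decreasing in [e] for [b = true] and
    of polynomial growth in [1 / e] for [b = false]. *)
Definition unif_bound (b : bool) K (A : R -> E -> R) : Prop :=
  if b then forall N, exists C : R, near0 (fun e => forall x, K x -> `|A e x| <= C * e ^+ N)
  else exists N (C : R), near0 (fun e => forall x, K x -> `|A e x| <= C * e^-1 ^+ N).

Lemma expV_mono (e : R) M N : 0 < e < 1 -> (M <= N)%N -> e^-1 ^+ M <= e^-1 ^+ N.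
Proof.
move=> /andP[e0 e1] MN; apply: ler_weXn2l => //.
by rewrite invf_ge1// ltW.
Qed.

Lemma exp_mono (e : R) M N : 0 < e < 1 -> (M <= N)%N -> e ^+ N <= e ^+ M.
Proof.
move=> /andP[e0 e1] MN; apply: ler_wiXn2l => //; exact: ltW.
Qed.

Lemma unif_bound_pos b K A : unif_bound b K A ->
  if b then forall N, exists2 C : R, 0 <= C & near0 (fun e => forall x, K x -> `|A e x| <= C * e ^+ N)
  else exists N, exists2 C : R, 0 <= C & forall M, (N <= M)%N ->
     near0 (fun e => forall x, K x -> `|A e x| <= C * e^-1 ^+ M).
Proof.
case: b => [H N|[N [C H]]].
  have [C HC] := H N; exists `|C| => //.
  apply: near0S (near0I HC (near01 ltr01)) => e [He /andP[e0 e1]] x Kx.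
  apply: (le_trans (He x Kx)); rewrite ler_wpM2r ?exprn_ge0 ?(ltW e0)//.
  exact: ler_norm.
exists N, `|C| => // M NM.
apply: near0S (near0I H (near01 ltr01)) => e [He e01] x Kx.
apply: (le_trans (He x Kx)); have /andP[e0 e1] := e01.
apply: (@le_trans _ _ (`|C| * e^-1 ^+ N)).
  by rewrite ler_wpM2r ?exprn_ge0 ?invr_ge0 ?(ltW e0)// ler_norm.
by rewrite ler_wpM2l//; exact: expV_mono.
Qed.

Lemma unif_bound_eq b K A B : near0 (fun e => forall x, K x -> A e x = B e x) ->
  unif_bound b K A -> unif_bound b K B.
Proof.
move=> AB; case: b => [H N|[N [C H]]].
  have [C HC] := H N; exists C.
  by apply: near0S (near0I AB HC) => e [h1 h2] x Kx; rewrite -h1// h2.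
exists N, C; by apply: near0S (near0I AB H) => e [h1 h2] x Kx; rewrite -h1// h2.
Qed.

Lemma unif_boundD b K A B : unif_bound b K A -> unif_bound b K B -> unif_bound b K (fun e x => A e x + B e x).
Proof.
case: b => [HA HB N|/unif_bound_pos[NA [CA CA0 HA]] /unif_bound_pos[NB [CB CB0 HB]]].
  have [CA hA] := HA N; have [CB hB] := HB N; exists (CA + CB).
  apply: near0S (near0I hA hB) => e [h1 h2] x Kx; apply: (le_trans (ler_normD _ _)).
  by rewrite mulrDl; apply: lerD; [exact: h1|exact: h2].
exists (NA + NB)%N, (CA + CB).
apply: near0S (near0I (HA _ (leq_addr NB NA)) (HB _ (leq_addl NA NB))) => e [h1 h2] x Kx.
apply: (le_trans (ler_normD _ _)).
by rewrite mulrDl; apply: lerD; [exact: h1|exact: h2].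
Qed.

Lemma unif_boundM b K A B : unif_bound b K A -> unif_bound false K B -> unif_bound b K (fun e x => A e x * B e x).
Proof.
case: b => [/unif_bound_pos HA|/unif_bound_pos[NA [CA CA0 HA]]] /unif_bound_pos[NB [CB CB0 HB]].
  move=> N; have [CA CA0 hA] := HA (N + NB)%N; exists (CA * CB).
  apply: near0S (near0I (near0I hA (HB _ (leqnn NB))) (near01 ltr01)) => e [[h1 h2] /andP[e0 _]] x Kx.
  rewrite normrM; apply: (le_trans (ler_pM (normr_ge0 _) (normr_ge0 _) (h1 x Kx) (h2 x Kx))).
  by rewrite mulrACA exprD -[_ * _ * _ ^+ NB]mulrA -exprMn divff ?gt_eqF// expr1n mulr1.
exists (NA + NB)%N, (CA * CB).
apply: near0S (near0I (HA _ (leqnn NA)) (HB _ (leqnn NB))) => e [h1 h2] x Kx.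
rewrite normrM; apply: (le_trans (ler_pM (normr_ge0 _) (normr_ge0 _) (h1 x Kx) (h2 x Kx))).
by rewrite mulrACA exprD.
Qed.

Lemma unif_bound_bounded K A (B : R) : (forall e x, 0 < e < 1 -> K x -> `|A e x| <= B) -> unif_bound false K A.
Proof.
move=> H; exists 0%N, B; apply: near0S (near01 ltr01) => e e01 x Kx.
by rewrite expr0 mulr1 H.
Qed.

Definition derivs_bound b U (f : R -> E -> R) := forall K, compact K -> K `<=` U ->
  forall s, unif_bound b K (fun e => rpartials s (f e)).

Definition slices_smooth U (f : R -> E -> R) := forall e, 0 < e < 1 -> rsmooth U (f e).

(** [g] is the derivative of the curve [e |-> f e] in [C^oo(U)]: the difference
    quotients converge together with all space derivatives, uniformly on compact
    sets. *)
Definition curve_deriv U (f g : R -> E -> R) := forall e, 0 < e < 1 ->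
  forall K, compact K -> K `<=` U -> forall s (eta : R), 0 < eta ->
  \forall h \near (0 : R)^', forall x, K x ->
    `|h^-1 * (rpartials s (f (e + h)) x - rpartials s (f e) x) - rpartials s (g e) x| <= eta.

Definition rsmooth_net U (f : R -> E -> R) := exists D : nat -> R -> E -> R,
  [/\ D 0%N = f, forall k, slices_smooth U (D k) & forall k, curve_deriv U (D k) (D k.+1)].

(** Smoothness is the greatest property [Q] such that every curve in [Q] has a
    derivative in [Q]. *)
Lemma rsmooth_net_coind U (Q : (R -> E -> R) -> Prop) :
  (forall f, Q f -> slices_smooth U f /\ exists2 g, Q g & curve_deriv U f g) ->
  forall f, Q f -> rsmooth_net U f.
Proof.
move=> H f Qf.
have /choice[D HD] : forall f, exists g, Q f -> Q g /\ curve_deriv U f g.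
  move=> g; have [Qg|nQ] := pselect (Q g); last by exists g.
  by have [_ [h Qh gh]] := H g Qg; exists h.
have QD k : Q (iter k D f) by elim: k => //= k /HD[].
exists (fun k => iter k D f); split => // k; first by have [] := H _ (QD k).
by have [] := HD _ (QD k).
Qed.

Lemma rsmooth_net_uncons U f : rsmooth_net U f ->
  slices_smooth U f /\ exists2 g, rsmooth_net U g & curve_deriv U f g.
Proof.
move=> [D [<- Ds Dd]]; split; first exact: Ds.
by exists (D 1%N) => //; exists (fun k => D k.+1); split.
Qed.

Lemma near_in01 (e : R) : 0 < e < 1 -> \forall h \near (0 : R)^', 0 < e + h < 1.
Proof.
move=> /andP[e0 e1].
have m0 : 0 < Num.min e (1 - e) by rewrite lt_min e0 subr_gt0.
near=> h.
have : `|h| < Num.min e (1 - e) by near: h; exact: dnbhs0_lt.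
rewrite lt_min !ltr_norml => /andP[/andP[h1 _] /andP[_ h2]].
by apply/andP; split; [move: h1; lra|move: h2; lra].
Unshelve. all: by end_near. Qed.

Lemma curve_derivD U f f' g g' : open U -> slices_smooth U f -> slices_smooth U f' -> slices_smooth U g -> slices_smooth U g' ->
  curve_deriv U f g -> curve_deriv U f' g' -> curve_deriv U (fun e x => f e x + f' e x) (fun e x => g e x + g' e x).
Proof.
move=> oU fs fs' gs gs' H H' e e01 K cK KU s eta eta0.
have e2 : 0 < eta / 2 by rewrite divr_gt0.
have N1 := H e e01 K cK KU s _ e2; have N2 := H' e e01 K cK KU s _ e2.
near=> h => x Kx; have Ux := KU _ Kx.
have eh : 0 < e + h < 1 by near: h; exact: near_in01.
rewrite (rpartialsD s oU (fs _ eh) (fs' _ eh) Ux) (rpartialsD s oU (fs _ e01) (fs' _ e01) Ux).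
rewrite (rpartialsD s oU (gs _ e01) (gs' _ e01) Ux).
have h1 : `|h^-1 * (rpartials s (f (e + h)) x - rpartials s (f e) x) - rpartials s (g e) x| <= eta / 2.
  by move: x Kx Ux; near: h; apply: filterS N1 => h Hh x Kx _; exact: Hh.
have h2 : `|h^-1 * (rpartials s (f' (e + h)) x - rpartials s (f' e) x) - rpartials s (g' e) x| <= eta / 2.
  by move: x Kx Ux h1; near: h; apply: filterS N2 => h Hh x Kx _ _; exact: Hh.
move: h1 h2.
move: (rpartials _ _ _) (rpartials _ _ _) (rpartials _ _ _) (rpartials _ _ _)
  (rpartials _ _ _) (rpartials _ _ _) => a1 a2 a3 a4 a5 a6 h1 h2.
rewrite [eta]splitr; apply: le_trans (lerD h1 h2); apply: le_trans (ler_normD _ _).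
by rewrite le_eqVlt; apply/orP; left; apply/eqP; congr (`|_|); ring.
Unshelve. all: by end_near. Qed.

Lemma curve_deriv_partial U f g i : curve_deriv U f g -> curve_deriv U (fun e => rpartial i (f e)) (fun e => rpartial i (g e)).
Proof.
move=> H e e01 K cK KU s eta eta0; have := H e e01 K cK KU (rcons s i) eta eta0.
by apply: filterS => h Hh x Kx; rewrite -!rpartials_rcons; exact: Hh.
Qed.

Lemma slices_smooth_partial U f i : slices_smooth U f -> slices_smooth U (fun e => rpartial i (f e)).
Proof. by move=> H e e01; apply: rsmooth_partial; exact: H. Qed.

Lemma prod_quot_est (h a b a' b' qa qb Ma : R) eta :
  `|qa - a'| <= eta -> `|qb - b'| <= eta -> `|h| <= eta -> 0 <= eta -> eta <= 1 ->
  `|a| <= Ma -> `|b| <= Ma -> `|a'| <= Ma -> `|b'| <= Ma -> 0 <= Ma ->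
  `|qa * b + a * qb + h * (qa * qb) - (a' * b + a * b')| <= eta * (2 * Ma + (Ma + 1) * (Ma + 1)).
Proof.
move=> ha hb hh eta0 eta1 aM bM aM' bM' M0.
have qaM : `|qa| <= Ma + 1.
  rewrite -(subrK a' qa) addrC; apply: (le_trans (ler_normD _ _)); apply: lerD => //.
  exact: le_trans ha eta1.
have qbM : `|qb| <= Ma + 1.
  rewrite -(subrK b' qb) addrC; apply: (le_trans (ler_normD _ _)); apply: lerD => //.
  exact: le_trans hb eta1.
rewrite (_ : _ - _ = (qa - a') * b + a * (qb - b') + h * (qa * qb)); last by ring.
apply: (le_trans (ler_normD _ _)).
rewrite [leRHS]mulrDr; apply: lerD; last first.
  by rewrite !normrM; apply: ler_pM => //; exact: ler_pM.
apply: (le_trans (ler_normD _ _)); rewrite !normrM mulr_natl mulr2n mulrDr.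
by apply: lerD; [exact: ler_pM|rewrite mulrC; exact: ler_pM].
Qed.

(** The Leibniz rule, by induction on the number of space derivatives. *)
Lemma curve_derivM U f f' g g' : open U -> slices_smooth U f -> slices_smooth U f' -> slices_smooth U g -> slices_smooth U g' ->
  curve_deriv U f g -> curve_deriv U f' g' ->
  curve_deriv U (fun e x => f e x * f' e x) (fun e x => g e x * f' e x + f e x * g' e x).
Proof.
move=> oU fs fs' gs gs' H H'.
suff S n : forall f f' g g', slices_smooth U f -> slices_smooth U f' -> slices_smooth U g -> slices_smooth U g' ->
  curve_deriv U f g -> curve_deriv U f' g' -> forall e, 0 < e < 1 ->
  forall K, compact K -> K `<=` U -> forall s, (size s <= n)%N -> forall (eta : R), 0 < eta ->
  \forall h \near (0 : R)^', forall x, K x ->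
    `|h^-1 * (rpartials s (fun x => f (e + h) x * f' (e + h) x) x - rpartials s (fun x => f e x * f' e x) x)
      - rpartials s (fun x => g e x * f' e x + f e x * g' e x) x| <= eta.
  by move=> e e01 K cK KU s eta eta0; exact: (S (size s)).
elim: n {f f' g g' fs fs' gs gs' H H'} => [|n IH] f f' g g' fs fs' gs gs' H H' e e01 K cK KU s.
  rewrite leqn0 size_eq0 => /eqP -> eta eta0 /=.
  have [B1 B10 HB1] := compact_bound (fs e e01) cK KU.
  have [B2 B20 HB2] := compact_bound (fs' e e01) cK KU.
  have [B3 B30 HB3] := compact_bound (gs e e01) cK KU.
  have [B4 B40 HB4] := compact_bound (gs' e e01) cK KU.
  pose M := B1 + B2 + B3 + B4.
  have M0 : 0 <= M by rewrite /M !addr_ge0.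
  pose Q := 2 * M + (M + 1) * (M + 1).
  have Q0 : 0 < Q.
    rewrite /Q ltr_wpDl//; first by rewrite mulr_ge0.
    by rewrite mulr_gt0// ltr_wpDl.
  pose de := Num.min 1 (eta / Q).
  have d0 : 0 < de by rewrite /de lt_min ltr01 divr_gt0.
  have N1 := H e e01 K cK KU [::] _ d0; have N2 := H' e e01 K cK KU [::] _ d0.
  near=> h => x Kx.
  have h0 : h != 0 by near: h; exact: nbhs_dnbhs_neq.
  have hd : `|h| <= de by near: h; exact: dnbhs0_le.
  have h1 : `|h^-1 * (f (e + h) x - f e x) - g e x| <= de.
    by move: x Kx; near: h.
  have h2 : `|h^-1 * (f' (e + h) x - f' e x) - g' e x| <= de.
    by move: x Kx h1; near: h; apply: filterS N2 => h Hh x Kx _; exact: Hh.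
  rewrite (_ : h^-1 * (_ - _) = (h^-1 * (f (e + h) x - f e x)) * f' e x +
     f e x * (h^-1 * (f' (e + h) x - f' e x)) +
     h * ((h^-1 * (f (e + h) x - f e x)) * (h^-1 * (f' (e + h) x - f' e x)))); last first.
    by field.
  have d1 : de <= 1 by rewrite /de ge_min lexx.
  apply: (le_trans (@prod_quot_est h _ _ _ _ _ _ M de h1 h2 hd (ltW d0) d1 _ _ _ _ M0)).
  - by apply: (le_trans (HB1 x Kx)); rewrite /M -!addrA lerDl !addr_ge0.
  - by apply: (le_trans (HB2 x Kx)); rewrite /M -!addrA addrCA lerDl !addr_ge0.
  - by apply: (le_trans (HB3 x Kx)); rewrite /M -addrA addrCA lerDl !addr_ge0.
  - by apply: (le_trans (HB4 x Kx)); rewrite /M lerDr !addr_ge0.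
  by rewrite -/Q -ler_pdivlMr// /de ge_min lexx orbT.
case: (lastP s) => [//|t i]; first by move=> _; exact: (IH f f' g g' fs fs' gs gs' H H' e e01 K cK KU [::] isT).
rewrite size_rcons ltnS => tn eta eta0.
have e2 : 0 < eta / 2 by rewrite divr_gt0.
have P a : slices_smooth U a -> slices_smooth U (fun e => rpartial i (a e)) by exact: slices_smooth_partial.
have N1 := IH _ _ _ _ (P _ fs) fs' (P _ gs) gs' (curve_deriv_partial i H) H' e e01 K cK KU t tn _ e2.
have N2 := IH _ _ _ _ fs (P _ fs') gs (P _ gs') H (curve_deriv_partial i H') e e01 K cK KU t tn _ e2.
have Leib (a b : E -> R) y : rsmooth U a -> rsmooth U b -> U y ->
    rpartials (rcons t i) (fun x => a x * b x) y =
    rpartials t (fun x => rpartial i a x * b x) y + rpartials t (fun x => a x * rpartial i b x) y.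
  move=> As Bs Uy; rewrite rpartials_rcons.
  rewrite -(rpartialsD t oU (rsmoothM oU (rsmooth_partial i As) Bs) (rsmoothM oU As (rsmooth_partial i Bs)) Uy).
  apply: (eq_on_rpartials t oU _ Uy) => z Uz.
  rewrite /rpartial deriveM; last 2 first.
    exact: rsmooth_derivable As Uz.
    exact: rsmooth_derivable Bs Uz.
  by rewrite addrC -![_ *: _]/(_ * _) [X in X + _]mulrC.
near=> h => x Kx; have Ux := KU _ Kx.
have eh : 0 < e + h < 1 by near: h; exact: near_in01.
have h1 : `|h^-1 * (rpartials t (fun x => rpartial i (f (e + h)) x * f' (e + h) x) x
    - rpartials t (fun x => rpartial i (f e) x * f' e x) x)
    - rpartials t (fun x => rpartial i (g e) x * f' e x + rpartial i (f e) x * g' e x) x| <= eta / 2.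
  by move: x Kx Ux; near: h; apply: filterS N1 => h Hh x Kx _; exact: Hh.
have h2 : `|h^-1 * (rpartials t (fun x => f (e + h) x * rpartial i (f' (e + h)) x) x
    - rpartials t (fun x => f e x * rpartial i (f' e) x) x)
    - rpartials t (fun x => g e x * rpartial i (f' e) x + f e x * rpartial i (g' e) x) x| <= eta / 2.
  by move: x Kx Ux h1; near: h; apply: filterS N2 => h Hh x Kx _ _; exact: Hh.
have sfe := fs _ e01; have sfe' := fs' _ e01; have sge := gs _ e01; have sge' := gs' _ e01.
have dfe := rsmooth_partial i sfe; have dfe' := rsmooth_partial i sfe'.
have dge := rsmooth_partial i sge; have dge' := rsmooth_partial i sge'.
rewrite (Leib _ _ _ (fs _ eh) (fs' _ eh) Ux) (Leib _ _ _ sfe sfe' Ux).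
rewrite (rpartialsD (rcons t i) oU (rsmoothM oU sge sfe') (rsmoothM oU sfe sge') Ux).
rewrite (Leib _ _ _ sge sfe' Ux) (Leib _ _ _ sfe sge' Ux).
move: h1 h2.
rewrite (rpartialsD t oU (rsmoothM oU dge sfe') (rsmoothM oU dfe sge') Ux).
rewrite (rpartialsD t oU (rsmoothM oU sge dfe') (rsmoothM oU sfe dge') Ux).
move: (rpartials _ _ _) (rpartials _ _ _) (rpartials _ _ _) (rpartials _ _ _)
  (rpartials _ _ _) (rpartials _ _ _) (rpartials _ _ _) (rpartials _ _ _)
  => a1 a2 a3 a4 a5 a6 a7 a8 h1 h2.
apply: le_trans (_ : eta / 2 + eta / 2 <= _); last by rewrite -splitr.
apply: le_trans (lerD h1 h2); apply: le_trans (ler_normD _ _).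
by rewrite le_eqVlt; apply/orP; left; apply/eqP; congr (`|_|); ring.
Unshelve. all: by end_near. Qed.

End Nets.

(** * Moderate and negligible real nets *)

Section NetClosure.
Context {R : realType} {d : nat}.
Local Notation E := 'rV[R]_d.
Implicit Types (U K : set E).

Lemma slices_smoothD U (f g : R -> E -> R) : open U -> slices_smooth U f -> slices_smooth U g -> slices_smooth U (fun e x => f e x + g e x).
Proof. by move=> oU fs gs e e01; apply: rsmoothD => //; [exact: fs|exact: gs]. Qed.

Lemma slices_smoothM U (f g : R -> E -> R) : open U -> slices_smooth U f -> slices_smooth U g -> slices_smooth U (fun e x => f e x * g e x).
Proof. by move=> oU fs gs e e01; apply: rsmoothM => //; [exact: fs|exact: gs]. Qed.

Lemma rsmooth_netD U (f g : R -> E -> R) : open U -> rsmooth_net U f -> rsmooth_net U g ->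
  rsmooth_net U (fun e x => f e x + g e x).
Proof.
move=> oU fs gs.
apply: (@rsmooth_net_coind _ _ U (fun h => exists a b, [/\ rsmooth_net U a, rsmooth_net U b &
  h = (fun e x => a e x + b e x)])); last by exists f, g.
move=> _ [a [b [/rsmooth_net_uncons[As [a' a's aa']] /rsmooth_net_uncons[bs [b' b's bb']] ->]]].
split; first exact: slices_smoothD.
exists (fun e x => a' e x + b' e x); first by exists a', b'.
by apply: curve_derivD => //; [have [] := rsmooth_net_uncons a's|have [] := rsmooth_net_uncons b's].
Qed.

Inductive prod_net U : (R -> E -> R) -> Prop :=
| PNmul a b : rsmooth_net U a -> rsmooth_net U b -> prod_net U (fun e x => a e x * b e x)
| PNadd f g : prod_net U f -> prod_net U g -> prod_net U (fun e x => f e x + g e x).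

Lemma rsmooth_netM U (f g : R -> E -> R) : open U -> rsmooth_net U f -> rsmooth_net U g ->
  rsmooth_net U (fun e x => f e x * g e x).
Proof.
move=> oU fs gs; apply: (@rsmooth_net_coind _ _ U (prod_net U)); last exact: PNmul.
have sm h : prod_net U h -> slices_smooth U h.
  elim=> [a b /rsmooth_net_uncons[As _] /rsmooth_net_uncons[bs _]|a b _ As _ bs].
    exact: slices_smoothM.
  exact: slices_smoothD.
move=> h hp; split; first exact: sm.
elim: hp => [a b As bs|a b ap [a' a'p aa'] bp [b' b'p bb']]; last first.
  exists (fun e x => a' e x + b' e x); first exact: PNadd.
  by apply: curve_derivD => //; exact: sm.
have [am [a' a's aa']] := rsmooth_net_uncons As.
have [bm [b' b's bb']] := rsmooth_net_uncons bs.
exists (fun e x => a' e x * b e x + a e x * b' e x).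
  by apply: PNadd; exact: PNmul.
by apply: curve_derivM => //; [have [] := rsmooth_net_uncons a's|have [] := rsmooth_net_uncons b's].
Qed.

Lemma rsmooth_net_cst U (f : E -> R) : open U -> rsmooth U f -> rsmooth_net U (fun=> f).
Proof.
move=> oU fs; apply: (@rsmooth_net_coind _ _ U (fun h => exists a, rsmooth U a /\ h = fun=> a)).
  move=> _ [a [As ->]]; split => //.
  exists (fun _ _ => 0); first by exists (fun=> 0); split => //; exact: rsmooth_cst.
  move=> e e01 K cK KU s eta eta0; near=> h => x Kx.
  rewrite subrr mulr0 sub0r normrN.
  have -> : rpartials s (fun=> 0 : R) = (fun=> 0) :> (E -> R).
    elim: s => //= i s ->; apply/funext => y; by rewrite /rpartial derive_cst.
  by rewrite normr0 ltW.
by exists f.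
Unshelve. all: by end_near. Qed.

Lemma rsmooth_net_sub U V (f : R -> E -> R) : V `<=` U -> rsmooth_net U f -> rsmooth_net V f.
Proof.
move=> VU [D [D0 Ds Dd]]; exists D; split => //.
  by move=> k e e01; apply: rsmoothS VU _; exact: Ds.
by move=> k e e01 K cK KV; apply: Dd => // x /KV /VU.
Qed.

Definition bounded_net b U (f : R -> E -> R) := rsmooth_net U f /\ derivs_bound b U f.

Lemma bounded_net_slices b U f : bounded_net b U f -> slices_smooth U f.
Proof. by move=> [/rsmooth_net_uncons[]]. Qed.

Lemma bounded_net_sub b U V f : V `<=` U -> bounded_net b U f -> bounded_net b V f.
Proof.
move=> VU [fs fb]; split; first exact: rsmooth_net_sub VU fs.
by move=> K cK KV; apply: fb => // x /KV /VU.
Qed.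


Lemma near_e01 : near0 (fun e : R => 0 < e < 1).
Proof. exact: near01. Qed.

Lemma derivs_boundD b U f g : open U -> slices_smooth U f -> slices_smooth U g -> derivs_bound b U f -> derivs_bound b U g ->
  derivs_bound b U (fun e x => f e x + g e x).
Proof.
move=> oU fs gs fb gb K cK KU s.
apply: (unif_bound_eq _ (unif_boundD (fb K cK KU s) (gb K cK KU s))).
apply: near0S near_e01 => e e01 x Kx.
by rewrite (rpartialsD s oU (fs e e01) (gs e e01) (KU _ Kx)).
Qed.

(** By the Leibniz rule, by induction on the number of derivatives. *)
Lemma derivs_boundM b U f g : open U -> slices_smooth U f -> slices_smooth U g -> derivs_bound b U f -> derivs_bound false U g ->
  derivs_bound b U (fun e x => f e x * g e x).
Proof.
move=> oU fs gs fb gb K cK KU s.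
suff S n : forall f g, slices_smooth U f -> slices_smooth U g -> derivs_bound b U f -> derivs_bound false U g ->
    forall s, (size s <= n)%N -> unif_bound b K (fun e => rpartials s (fun x => f e x * g e x)).
  exact: (S (size s)).
elim: n {s f g fs gs fb gb} => [|n IH] f g fs gs fb gb s.
  by rewrite leqn0 size_eq0 => /eqP ->; exact: (unif_boundM (fb K cK KU [::]) (gb K cK KU [::])).
case: (lastP s) => [_|t i]; first exact: (unif_boundM (fb K cK KU [::]) (gb K cK KU [::])).
rewrite size_rcons ltnS => tn.
have P b' a : derivs_bound b' U a -> derivs_bound b' U (fun e => rpartial i (a e)).
  move=> ab K' cK' KU' s'; have := ab K' cK' KU' (rcons s' i).
  by rewrite (_ : (fun e => rpartials _ (a e)) = (fun e => rpartials s' (rpartial i (a e)))) //;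
    apply/funext => e; rewrite rpartials_rcons.
have N1 := IH _ _ (slices_smooth_partial i fs) gs (P _ _ fb) gb t tn.
have N2 := IH _ _ fs (slices_smooth_partial i gs) fb (P _ _ gb) t tn.
apply: (unif_bound_eq _ (unif_boundD N1 N2)); apply: near0S near_e01 => e e01 x Kx.
have sf := fs e e01; have sg := gs e e01; have Ux := KU _ Kx.
rewrite rpartials_rcons.
rewrite -(rpartialsD t oU (rsmoothM oU (rsmooth_partial i sf) sg) (rsmoothM oU sf (rsmooth_partial i sg)) Ux).
apply: (eq_on_rpartials t oU _ Ux) => z Uz.
rewrite /rpartial [RHS]deriveM; last 2 first.
  exact: rsmooth_derivable sf Uz.
  exact: rsmooth_derivable sg Uz.
by rewrite addrC -![_ *: _]/(_ * _) [X in _ + X = _]mulrC.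
Qed.

Lemma bounded_netD b U f g : open U -> bounded_net b U f -> bounded_net b U g -> bounded_net b U (fun e x => f e x + g e x).
Proof.
move=> oU Hf Hg; split; first by apply: rsmooth_netD => //; [exact: Hf.1|exact: Hg.1].
by apply: derivs_boundD => //; [exact: bounded_net_slices Hf|exact: bounded_net_slices Hg|exact: Hf.2|exact: Hg.2].
Qed.

Lemma bounded_netM b U f g : open U -> bounded_net b U f -> bounded_net false U g -> bounded_net b U (fun e x => f e x * g e x).
Proof.
move=> oU Hf Hg; split; first by apply: rsmooth_netM => //; [exact: Hf.1|exact: Hg.1].
by apply: derivs_boundM => //; [exact: bounded_net_slices Hf|exact: bounded_net_slices Hg|exact: Hf.2|exact: Hg.2].
Qed.

Lemma bounded_net_cst U (f : E -> R) : open U -> rsmooth U f -> bounded_net false U (fun=> f).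
Proof.
move=> oU fs; split; first exact: rsmooth_net_cst.
move=> K cK KU s; have [B B0 HB] := compact_bound (rsmooth_partials s fs) cK KU.
by apply: (@unif_bound_bounded _ _ _ _ B) => e x _ Kx; exact: HB.
Qed.

Lemma bounded_net_zero b U : open U -> bounded_net b U (fun _ _ => 0).
Proof.
move=> oU; split; first by apply: rsmooth_net_cst => //; exact: rsmooth_cst.
move=> K cK KU s.
have Z : rpartials s (fun=> 0 : R) = (fun=> 0) :> (E -> R).
  elim: s => //= i s ->; apply/funext => y; by rewrite /rpartial derive_cst.
rewrite Z; case: b => [N|]; [exists 0|exists 0%N, 0];
  by apply: near0S near_e01 => e _ x _; rewrite normr0 mul0r.
Qed.

Lemma bounded_netZ b U c f : open U -> bounded_net b U f -> bounded_net b U (fun e x => c * f e x).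
Proof.
move=> oU Hf; have := bounded_netM oU Hf (bounded_net_cst oU (rsmooth_cst U c)).
rewrite (_ : (fun e x => f e x * _) = (fun e x => c * f e x)) //.
by apply/funext => e; apply/funext => x; rewrite mulrC.
Qed.

Lemma bounded_netN b U f : open U -> bounded_net b U f -> bounded_net b U (fun e x => - f e x).
Proof.
move=> oU Hf; have := bounded_netZ (-1) oU Hf.
rewrite (_ : (fun e x => -1 * _) = (fun e x => - f e x)) //.
by apply/funext => e; apply/funext => x; rewrite mulN1r.
Qed.

Lemma bounded_netB b U f g : open U -> bounded_net b U f -> bounded_net b U g -> bounded_net b U (fun e x => f e x - g e x).
Proof. by move=> oU Hf Hg; apply: bounded_netD => //; exact: bounded_netN. Qed.

(** * Negligibility of moderate nets needs no derivatives *)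

Lemma norm_delta_le1 (i : 'I_d) : `|delta_mx 0 i : E| <= 1.
Proof.
apply: row_norm_le => // l; rewrite mxE eqxx /=.
by case: eqP => _; rewrite ?normr1 ?normr0.
Qed.

Lemma shift_near_compact (K U : set E) (i : 'I_d) : open U -> compact K -> K `<=` U ->
  exists2 delta, 0 < delta & exists L, [/\ compact L, L `<=` U, K `<=` L &
    forall h x, 0 <= h < delta -> K x -> L (x + h *: delta_mx 0 i)].
Proof.
move=> oU cK KU; have [chi [L [W [[_ cL LU oW KW] [e1 e0]]]]] := cutoff oU cK KU.
have WL : W `<=` L.
  by move=> x Wx; apply: contrapT => /e0; rewrite e1// => /eqP; rewrite oner_eq0.
have [delta d0 H] : exists2 delta, 0 < delta & forall y : E, ball 0 delta y ->
    forall x, K x -> W (x + y).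
  have : \forall y \near (0 : E), K `<=` (fun x => W (x + y)).
    apply: ((compact_near_coveringP _).1 cK _ (nbhs (0 : E)) (fun y x => W (x + y))) => x Kx.
    have /nbhs_ballP[r /= r0 Hr] := near_openP oW (KW _ Kx).
    have r2 : 0 < r / 2 by rewrite divr_gt0.
    exists (ball x (r / 2), ball 0 (r / 2)) => /=; first by split; exact: nbhsx_ballx.
    move=> [x' y] /=; rewrite -!ball_normE /ball_ /= sub0r normrN => -[xx yy].
    apply: Hr; rewrite -ball_normE /ball_ /= opprD addrA.
    apply: (le_lt_trans (ler_normB _ _)); rewrite [r]splitr; exact: ltrD.
  by move=> /nbhs_ballP[r /= r0 Hr]; exists r => // y /Hr.
exists delta => //; exists L; split => // [x /KW/WL//|h x /andP[h0 hd] Kx].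
apply: WL; apply: H => //; rewrite -ball_normE /ball_ /= sub0r normrN normrZ ger0_norm//.
apply: le_lt_trans hd; apply: (@le_trans _ _ (h * 1)); last by rewrite mulr1.
by rewrite ler_wpM2l// norm_delta_le1.
Qed.

(** Taylor expansion with step [h]: a derivative is controlled by the values and by the
    second derivative. *)
Lemma interpolation_est (h g0 g1 D D2 t A B : R) : 0 < h -> h <= 1 -> 0 <= t <= 1 ->
  `|g0| <= A -> `|g1| <= A -> `|D2| <= B ->
  g1 - g0 = h * (D + t * h * D2) -> `|D| <= 2 * A / h + h * B.
Proof.
move=> h0 h1 /andP[t0 t1] ha hb hd E.
have -> : D = (g1 - g0) / h - t * h * D2.
  by rewrite E mulrC mulKf ?gt_eqF// addrK.
apply: (le_trans (ler_normB _ _)); apply: lerD.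
  rewrite normrM normfV (gtr0_norm h0) ler_pM2r ?invr_gt0//.
  by apply: (le_trans (ler_normB _ _)); rewrite mulr_natl mulr2n; exact: lerD.
rewrite !normrM (ger0_norm t0) (gtr0_norm h0); apply: ler_pM => //.
  by rewrite mulr_ge0// ltW.
by rewrite ger_pMl.
Qed.

(** With values [O(e^(N + P))] and a second derivative [O(e^-M)], the step [e ^ P] with
    [P = N + M + 1] makes both terms of [interpolation_est] of order [e ^ N]. *)
Lemma landau_step U (g : R -> E -> R) i : open U -> slices_smooth U g -> derivs_bound false U g ->
  (forall K, compact K -> K `<=` U -> unif_bound true K g) ->
  forall K, compact K -> K `<=` U -> unif_bound true K (fun e => rpartial i (g e)).
Proof.
move=> oU gs gb g0 K cK KU N.
have [delta d0 [L [cL LU KL HL]]] := shift_near_compact i oU cK KU.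
have [M [B B0 HB]] := unif_bound_pos (gb L cL LU [:: i; i]).
have {HB} HB := HB M (leqnn _).
pose P := (N + M + 1)%N.
have [A A0 HA] := unif_bound_pos (g0 L cL LU) (N + P)%N.
exists (2 * A + B).
apply: near0S (near0I (near0I HA HB) (near0I near_e01 (near01 d0))) => e [[hA hB] [e01 /andP[_ ed]]] x Kx.
have /andP[e0 e1] := e01.
pose h := e ^+ P.
have h0 : 0 < h by rewrite exprn_gt0.
have he : h <= e by rewrite -[leRHS]expr1; apply: exp_mono => //; rewrite /P addn1.
have hd : h < delta by exact: le_lt_trans ed.
have Lt s : 0 <= s <= 1 -> L (x + (s * h) *: delta_mx 0 i).
  move=> /andP[s0 s1]; apply: HL => //; rewrite mulr_ge0 ?(ltW h0)//=.
  by apply: le_lt_trans hd; rewrite ger_pMl.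
have I1 : 0 <= (1 : R) <= 1 by rewrite lexx ler01.
have Lx : L x by exact: KL.
have gse := gs e e01.
have [t t01 E1] : exists2 t, 0 <= t <= 1 & g e (x + h *: delta_mx 0 i) - g e x =
    h * rpartial i (g e) (x + (t * h) *: delta_mx 0 i).
  by apply: line_MVT => t t01; apply: (rsmooth_derivable gse); apply: LU; exact: Lt.
have /andP[t0 t1] := t01.
have [t' t'01 E2] : exists2 t', 0 <= t' <= 1 &
    rpartial i (g e) (x + (t * h) *: delta_mx 0 i) - rpartial i (g e) x =
    (t * h) * rpartial i (rpartial i (g e)) (x + (t' * (t * h)) *: delta_mx 0 i).
  apply: line_MVT => t' /andP[t'0 t'1].
  apply: (rsmooth_derivable (rsmooth_partial i gse)); apply: LU; rewrite mulrA; apply: Lt.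
  by rewrite mulr_ge0//= mulr_ile1.
have Lt' : L (x + (t' * (t * h)) *: delta_mx 0 i).
  have /andP[t'0 t'1] := t'01.
  by rewrite mulrA; apply: Lt; rewrite mulr_ge0//= mulr_ile1.
have L1 : L (x + h *: delta_mx 0 i) by have := Lt 1 I1; rewrite mul1r.
apply: le_trans (@interpolation_est h _ _ _ _ t _ _ h0 _ t01 (hA _ Lx) (hA _ L1) (hB _ Lt') _) _.
- by apply: (le_trans he); exact: ltW.
- by rewrite E1 -E2 [rpartial i (g e) x + _]addrC subrK.
rewrite [leRHS]mulrDl; apply: lerD.
  by rewrite exprD -/h !mulrA mulfK ?gt_eqF.
rewrite mulrCA ler_wpM2l// /h /P -addnA [(M + 1)%N]addnC addnA exprD -mulrA -exprMn divff ?gt_eqF//.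
by rewrite expr1n mulr1; apply: exp_mono => //; rewrite addn1.
Qed.

(** By induction on the order of the derivative, with [landau_step]. *)
Lemma landau U (f : R -> E -> R) : open U -> bounded_net false U f ->
  (forall K, compact K -> K `<=` U -> unif_bound true K f) -> bounded_net true U f.
Proof.
move=> oU Hf f0; split; first exact: Hf.1.
suff S s : forall K, compact K -> K `<=` U -> unif_bound true K (fun e => rpartials s (f e)).
  by move=> K cK KU s; exact: S.
elim: s => //= i s IH; apply: landau_step => //.
  by move=> e e01; apply: rsmooth_partials; exact: bounded_net_slices Hf _ _.
move=> K cK KU t; have := Hf.2 K cK KU (t ++ s).
by under eq_fun do rewrite rpartials_cat.
Qed.

(** * Nets given by jointly smooth functions *)

(** The parameter as a vector, so that [row_mx (epoint e) x] is the point [(e, x)]. *)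
Definition epoint (e : R) : 'rV[R]_1 := const_mx e.

Definition joint_dom U : set 'rV[R]_(1 + d) :=
  [set z : 'rV[R]_(1 + d) | 0 < z 0 (lshift d ord0) < 1 /\ U (rsubmx z)].

Lemma continuous_rsubmx m k : continuous (@rsubmx R 1 m k).
Proof.
move=> w; apply: (@cvg_rowP _ _ _ (nbhs w) _ (@rsubmx R 1 m k) (rsubmx w)) => j.
rewrite mxE (_ : (fun z => _) = (fun z : 'rV[R]_(m + k) => z 0 (rshift m j))).
  exact: coord_continuous.
by apply/funext => z; rewrite mxE.
Qed.

Lemma open_joint_dom U : open U -> open (joint_dom U).
Proof.
move=> oU.
rewrite (_ : joint_dom U = ((fun z : 'rV[R]_(1 + d) => z 0 (lshift d ord0)) @^-1` `]0, 1[%classic) `&`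
   (@rsubmx R 1 1 d @^-1` U)); last first.
  by apply/seteqP; split => z /=; rewrite in_itv.
apply: openI.
  apply: open_comp; last exact: itv_open.
  by move=> w _; exact: coord_continuous.
apply: open_comp => // w _; exact: continuous_rsubmx.
Qed.

Lemma joint_dom_mem U e x : 0 < e < 1 -> U x -> joint_dom U (row_mx (epoint e) x).
Proof.
move=> e01 Ux; split; last by rewrite row_mxKr.
by rewrite row_mxEl mxE.
Qed.

(** The derivative of the curve is the partial derivative of [Phi] in its first coordinate;
    by [diff_quot_cvg] the difference quotients converge to it uniformly on compact
    sets. The class of such nets is thus closed under derivation. *)
Lemma joint_net U (Phi : 'rV[R]_(1 + d) -> R) (f : R -> E -> R) : open U ->
  rsmooth (joint_dom U) Phi ->
  (forall e x, 0 < e < 1 -> U x -> f e x = Phi (row_mx (epoint e) x)) ->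
  rsmooth_net U f.
Proof.
move=> oU Ps fP; have oJ := open_joint_dom oU.
pose Q (f : R -> E -> R) := exists Phi, rsmooth (joint_dom U) Phi /\ (forall e x, 0 < e < 1 -> U x -> f e x = Phi (row_mx (epoint e) x)).
apply: (@rsmooth_net_coind _ _ U Q); last by exists Phi.
move=> {Phi f Ps fP} f [Phi [Ps fP]].
have sl e P : 0 < e < 1 -> rsmooth (joint_dom U) P -> rsmooth U (fun x => P (row_mx (epoint e) x)).
  move=> e01 Ps'; apply: (rsmooth_rslice oJ oU _ Ps') => r Ur; exact: joint_dom_mem.
have fs : slices_smooth U f.
  move=> e e01; apply: (rsmooth_eq oU _ (sl e Phi e01 Ps)) => x Ux; exact/esym/fP.
split => //.
pose D := rpartial (lshift d ord0) Phi.
have Ds : rsmooth (joint_dom U) D by exact: rsmooth_partial.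
exists (fun e x => D (row_mx (epoint e) x)); first by exists D.
move=> e e01 K cK KU s eta eta0.
have KW x : K x -> joint_dom U (row_mx (epoint e) x) by move=> /KU; exact: joint_dom_mem.
have N := @diff_quot_cvg R 1 d (joint_dom U) (rpartials (map (@rshift 1 d) s) Phi)
  (epoint e) K ord0 oJ (rsmooth_partials _ Ps) cK KW eta eta0.
near=> h => x Kx; have Ux := KU _ Kx.
have eh : 0 < e + h < 1 by near: h; exact: near_in01.
rewrite (eq_on_rpartials s oU (fun y Uy => fP _ y eh Uy) Ux).
rewrite (eq_on_rpartials s oU (fun y Uy => fP _ y e01 Uy) Ux).
rewrite !rpartials_rslice (rpartials_partialC _ _ oJ Ps (joint_dom_mem e01 Ux)).
have -> : epoint (e + h) = epoint e + h *: delta_mx 0 0.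
  by apply/rowP => j; rewrite !mxE (ord1 j) eqxx mulr1.
move: x Kx Ux; near: h; apply: filterS N => h Hh x Kx _; exact: Hh.
Unshelve. all: by end_near. Qed.

Lemma joint_derivs_bound U (Phi : 'rV[R]_(1 + d) -> R) (f : R -> E -> R) b : open U ->
  (forall e x, 0 < e < 1 -> U x -> f e x = Phi (row_mx (epoint e) x)) ->
  (forall K, compact K -> K `<=` U -> mbnd (fun z : 'rV[R]_(1 + d) => z 0 (lshift d ord0))
     [set z : 'rV[R]_(1 + d) | 0 < z 0 (lshift d ord0) < 1 /\ K (rsubmx z)] b Phi) ->
  derivs_bound b U f.
Proof.
move=> oU fP H K cK KU s.
have key e x : 0 < e < 1 -> K x -> rpartials s (f e) x =
    rpartials (map (@rshift 1 d) s) Phi (row_mx (epoint e) x).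
  move=> e01 Kx; rewrite (eq_on_rpartials s oU (fun y Uy => fP _ y e01 Uy) (KU _ Kx)).
  by rewrite rpartials_rslice.
have mem e x : 0 < e < 1 -> K x ->
    0 < (row_mx (epoint e) x : 'rV[R]_(1 + d)) 0 (lshift d ord0) < 1 /\ K (rsubmx (row_mx (epoint e) x)).
  by move=> e01 Kx; rewrite row_mxEl mxE row_mxKr.
have ee e (x : E) : (row_mx (epoint e) x : 'rV[R]_(1 + d)) 0 (lshift d ord0) = e by rewrite row_mxEl mxE.
case: b H => H.
  move=> N; have [C HC] := H K cK KU (map (@rshift 1 d) s) N; exists C.
  apply: near0S near_e01 => e e01 x Kx; rewrite key//.
  by have := HC _ (mem e x e01 Kx); rewrite ee.
have [N [C HC]] := H K cK KU (map (@rshift 1 d) s); exists N, C.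
apply: near0S near_e01 => e e01 x Kx; rewrite key//.
by have := HC _ (mem e x e01 Kx); rewrite ee.
Qed.

End NetClosure.

(** * Complex functions and seminorms *)

Section ComplexBridge.
Context {R : realType} {d : nat}.
Local Notation E := 'rV[R]_d.
Local Notation C := R[i].
Local Notation net := (@net R d).
Local Notation at0 := (0^'+ : set_system R).
Implicit Types (U K : set E) (f g : E -> C).

Definition reF f : E -> R := fun x => complex.Re (f x).
Definition imF f : E -> R := fun x => complex.Im (f x).

Lemma cpartialsE s f x :
  cpartials s f x = (rpartials s (reF f) x) +i* (rpartials s (imF f) x).
Proof.
elim: s x => [|i s IH] x /=; first by rewrite /reF /imF; case: (f x).
rewrite /cpartial.
have -> : (fun y => complex.Re (cpartials s f y)) = rpartials s (reF f).
  by apply/funext => y; rewrite IH.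
have -> // : (fun y => complex.Im (cpartials s f y)) = rpartials s (imF f).
by apply/funext => y; rewrite IH.
Qed.

Lemma smoothP U f : smooth U f <-> rsmooth U (reF f) /\ rsmooth U (imF f).
Proof.
have E1 s : (fun y => complex.Re (cpartials s f y)) = rpartials s (reF f).
  by apply/funext => y; rewrite cpartialsE.
have E2 s : (fun y => complex.Im (cpartials s f y)) = rpartials s (imF f).
  by apply/funext => y; rewrite cpartialsE.
split=> [H|[/rsmoothP H1 /rsmoothP H2] s x Ux].
  split; apply/rsmoothP => s x Ux; have [] := H s x Ux; rewrite E1 E2 => h1 h2 h3.
    by split => // i; have [] := h3 i.
  by split => // i; have [] := h3 i.
have [a1 b1] := H1 s x Ux; have [a2 b2] := H2 s x Ux.
by rewrite E1 E2; split.
Qed.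

Lemma cmodE (a b : R) : cmod (a +i* b) = Num.sqrt (a ^+ 2 + b ^+ 2).
Proof. by []. Qed.

Lemma cmod_ge0 (z : C) : 0 <= cmod z.
Proof. by case: z => a b; rewrite cmodE sqrtr_ge0. Qed.

Lemma Re_le_cmod (z : C) : `|complex.Re z| <= cmod z.
Proof. by case: z => a b; rewrite cmodE /= -sqrtr_sqr ler_wsqrtr// lerDl sqr_ge0. Qed.

Lemma Im_le_cmod (z : C) : `|complex.Im z| <= cmod z.
Proof. by case: z => a b; rewrite cmodE /= -sqrtr_sqr ler_wsqrtr// lerDr sqr_ge0. Qed.

Lemma cmod_le (z : C) : cmod z <= `|complex.Re z| + `|complex.Im z|.
Proof.
case: z => a b; rewrite cmodE /= -[leRHS]ger0_norm ?addr_ge0// -sqrtr_sqr ler_wsqrtr//.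
rewrite sqrrD !real_normK ?num_real// addrAC lerDl.
by rewrite mulrn_wge0// mulr_ge0.
Qed.

Lemma cmodM (z w : C) : cmod (z * w) = cmod z * cmod w.
Proof. exact: Normc.normcM. Qed.

Lemma cmodD (z w : C) : cmod (z + w) <= cmod z + cmod w.
Proof. exact: le_normcD. Qed.

Lemma cmod1 : cmod (1 : C) = 1. Proof. exact: Normc.normc1. Qed.

Lemma cmod0 : cmod (0 : C) = 0. Proof. exact: Normc.normc0. Qed.

Lemma cmod_real (a : R) : cmod a%:C = `|a|.
Proof. by rewrite cmodE expr0n addr0 sqrtr_sqr. Qed.

Lemma cmodN1 : cmod (-1 : C) = 1.
Proof. by have -> : (-1 : C) = (-1)%:C; [rewrite rmorphN1|rewrite cmod_real normrN1]. Qed.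

Let Sset K k f := [set r : R | exists s : seq 'I_d, exists x : E,
    [/\ (size s <= k)%N, K x & r = cmod (cpartials s f x)]].

Lemma Ck_has_ub U K k f : smooth U f -> compact K -> K `<=` U -> has_ubound (Sset K k f).
Proof.
move=> /smoothP[f1 f2] cK KU.
have /choice[B HB] : forall s : {bseq k of 'I_d}, exists B : R, 0 <= B /\
    forall x, K x -> cmod (cpartials s f x) <= B.
  move=> s; have [B1 B10 H1] := compact_bound (rsmooth_partials s f1) cK KU.
  have [B2 B20 H2] := compact_bound (rsmooth_partials s f2) cK KU.
  exists (B1 + B2); split; first exact: addr_ge0.
  move=> x Kx; apply: (le_trans (cmod_le _)); rewrite cpartialsE /=.
  by apply: lerD; [exact: H1|exact: H2].
exists (\sum_s B s) => _ [s [x [sk Kx ->]]].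
apply: (le_trans ((HB (Bseq sk)).2 x Kx)).
by rewrite (bigD1 (Bseq sk))//= lerDl sumr_ge0// => t _; have [] := HB t.
Qed.

Lemma Ck_ub U K k f s x : smooth U f -> compact K -> K `<=` U -> (size s <= k)%N -> K x ->
  cmod (cpartials s f x) <= Ck_seminorm K k f.
Proof.
move=> fs cK KU sk Kx; apply: (ub_le_sup (Ck_has_ub k fs cK KU)).
by exists s, x; split.
Qed.

Lemma Ck_le K k f (B : R) : 0 <= B ->
  (forall s x, (size s <= k)%N -> K x -> cmod (cpartials s f x) <= B) -> Ck_seminorm K k f <= B.
Proof.
move=> B0 H; rewrite /Ck_seminorm -/(Sset K k f).
have [->|/set0P ne] := eqVneq (Sset K k f) set0; first by rewrite sup0.
by apply: ge_sup => // _ [s [x [sk Kx ->]]]; exact: H.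
Qed.

Lemma Ck_ge0 U K k f : smooth U f -> compact K -> K `<=` U -> 0 <= Ck_seminorm K k f.
Proof.
move=> fs cK KU; have [K0|/set0P[x Kx]] := eqVneq K set0.
  rewrite /Ck_seminorm (_ : [set r | _] = set0) ?sup0//.
  by apply/seteqP; split => // r [s [x []]]; rewrite K0.
by apply: le_trans (@Ck_ub U K k f [::] x fs cK KU isT Kx); exact: cmod_ge0.
Qed.

Lemma smoothD U f g : open U -> smooth U f -> smooth U g -> smooth U (f \+ g).
Proof.
move=> oU /smoothP[f1 f2] /smoothP[g1 g2]; apply/smoothP.
rewrite (_ : reF (f \+ g) = fun x => reF f x + reF g x); last first.
  by apply/funext => x; rewrite /reF /=; case: (f x) (g x) => [? ?] [].
rewrite (_ : imF (f \+ g) = fun x => imF f x + imF g x); last first.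
  by apply/funext => x; rewrite /imF /=; case: (f x) (g x) => [? ?] [].
by split; exact: rsmoothD.
Qed.

Lemma cpartialsD U f g s x : open U -> smooth U f -> smooth U g -> U x ->
  cpartials s (f \+ g) x = cpartials s f x + cpartials s g x.
Proof.
move=> oU /smoothP[f1 f2] /smoothP[g1 g2] Ux; rewrite !cpartialsE.
rewrite (_ : reF (f \+ g) = fun x => reF f x + reF g x); last first.
  by apply/funext => y; rewrite /reF /=; case: (f y) (g y) => [? ?] [].
rewrite (_ : imF (f \+ g) = fun x => imF f x + imF g x); last first.
  by apply/funext => y; rewrite /imF /=; case: (f y) (g y) => [? ?] [].
by rewrite (rpartialsD s oU f1 g1 Ux) (rpartialsD s oU f2 g2 Ux).
Qed.

Lemma reFZ (a : C) f : reF (a \*o f) = fun x => complex.Re a * reF f x - complex.Im a * imF f x.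
Proof. by apply/funext => x; rewrite /reF /imF /=; case: a (f x) => [? ?] []. Qed.

Lemma imFZ (a : C) f : imF (a \*o f) = fun x => complex.Re a * imF f x + complex.Im a * reF f x.
Proof. by apply/funext => x; rewrite /reF /imF /=; case: a (f x) => [? ?] []. Qed.

Lemma smoothZ U (a : C) f : open U -> smooth U f -> smooth U (a \*o f).
Proof.
move=> oU /smoothP[f1 f2]; apply/smoothP; rewrite reFZ imFZ.
by split; [apply: rsmoothB => //|apply: rsmoothD => //]; exact: rsmoothZ.
Qed.

Lemma cpartialsZ U (a : C) f s x : open U -> smooth U f -> U x ->
  cpartials s (a \*o f) x = a * cpartials s f x.
Proof.
move=> oU /smoothP[f1 f2] Ux; rewrite !cpartialsE reFZ imFZ.
have Z c h : rsmooth U h -> rsmooth U (fun x => c * h x) by move=> hs; exact: rsmoothZ.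
rewrite (rpartialsB s oU (Z _ _ f1) (Z _ _ f2) Ux) (rpartialsD s oU (Z _ _ f2) (Z _ _ f1) Ux).
rewrite (rpartialsZ _ _ oU f1 Ux) (rpartialsZ _ _ oU f2 Ux).
rewrite (rpartialsZ _ _ oU f1 Ux) (rpartialsZ _ _ oU f2 Ux).
by case: a.
Qed.

(** The supremum is finite by compactness, and it inherits subadditivity and homogeneity
    from the modulus. *)
Lemma Ck_seminorm_continuous U K k : open U -> compact K -> K `<=` U ->
  continuous_seminorm U (Ck_seminorm K k).
Proof.
move=> oU cK KU.
have le_scale a f : smooth U f -> Ck_seminorm K k (a \*o f) <= cmod a * Ck_seminorm K k f.
  move=> fs; apply: Ck_le; first by rewrite mulr_ge0 ?cmod_ge0 ?(Ck_ge0 k fs cK KU).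
  move=> s x sk Kx; rewrite (cpartialsZ _ _ oU fs (KU _ Kx)) cmodM.
  by rewrite ler_wpM2l ?cmod_ge0// (Ck_ub fs cK KU).
split.
- move=> f g fs gs; apply: Ck_le.
    by rewrite addr_ge0// (@Ck_ge0 U).
  move=> s x sk Kx; rewrite (cpartialsD _ oU fs gs (KU _ Kx)).
  apply: (le_trans (cmodD _ _)).
  by apply: lerD; [exact: (Ck_ub fs cK KU)|exact: (Ck_ub gs cK KU)].
- move=> a f fs; apply/eqP; rewrite eq_le le_scale//=.
  have [->|a0] := eqVneq a 0.
    rewrite cmod0 mul0r; exact: (Ck_ge0 k (smoothZ 0 oU fs) cK KU).
  have fE : f = (a^-1 \*o (a \*o f)).
    by apply/funext => x /=; rewrite mulKf.
  have ca : 0 < cmod a.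
    by rewrite lt_neqAle cmod_ge0 andbT eq_sym; apply: contra a0 => /eqP /Normc.eq0_normc ->.
  have := le_scale a^-1 _ (smoothZ a oU fs); rewrite -fE => H.
  apply: (le_trans (ler_wpM2l (ltW ca) H)).
  by rewrite mulrA -cmodM divff// cmod1 mul1r.
- by exists K, k, 1; split => // f _; rewrite mul1r.
Qed.

(** [0 = p (f - f) <= 2 p f]. *)
Lemma seminorm_ge0 U p f : open U -> continuous_seminorm U p -> smooth U f -> 0 <= p f.
Proof.
move=> oU [pD pZ _] fs.
have f0 := pD f ((-1) \*o f) fs (smoothZ (-1) oU fs).
have z : p (f \+ ((-1) \*o f)) = 0.
  rewrite (_ : _ \+ _ = 0 \*o f); last by apply/funext => x /=; rewrite mulN1r subrr mul0r.
  by rewrite pZ// cmod0 mul0r.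
move: f0; rewrite z pZ// cmodN1 mul1r -mulr2n.
by rewrite pmulrn_lge0.
Qed.

(** * Moderate and negligible nets through real and imaginary parts *)

Definition reN (f : net) : R -> E -> R := fun e => reF (f e).
Definition imN (f : net) : R -> E -> R := fun e => imF (f e).

Definition cnet (f : R -> E -> R) (g : R -> E -> R) : net :=
  fun e x => f e x +i* g e x.

Lemma quotient_parts U (f g : net) e h s x : open U ->
  smooth U (f (e + h)) -> smooth U (f e) -> smooth U (g e) -> U x ->
  cpartials s (fun x => (h^-1)%:C * (f (e + h) x - f e x) - g e x) x =
  (h^-1 * (rpartials s (reN f (e + h)) x - rpartials s (reN f e) x) - rpartials s (reN g e) x) +i*
  (h^-1 * (rpartials s (imN f (e + h)) x - rpartials s (imN f e) x) - rpartials s (imN g e) x).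
Proof.
move=> oU /smoothP[a1 a2] /smoothP[b1 b2] /smoothP[c1 c2] Ux; rewrite cpartialsE.
have D u v w : rsmooth U u -> rsmooth U v -> rsmooth U w ->
    rpartials s (fun x => h^-1 * (u x - v x) - w x) x =
    h^-1 * (rpartials s u x - rpartials s v x) - rpartials s w x.
  move=> us vs ws; rewrite (rpartialsB s oU (rsmoothZ _ oU (rsmoothB oU us vs)) ws Ux).
  by rewrite (rpartialsZ _ _ oU (rsmoothB oU us vs) Ux) (rpartialsB s oU us vs Ux).
rewrite /reN /imN; congr (_ +i* _).
  rewrite -(D _ _ _ a1 b1 c1); congr (rpartials _ _ _); apply/funext => y; rewrite /reF /=.
  by case: (f (e + h) y) (f e y) (g e y) => [? ?] [? ?] [? ?] /=; rewrite mul0r subr0.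
rewrite -(D _ _ _ a2 b2 c2); congr (rpartials _ _ _); apply/funext => y; rewrite /imF /=.
by case: (f (e + h) y) (f e y) (g e y) => [? ?] [? ?] [? ?] /=; rewrite mul0r addr0.
Qed.

Lemma quotient_smooth U (f g : net) e h : open U ->
  smooth U (f (e + h)) -> smooth U (f e) -> smooth U (g e) ->
  smooth U (fun x => (h^-1)%:C * (f (e + h) x - f e x) - g e x).
Proof.
move=> oU a b c.
have := smoothD oU (smoothZ (h^-1)%:C oU (smoothD oU a (smoothZ (-1) oU b))) (smoothZ (-1) oU c).
rewrite (_ : _ \+ _ = (fun x => (h^-1)%:C * (f (e + h) x - f e x) - g e x)) //.
by apply/funext => x /=; rewrite !mulN1r.
Qed.

Lemma net_derivativeP U (f g : net) : open U ->
  (forall e, 0 < e < 1 -> smooth U (f e)) -> (forall e, 0 < e < 1 -> smooth U (g e)) ->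
  net_derivative U f g <-> curve_deriv U (reN f) (reN g) /\ curve_deriv U (imN f) (imN g).
Proof.
move=> oU fs gs; split=> [H|[H1 H2]].
  suff key e K s eta : 0 < e < 1 -> compact K -> K `<=` U -> 0 < eta ->
    \forall h \near (0 : R)^', forall x, K x ->
    cmod (cpartials s (fun x => (h^-1)%:C * (f (e + h) x - f e x) - g e x) x) <= eta.
    split=> e e01 K cK KU s eta eta0; near=> h => x Kx.
      have eh : 0 < e + h < 1 by near: h; exact: near_in01.
      have h0 : cmod (cpartials s (fun x => (h^-1)%:C * (f (e + h) x - f e x) - g e x) x) <= eta.
        by move: x Kx; near: h; exact: key.
      apply: le_trans h0.
      rewrite (quotient_parts s oU (fs _ eh) (fs _ e01) (gs _ e01) (KU _ Kx)).
      exact: (@Re_le_cmod (_ +i* _)).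
    have eh : 0 < e + h < 1 by near: h; exact: near_in01.
    have h0 : cmod (cpartials s (fun x => (h^-1)%:C * (f (e + h) x - f e x) - g e x) x) <= eta.
      by move: x Kx; near: h; exact: key.
    apply: le_trans h0.
    rewrite (quotient_parts s oU (fs _ eh) (fs _ e01) (gs _ e01) (KU _ Kx)).
    exact: (@Im_le_cmod (_ +i* _)).
  move=> e01 cK KU eta0.
  have /cvgrPdist_le/(_ _ eta0) N := H e e01 _ (Ck_seminorm_continuous (size s) oU cK KU).
  near=> h => x Kx.
  have eh : 0 < e + h < 1 by near: h; exact: near_in01.
  have qs := quotient_smooth oU (fs _ eh) (fs _ e01) (gs _ e01).
  apply: (le_trans (Ck_ub qs cK KU (leqnn _) Kx)).
  have : `|0 - Ck_seminorm K (size s) (fun x => (h^-1)%:C * (f (e + h) x - f e x) - g e x)| <= eta.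
    by near: h.
  by rewrite sub0r normrN; apply: le_trans; exact: ler_norm.
move=> e e01 p pc; have [pD pZ [K [k [M [cK KU pM]]]]] := pc.
apply/cvgrPdist_le => eta eta0.
have M1 : 0 < `|M| + 1 by rewrite ltr_wpDl.
have e2 : 0 < eta / (`|M| + 1) / 2 by rewrite !divr_gt0.
have N F G : curve_deriv U F G -> \forall h \near (0 : R)^', forall s, (size s <= k)%N -> forall x, K x ->
    `|h^-1 * (rpartials s (F (e + h)) x - rpartials s (F e) x) - rpartials s (G e) x|
      <= eta / (`|M| + 1) / 2.
  by move=> FG; apply: near_short => s; exact: (FG e e01 K cK KU s _ e2).
have N1 := N _ _ H1; have N2 := N _ _ H2.
near=> h.
have eh : 0 < e + h < 1 by near: h; exact: near_in01.
have qs := quotient_smooth oU (fs _ eh) (fs _ e01) (gs _ e01).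
rewrite sub0r normrN ger0_norm ?(seminorm_ge0 oU pc qs)//.
apply: (le_trans (pM _ qs)).
have C0 := Ck_ge0 k qs cK KU.
apply: (@le_trans _ _ (`|M| * (eta / (`|M| + 1)))); last first.
  by rewrite mulrCA ger_pMr// ler_pdivrMr// mul1r lerDl.
apply: (@le_trans _ _ (`|M| * Ck_seminorm K k (fun x => (h^-1)%:C * (f (e + h) x - f e x) - g e x))).
  by rewrite ler_wpM2r// ler_norm.
rewrite ler_wpM2l//; apply: Ck_le; first by rewrite ltW// divr_gt0.
move=> s x sk Kx; rewrite (quotient_parts s oU (fs _ eh) (fs _ e01) (gs _ e01) (KU _ Kx)).
apply: (le_trans (cmod_le _)) => /=; rewrite [leRHS]splitr; apply: lerD.
  by move: s sk x Kx; near: h.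
have := N2; move=> _.
move: s sk x Kx; near: h; exact: N2.
Unshelve. all: by end_near. Qed.

Lemma smooth_netP U (f : net) : open U ->
  smooth_net U f <-> rsmooth_net U (reN f) /\ rsmooth_net U (imN f).
Proof.
move=> oU; split=> [[D [D0 Ds Dd]]|[[D1 [D10 D1s D1d]] [D2 [D20 D2s D2d]]]].
  have P k := (net_derivativeP oU (fun e e01 => Ds k e e01) (fun e e01 => Ds k.+1 e e01)).1 (Dd k).
  split; [exists (fun k => reN (D k))|exists (fun k => imN (D k))]; split.
  - by rewrite D0.
  - by move=> k e e01; have /smoothP[] := Ds k e e01.
  - by move=> k; have [] := P k.
  - by rewrite D0.
  - by move=> k e e01; have /smoothP[] := Ds k e e01.
  - by move=> k; have [] := P k.
have sm k e : 0 < e < 1 -> smooth U (cnet (D1 k) (D2 k) e).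
  by move=> e01; apply/smoothP; split; [exact: D1s|exact: D2s].
exists (fun k => cnet (D1 k) (D2 k)); split.
- by rewrite D10 D20; apply/funext => e; apply/funext => x; rewrite /cnet /reN /imN /reF /imF; case: (f e x).
- exact: sm.
- move=> k; apply/(net_derivativeP oU (sm k) (sm k.+1)); split; [exact: D1d|exact: D2d].
Qed.

Lemma smooth_net_smooth U (f : net) e : smooth_net U f -> 0 < e < 1 -> smooth U (f e).
Proof. by move=> [D [<- Ds _]]; exact: Ds. Qed.

(** A continuous seminorm is bounded by finitely many derivatives on one compact set. *)
Lemma unif_bound_seminorm_k U (f : net) p K k M (N : int) : open U -> smooth_net U f ->
  continuous_seminorm U p -> compact K -> K `<=` U ->
  (forall f, smooth U f -> p f <= M * Ck_seminorm K k f) ->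
  (forall s : {bseq k of 'I_d}, exists B : R, near0 (fun e => forall x, K x ->
     `|rpartials s (reN f e) x| <= B * e ^ N /\ `|rpartials s (imN f e) x| <= B * e ^ N)) ->
  (fun e : R => p (f e)) =O_at0 (fun e : R => e ^ N).
Proof.
move=> oU fs pc cK KU pM /choice[B HB].
have NB : near0 (fun e => forall s : {bseq k of 'I_d}, forall x, K x ->
     `|rpartials s (reN f e) x| <= B s * e ^ N /\ `|rpartials s (imN f e) x| <= B s * e ^ N).
  by rewrite /near0; apply: filter_forall => s; exact: HB.
apply/eqO_exP; exists (`|M| * (2 * \sum_s `|B s|) + 1); first by rewrite ltr_wpDl// !mulr_ge0// sumr_ge0.
apply: near0S (near0I NB near_e01) => e [hB e01].
have fe := smooth_net_smooth fs e01.
have /andP[e0 e1] := e01.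
have eN : 0 < e ^ N by exact: exprz_gt0.
rewrite (ger0_norm (seminorm_ge0 oU pc fe)) (gtr0_norm eN).
apply: (le_trans (pM _ fe)).
have C0 := Ck_ge0 k fe cK KU.
apply: (@le_trans _ _ (`|M| * Ck_seminorm K k (f e))).
  by rewrite ler_wpM2r// ler_norm.
apply: (@le_trans _ _ (`|M| * (2 * \sum_s `|B s|) * e ^ N)); last first.
  by rewrite ler_wpM2r ?(ltW eN)// lerDl.
rewrite -[leRHS]mulrA ler_wpM2l//; apply: Ck_le.
  by rewrite !mulr_ge0 ?(ltW eN)// sumr_ge0.
move=> s x sk Kx; apply: (le_trans (cmod_le _)); rewrite cpartialsE /=.
have [h1 h2] := hB (Bseq sk) x Kx.
have BS : B (Bseq sk) * e ^ N <= (\sum_s `|B s|) * e ^ N.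
  rewrite ler_wpM2r ?(ltW eN)//; apply: (le_trans (ler_norm _)).
  by rewrite (bigD1 (Bseq sk))//= lerDl sumr_ge0.
rewrite -mulrA mulr_natl mulr2n.
by apply: lerD; [exact: le_trans h1 BS|exact: le_trans h2 BS].
Qed.

Lemma seminorm_unif_bound U (f : net) (N : int) K s : open U -> smooth_net U f ->
  compact K -> K `<=` U ->
  (fun e : R => Ck_seminorm K (size s) (f e)) =O_at0 (fun e : R => e ^ N) ->
  exists B : R, near0 (fun e => forall x, K x ->
     `|rpartials s (reN f e) x| <= B * e ^ N /\ `|rpartials s (imN f e) x| <= B * e ^ N).
Proof.
move=> oU fs cK KU /eqO_exP[B B0 HB]; exists B.
apply: near0S (near0I HB near_e01) => e [hB e01] x Kx.
have fe := smooth_net_smooth fs e01.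
have /andP[e0 e1] := e01.
move: hB; rewrite (gtr0_norm (exprz_gt0 _ e0)) (ger0_norm (Ck_ge0 _ fe cK KU)) => hB.
have := le_trans (Ck_ub fe cK KU (leqnn _) Kx) hB; rewrite cpartialsE => h.
by split; apply: le_trans h; [exact: (@Re_le_cmod (_ +i* _))|exact: (@Im_le_cmod (_ +i* _))].
Qed.

Lemma moderateP U (f : net) : open U ->
  moderate U f <-> bounded_net false U (reN f) /\ bounded_net false U (imN f).
Proof.
move=> oU; split=> [[fs H]|[[f1 b1] [f2 b2]]].
  have [f1 f2] := (smooth_netP f oU).1 fs.
  suff : forall K, compact K -> K `<=` U -> forall s, exists N (B : R), near0 (fun e => forall x, K x ->
     `|rpartials s (reN f e) x| <= B * e^-1 ^+ N /\ `|rpartials s (imN f e) x| <= B * e^-1 ^+ N).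
    move=> S; split; split => // K cK KU s; have [N [B h]] := S K cK KU s; exists N, B;
      by apply: near0S h => e h x /h[].
  move=> K cK KU s.
  have [N HN] := H _ (Ck_seminorm_continuous (size s) oU cK KU).
  have [B HB] := seminorm_unif_bound oU fs cK KU HN.
  exists `|N|%N, `|B|; apply: near0S (near0I HB near_e01) => e [hB e01] x Kx.
  have [h1 h2] := hB x Kx; have /andP[e0 e1] := e01.
  have W : B * e ^ N <= `|B| * e^-1 ^+ `|N|%N.
    apply: (le_trans (ler_norm _)); rewrite normrM ler_wpM2l// gtr0_norm ?exprz_gt0//.
    case: N {HN HB hB h1 h2} => n; last by rewrite NegzE /= exprVn.
    apply: (@le_trans _ _ 1); first by apply: exprn_ile1; exact: ltW.
    by apply: exprn_ege1; rewrite invf_ge1// ltW.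
  by split; [exact: le_trans h1 W|exact: le_trans h2 W].
have fs : smooth_net U f by apply/smooth_netP.
split => // p pc; have [_ _ [K [k [M [cK KU pM]]]]] := pc.
have /choice[N /choice[B HB]] : forall s : {bseq k of 'I_d}, exists N (B : R), 0 <= B /\
    forall n, (N <= n)%N -> near0 (fun e => forall x, K x ->
     `|rpartials s (reN f e) x| <= B * e^-1 ^+ n /\ `|rpartials s (imN f e) x| <= B * e^-1 ^+ n).
  move=> s; have [N1 [B1 B10 H1]] := unif_bound_pos (b1 K cK KU s).
  have [N2 [B2 B20 H2]] := unif_bound_pos (b2 K cK KU s).
  exists (N1 + N2)%N, (B1 + B2); split; first exact: addr_ge0.
  move=> n Nn.
  have /H1 h1 : (N1 <= n)%N by exact: leq_trans (leq_addr _ _) Nn.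
  have /H2 h2 : (N2 <= n)%N by exact: leq_trans (leq_addl _ _) Nn.
  apply: near0S (near0I near_e01 (near0I h1 h2)) => e [/andP[e0 _] [a1 a2]] x Kx.
  have en : 0 <= e^-1 ^+ n by rewrite exprn_ge0// invr_ge0 ltW.
  split; first by apply: (le_trans (a1 x Kx)); rewrite ler_wpM2r// lerDl.
  by apply: (le_trans (a2 x Kx)); rewrite ler_wpM2r// lerDr.
exists (- (\sum_s N s)%N%:Z).
apply: (unif_bound_seminorm_k oU fs pc cK KU pM) => s; exists (B s).
have NN : (N s <= \sum_s N s)%N by rewrite (bigD1 s)//= leq_addr.
apply: near0S ((HB s).2 _ NN) => e he x Kx; have := he x Kx.
by rewrite exprVn -exprnN.
Qed.

Lemma negligibleP U (f : net) : open U ->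
  negligible_net U f <-> bounded_net true U (reN f) /\ bounded_net true U (imN f).
Proof.
move=> oU; split=> [[fs H]|[[f1 b1] [f2 b2]]].
  have [f1 f2] := (smooth_netP f oU).1 fs.
  suff : forall K, compact K -> K `<=` U -> forall s N, exists (B : R), near0 (fun e => forall x, K x ->
     `|rpartials s (reN f e) x| <= B * e ^+ N /\ `|rpartials s (imN f e) x| <= B * e ^+ N).
    move=> S; split; split => // K cK KU s N; have [B h] := S K cK KU s N; exists B;
      by apply: near0S h => e h x /h[].
  move=> K cK KU s N.
  exact: (seminorm_unif_bound oU fs cK KU (H _ (Ck_seminorm_continuous (size s) oU cK KU) N%:Z)).
have fs : smooth_net U f by apply/smooth_netP.
split => // p pc N; have [_ _ [K [k [M [cK KU pM]]]]] := pc.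
apply: (unif_bound_seminorm_k oU fs pc cK KU pM) => s.
have [B1 B10 h1] := unif_bound_pos (b1 K cK KU s) `|N|%N.
have [B2 B20 h2] := unif_bound_pos (b2 K cK KU s) `|N|%N.
exists (B1 + B2).
apply: near0S (near0I near_e01 (near0I h1 h2)) => e [e01 [a1 a2]] x Kx.
have /andP[e0 e1] := e01.
have W B : 0 <= B -> B <= B1 + B2 -> B * e ^+ `|N|%N <= (B1 + B2) * e ^ N.
  move=> B0 BB; apply: ler_pM => //; first by rewrite exprn_ge0// ltW.
  case: (N) => n //; rewrite NegzE /= -exprnN -exprVn.
  apply: (@le_trans _ _ 1); first by apply: exprn_ile1; exact: ltW.
  by apply: exprn_ege1; rewrite invf_ge1// ltW.
split; first by apply: (le_trans (a1 x Kx)); apply: W => //; rewrite lerDl.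
by apply: (le_trans (a2 x Kx)); apply: W => //; rewrite lerDr.
Qed.

End ComplexBridge.

(** * Integration over row vectors *)

Section TupleMeasure.
Context {R : realType}.
Local Notation mR := (measurableTypeR R).
Local Notation lam := (@lebesgue_measure R).

Definition to_row d (t : d.-tuple R) : 'rV[R]_d := \row_i tnth t i.

(** The tuples carry the product sigma-algebra, for which continuous functions are a limit of
    functions of countably many values: round the coordinates down to multiples of
    [1 / (k + 1)]. *)
Lemma continuous_measurable_tuple d (f : 'rV[R]_d -> R) : continuous f ->
  measurable_fun setT (fun t : d.-tuple mR => f (to_row t)).
Proof.
move=> cf.
pose Z (k : nat) (x : R) : int := Num.floor (k.+1%:R * x).
pose rounded (k : nat) (z : d.-tuple int) : 'rV[R]_d := \row_i ((tnth z i)%:~R / k.+1%:R).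
apply: (@measurable_fun_cvg _ _ _ setT (fun k (t : d.-tuple mR) => f (rounded k [tuple Z k (tnth t i) | i < d]))).
  move=> k _ A mA; rewrite setTI.
  pose F (z : d.-tuple int) : set (d.-tuple mR) :=
    if `[< A (f (rounded k z)) >] then [set t | forall i, Z k (tnth t i) = tnth z i] else set0.
  rewrite (_ : _ @^-1` _ = \bigcup_z F z); last first.
    apply/seteqP; split=> [t /= At|t [z _]].
      exists [tuple Z k (tnth t i) | i < d] => //; rewrite /F asboolT// => i.
      by rewrite tnth_mktuple.
    rewrite /F; case: asboolP => //= Az tz.
    suff -> : [tuple Z k (tnth t i) | i < d] = z by [].
    by apply: eq_from_tnth => i; rewrite tnth_mktuple tz.
  apply: countable_bigcupT_measurable => [|z]; first exact: countableP.
  rewrite /F; case: asboolP => // _.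
  rewrite (_ : [set t | _] = \bigcap_(i in [set: 'I_d]) [set t : d.-tuple mR | Z k (tnth t i) = tnth z i]); last first.
    by apply/seteqP; split=> [t H i _|t H i]; [exact: H|exact: (H i I)].
  apply: fin_bigcap_measurable => //.
  move=> i _.
  have mt := @measurable_tnth _ mR d i.
  rewrite (_ : [set t | _] = setT `&` (fun t => tnth t i) @^-1` [set x : mR | Z k x = tnth z i]); last first.
    by rewrite setTI.
  apply: mt => //.
  rewrite /Z (_ : [set x | _] = `[((tnth z i)%:~R / k.+1%:R), ((tnth z i + 1)%:~R / k.+1%:R)[%classic) //.
  apply/seteqP; split=> x /=; rewrite in_itv /= ler_pdivrMr ?ltr0n// ltr_pdivlMr ?ltr0n// mulrC.
    by move=> <-; rewrite mulrC floor_itv.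
  exact: floor_def.
move=> t _.
have c : f y @[y --> to_row t] --> f (to_row t) by exact: cf.
apply: (cvg_comp _ _ _ c).
apply: cvg_rowP => i; rewrite mxE.
apply/cvgrPdist_le => e e0; near=> k.
rewrite mxE tnth_mktuple /Z.
have k0 : 0 < k.+1%:R :> R by rewrite ltr0n.
have /andP[h1 h2] := floor_itv (k.+1%:R * tnth t i).
have ke : e^-1 <= k.+1%:R.
  apply: (@le_trans _ _ k%:R); last by rewrite ler_nat.
  by near: k; exact: nbhs_infty_ger.
have e1 : k.+1%:R^-1 <= e by rewrite invf_ple.
apply: le_trans e1; move: h1 h2; move: (Num.floor _) => z; move: (tnth t i) k0 => x.
move: (k.+1%:R : R) => K K0 h1 h2.
rewrite (_ : x - _ = K^-1 * (K * x - z%:~R)); last by field; rewrite gt_eqF.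
rewrite normrM gtr0_norm ?invr_gt0// ler_piMr ?invr_ge0 ?ltW//.
rewrite ltr_norml ltrBlDl; apply/andP; split.
  by rewrite (lt_le_trans (ltrN10 _))// subr_ge0.
by move: h2; rewrite intrD.
Unshelve. all: by end_near. Qed.

(** Up to the factor both sides are measures in [A], and they agree on intervals. *)
Lemma lebesgue_affine (a b : R) (A : set mR) : a != 0 -> measurable A ->
  lam ((fun x => a * x + b) @^-1` A) = (`|a|^-1%:E * lam A)%E.
Proof.
move=> a0 mA.
have mphi : measurable_fun setT (fun x : mR => a * x + b : mR).
  apply: continuous_measurable_fun => x.
  by apply: cvgD; [apply: cvgM; [exact: cvg_cst|exact: cvg_id]|exact: cvg_cst].
pose aa : {nonneg R} := NngNum (normr_ge0 a).
have [mu muE] : exists mu : {measure set mR -> \bar R},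
    forall X, mu X = (`|a|%:E * lam ((fun x : mR => (a * x + b)%R : mR) @^-1` X))%E.
  pose mu0 := fun H : measurable_fun setT (fun x : mR => a * x + b : mR) =>
    (mscale aa (pushforward lam (fun x : mR => a * x + b : mR)) : {measure set mR -> \bar R}).
  by exists (mu0 mphi mphi).
have E X : ocitv X -> lam X = mu X.
  move=> [[u v] _ <-] /=; rewrite muE /=.
  rewrite lebesgue_measure_itv /= lte_fin.
  have [a1|a1] : a < 0 \/ 0 < a by apply/orP; rewrite -neq_lt.
    rewrite (_ : _ @^-1` _ = `[((v - b) / a), ((u - b) / a)[%classic); last first.
      apply/seteqP; split => x /=; rewrite !in_itv /= => /andP[h1 h2].
        by rewrite ler_ndivrMr// ltr_ndivlMr// mulrC lerBrDr h2 ltrBlDr h1.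
      by move: h1 h2; rewrite ler_ndivrMr// ltr_ndivlMr// mulrC lerBrDr ltrBlDr => -> ->.
    rewrite lebesgue_measure_itv /= lte_fin ltr_ndivrMr// divfK// ltrD2r ltr0_norm//.
    case: ifP => _; rewrite ?mule0// -EFinB -EFinD -EFinM; congr (_%:E).
    by field.
  rewrite (_ : _ @^-1` _ = `]((u - b) / a), ((v - b) / a)]%classic); last first.
    apply/seteqP; split => x /=; rewrite !in_itv /= => /andP[h1 h2].
      by rewrite ltr_pdivrMr// ler_pdivlMr// mulrC lerBrDr h2 ltrBlDr h1.
    by move: h1 h2; rewrite ltr_pdivrMr// ler_pdivlMr// mulrC lerBrDr ltrBlDr => -> ->.
  rewrite lebesgue_measure_itv /= lte_fin ltr_pdivrMr// divfK// ltrD2r gtr0_norm//.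
  case: ifP => _; rewrite ?mule0// -EFinB -EFinD -EFinM; congr (_%:E).
  by field.
have := lebesgue_measure_unique E mA; rewrite muE => ->.
rewrite muleA -EFinM mulVf ?normr_eq0// mul1e.
by [].
Qed.

Lemma measurable_affine (a b : R) : measurable_fun setT (fun x : mR => a * x + b : mR).
Proof.
apply: continuous_measurable_fun => x.
by apply: cvgD; [apply: cvgM; [exact: cvg_cst|exact: cvg_id]|exact: cvg_cst].
Qed.

Lemma integral_affine (a b : R) (G : mR -> \bar R) : a != 0 -> measurable_fun setT G ->
  (forall x, 0 <= G x)%E ->
  (\int[lam]_x G (a * x + b)%R = `|a|^-1%:E * \int[lam]_x G x)%E.
Proof.
move=> a0 mG G0.
have := @ge0_integral_pushforward _ _ _ _ R _ (measurable_affine a b) lam setT G measurableT mG (fun y _ => G0 y).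
rewrite preimage_setT => <-.
have a1 : 0 <= `|a|^-1 by rewrite invr_ge0.
pose aa : {nonneg R} := NngNum a1.
rewrite -(ge0_integral_mscale lam measurableT aa mG (fun x _ => G0 x)) /=.
apply: eq_measure_integral; first exact: measurable_affine.
by move=> m A mA _; exact: lebesgue_affine.
Qed.

Lemma integral_tupleS m (F : m.+1.-tuple mR -> \bar R) : measurable_fun setT F ->
  (forall t, 0 <= F t)%E ->
  (\int[lebesgue_tuple m.+1]_t F t =
   \int[lam]_x \int[lebesgue_tuple m]_t F [tuple of x :: t])%E.
Proof.
move=> mF F0.
have := @ge0_integral_pushforward _ _ _ _ R _ (@measurable_tuple_cons R m)
  (lam \x lebesgue_tuple m)%E setT F measurableT mF (fun y _ => F0 y).
rewrite preimage_setT => E.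
rewrite [LHS]E fubini_tonelli1//; last by move=> x; exact: F0.
by apply: measurableT_comp mF _; exact: measurable_tuple_cons.
Qed.


Lemma measurable_tuple_fun dd (T : measurableType dd) m (f : T -> m.-tuple mR) :
  (forall i, measurable_fun setT (fun x => tnth (f x) i)) -> measurable_fun setT f.
Proof. by move=> H; exact/measurable_fun_tnthP. Qed.

Lemma measurable_section m (x : R) (F : m.+1.-tuple mR -> \bar R) : measurable_fun setT F ->
  measurable_fun setT (fun t : m.-tuple mR => F [tuple of x :: t]).
Proof.
move=> mF; apply: (measurableT_comp mF).
apply: (measurableT_comp (@measurable_tuple_cons R m) (measurable_pair1 x)).
Qed.

Lemma measurable_partial_integral m (F : m.+1.-tuple mR -> \bar R) : measurable_fun setT F ->
  (forall t, 0 <= F t)%E ->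
  measurable_fun setT (fun x : mR => \int[lebesgue_tuple m]_t F [tuple of x :: t])%E.
Proof.
move=> mF F0.
exact: (@measurable_fun_fubini_tonelli_F _ _ _ _ _ (lebesgue_tuple m) (F \o (@tuple_cons R m))
  (measurableT_comp mF (@measurable_tuple_cons R m)) (fun x => F0 _)).
Qed.

(** The map [t |-> a t + b], except that the last coordinate moreover receives [k] and a
    linear function, with coefficients [c], of the earlier coordinates. The recursion peels the first coordinate, adding its contribution to [k]. As a function
    of [r], the argument [e^-1 (p r^-1)] of the mollifier has this form. *)
Fixpoint tri_affine m (a : R) (b c : nat -> R) (k : R) : m.-tuple R -> m.-tuple R :=
  match m return m.-tuple R -> m.-tuple R with
  | 0 => fun t => t
  | m'.+1 => fun t => [tuple of (a * thead t + b 0%N + (m' == 0%N)%:R * k) ::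
       tri_affine a (b \o S) (c \o S) (k + c 0%N * thead t) [tuple of behead t]]
  end.

Lemma tri_affine_tnth m a b c k (t : m.-tuple R) (i : 'I_m) :
  tnth (tri_affine a b c k t) i = a * tnth t i + b i + (i.+1 == m)%:R *
    (k + \sum_(j < m | (j.+1 < m)%N) c j * tnth t j).
Proof.
elim: m b c k t i => [|m IH] b c k t i; first by case: i.
have [j ->|->] := unliftP ord0 i; last first.
  rewrite /= tnth0 eqSS; case: m {IH i} t => [|m] t; rewrite /= ?mul0r ?addr0//.
  by rewrite big_mkcond big_ord_recl big_ord0 /= !addr0.
rewrite /= (_ : tnth [tuple of _ :: _] (lift ord0 j) = tnth (tri_affine a (b \o S) (c \o S) (k + c 0%N * thead t) [tuple of behead t]) j); last first.
  by rewrite [in LHS](tnth_nth 0) [in RHS](tnth_nth 0).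
have E (l : 'I_m) : tnth t (lift ord0 l) = tnth [tuple of behead t] l.
  by rewrite !(tnth_nth 0) /= nth_behead.
rewrite IH E; congr (_ + _ * _).
rewrite big_mkcond [in RHS]big_mkcond big_ord_recl /= ltnS.
have -> : (0 < m)%N by case: (m) (j) => // -[].
by rewrite addrA; congr (_ + _); apply: eq_bigr => l _; rewrite E.
Qed.

Lemma tri_affine_measurable m a b c k : measurable_fun setT (@tri_affine m a b c k : m.-tuple mR -> m.-tuple mR).
Proof.
apply: measurable_tuple_fun => i; under eq_fun do rewrite tri_affine_tnth.
apply: measurable_funD.
  by apply: measurable_funD => //; apply: measurable_funM => //; exact: measurable_tnth.
apply: measurable_funM => //; apply: measurable_funD => //.
under eq_fun do rewrite big_mkcond.
apply: measurable_sum => j; case: ((j.+1 < m)%N) => //.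
by apply: measurable_funM => //; exact: measurable_tnth.
Qed.

(** By Tonelli, integrating the last coordinates first: for a fixed first coordinate they
    undergo a map of the same kind. *)
Lemma integral_tri_affine m a b c k (F : m.-tuple mR -> \bar R) : a != 0 -> measurable_fun setT F ->
  (forall t, 0 <= F t)%E ->
  (\int[lebesgue_tuple m]_t F (tri_affine a b c k t) =
   (`|a|^-1 ^+ m)%:E * \int[lebesgue_tuple m]_t F t)%E.
Proof.
move=> a0; elim: m b c k F => [|m IH] b c k F mF F0.
  by rewrite expr0 mul1e.
rewrite !integral_tupleS//; last by apply: (measurableT_comp mF); exact: tri_affine_measurable.
have th x (t : m.-tuple R) : thead [tuple of x :: t] = x by rewrite theadE.
have bh x (t : m.-tuple R) : [tuple of behead [tuple of x :: t]] = t by apply/val_inj.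
have a1 : 0 <= `|a|^-1 by rewrite invr_ge0.
have mI := measurable_partial_integral mF F0.
transitivity (\int[lam]_x ((`|a|^-1 ^+ m)%:E * \int[lebesgue_tuple m]_t F [tuple of (a * x + (b 0%N + (m == 0%N)%:R * k))%R :: t]))%E.
  apply: eq_integral => x _.
  rewrite -(IH (b \o S) (c \o S) (k + c 0%N * x) (fun t => F [tuple of (a * x + (b 0%N + (m == 0%N)%:R * k))%R :: t]))//; last exact: measurable_section.
  apply: eq_integral => t _; congr F; apply/val_inj => /=.
  by rewrite bh th addrA.
move: mI; set G := (fun x : mR => integral _ _ _) => mI.
have G0 x : (0 <= G x)%E by apply: integral_ge0.
pose b' := b 0%N + (m == 0%N)%:R * k.
transitivity ((`|a|^-1 ^+ m)%:E * \int[lam]_x G (a * x + b')%R)%E.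
  apply: (@ge0_integralZl _ _ _ lam setT measurableT (fun x => G (a * x + b')%R)).
  - exact: (measurableT_comp mI (measurable_affine a _)).
  - by [].
  - by rewrite lee_fin exprn_ge0.
rewrite (integral_affine b' a0 mI G0).
by rewrite muleA -EFinM exprSr.
Qed.

Lemma Rintegral_tri_affine m a b c k (F : m.-tuple mR -> R) : a != 0 -> measurable_fun setT F ->
  \int[lebesgue_tuple m]_t F (tri_affine a b c k t) = `|a|^-1 ^+ m * \int[lebesgue_tuple m]_t F t.
Proof.
move=> a0 mF; have mE : measurable_fun setT (EFin \o F) by exact/measurable_EFinP.
have a1 : 0 <= `|a|^-1 ^+ m by rewrite exprn_ge0// invr_ge0.
rewrite /Rintegral integralE [in RHS]integralE.
have := integral_tri_affine b c k a0 (measurable_funepos mE) (fun t => funepos_ge0 _ t).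
have := integral_tri_affine b c k a0 (measurable_funeneg mE) (fun t => funeneg_ge0 _ t).
rewrite (_ : (fun t => (EFin \o F)^\+ (tri_affine a b c k t))%E = ((fun t => (F (tri_affine a b c k t))%:E)^\+)%E); last first.
  by apply/funext => t; rewrite !funeposE.
rewrite (_ : (fun t => (EFin \o F)^\- (tri_affine a b c k t))%E = ((fun t => (F (tri_affine a b c k t))%:E)^\-)%E); last first.
  by apply/funext => t; rewrite !funenegE.
move=> -> ->.
have c0 : 0 < `|a|^-1 ^+ m by rewrite exprn_gt0// invr_gt0 normr_gt0.
move: (integral _ _ _) (integral _ _ _) => P N.
move: (_ ^+ m) c0 => r r0.
case: P => [P| |]; case: N => [N| |] //=; rewrite ?gt0_muley ?gt0_muleNy ?lte_fin//= ?mulr0//.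
by rewrite mulrBr.
Qed.


Lemma integral_oneDsqrV : (\int[lam]_x ((oneDsqr x)^-1)%:E = pi%:E)%E.
Proof.
rewrite ge0_symfun_integralT; last 3 first.
- by move=> x; rewrite invr_ge0 ltW// (lt_le_trans _ (oneDsqr_ge1 x)).
- exact: continuous_oneDsqrV.
- by move=> x/=; rewrite /oneDsqr sqrrN.
rewrite (_ : [set x | _] = `[0, +oo[%classic); last first.
  by apply/seteqP; split => x/=; rewrite in_itv/= andbT.
by rewrite integral0y_oneDsqr -EFinM mulrCA divff// mulr1.
Qed.

(** An integrable weight, a product of functions of one variable, that dominates every
    Schwartz function. *)
Definition decay_weight d (q : 'rV[R]_d) : R := \prod_i (oneDsqr (q 0 i))^-1.

Lemma oneDsqr_gt0 (x : R) : 0 < oneDsqr x.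
Proof. exact: lt_le_trans (oneDsqr_ge1 x). Qed.

Lemma decay_weight_ge0 d (q : 'rV[R]_d) : 0 <= decay_weight q.
Proof. by apply: prodr_ge0 => i _; rewrite invr_ge0 ltW// oneDsqr_gt0. Qed.

Lemma measurable_oneDsqrV : measurable_fun setT (fun x : mR => (oneDsqr x)^-1 : mR).
Proof. by apply: continuous_measurable_fun; exact: continuous_oneDsqrV. Qed.

Lemma measurable_decay_weight d :
  measurable_fun setT (fun t : d.-tuple mR => decay_weight (to_row t)).
Proof.
apply: measurable_prod => i _; under eq_fun do rewrite mxE.
apply: (@measurableT_comp _ _ _ _ _ _ (fun x : mR => (oneDsqr x)^-1)).
  exact: measurable_oneDsqrV.
exact: measurable_tnth.
Qed.

Lemma integral_decay_weight d :
  (\int[lebesgue_tuple d]_t (decay_weight (to_row t))%:E = (pi ^+ d)%:E)%E.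
Proof.
elim: d => [|d IH].
  rewrite /= integral_dirac//; last by apply/measurable_EFinP; exact: measurable_decay_weight.
  by rewrite /dirac indicT mul1e /decay_weight big_ord0 expr0.
have mE k : measurable_fun setT (fun t : k.-tuple mR => (decay_weight (to_row t))%:E).
  by apply/measurable_EFinP; exact: measurable_decay_weight.
rewrite integral_tupleS//; last by move=> t; rewrite lee_fin decay_weight_ge0.
transitivity (\int[lam]_x ((pi ^+ d)%:E * ((oneDsqr x)^-1)%:E))%E; last first.
  rewrite (@ge0_integralZl _ _ _ lam setT measurableT).
  - by rewrite integral_oneDsqrV -EFinM exprSr.
  - by apply/measurable_EFinP; exact: measurable_oneDsqrV.
  - by move=> x _; rewrite lee_fin invr_ge0 ltW// oneDsqr_gt0.
  - by rewrite lee_fin exprn_ge0// pi_ge0.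
apply: eq_integral => x _; rewrite muleC -IH.
rewrite -(@ge0_integralZl _ _ _ (lebesgue_tuple d) setT measurableT).
- apply: eq_integral => t _; rewrite -EFinM; congr EFin.
  rewrite /decay_weight big_ord_recl !mxE tnth0; congr (_ * _).
  by apply: eq_bigr => i _; rewrite !mxE (tnth_nth 0) /= -tnth_nth.
- exact: mE.
- by move=> t _; rewrite lee_fin decay_weight_ge0.
- by rewrite lee_fin invr_ge0 ltW// oneDsqr_gt0.
Qed.

Lemma integrable_decay_weight d :
  (lebesgue_tuple d).-integrable setT (fun t : d.-tuple mR => (decay_weight (to_row t))%:E).
Proof.
apply/integrableP; split; first by apply/measurable_EFinP; exact: measurable_decay_weight.
rewrite (_ : (fun t => _) = fun t : d.-tuple mR => (decay_weight (to_row t))%:E).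
  by rewrite integral_decay_weight ltry.
by apply/funext => t; rewrite gee0_abs// lee_fin decay_weight_ge0.
Qed.

Lemma decay_weight_ge d (q : 'rV[R]_d) : 1 <= (1 + `|q|) ^+ (d + d) * decay_weight q.
Proof.
rewrite addnn -mul2n exprM -[X in _ ^+ X]card_ord -prodr_const -big_split /=.
elim/big_ind: _ => // [x y x1 y1|i _]; first by rewrite -[1]mulr1 ler_pM.
rewrite ler_pdivlMr ?oneDsqr_gt0// mul1r /oneDsqr -(real_normK (num_real (q 0 i))).
have := coord_le_norm q i; have := normr_ge0 (q 0 i).
move: `|q 0 i| `|q| => x y x0 xy; nra.
Qed.

Definition integrable_rV d (f : 'rV[R]_d -> R) :=
  (lebesgue_tuple d).-integrable setT (fun t : d.-tuple mR => (f (to_row t))%:E).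

Lemma integrable_rVD d (f g : 'rV[R]_d -> R) : integrable_rV f -> integrable_rV g -> integrable_rV (fun q => f q + g q).
Proof. exact: integrableD. Qed.

Lemma integrable_rVB d (f g : 'rV[R]_d -> R) : integrable_rV f -> integrable_rV g -> integrable_rV (fun q => f q - g q).
Proof. exact: integrableB. Qed.

Lemma integrable_rVZ d c (f : 'rV[R]_d -> R) : integrable_rV f -> integrable_rV (fun q => c * f q).
Proof. exact: integrableZl. Qed.

Lemma Rintegral_rVD d (f g : 'rV[R]_d -> R) : integrable_rV f -> integrable_rV g ->
  Rintegral_rV (fun q => f q + g q) = Rintegral_rV f + Rintegral_rV g.
Proof. exact: RintegralD. Qed.

Lemma Rintegral_rVB d (f g : 'rV[R]_d -> R) : integrable_rV f -> integrable_rV g ->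
  Rintegral_rV (fun q => f q - g q) = Rintegral_rV f - Rintegral_rV g.
Proof. exact: RintegralB. Qed.

Lemma Rintegral_rVZ d c (f : 'rV[R]_d -> R) : integrable_rV f ->
  Rintegral_rV (fun q => c * f q) = c * Rintegral_rV f.
Proof. exact: RintegralZl. Qed.

Lemma integrable_rV_dominated d (f : 'rV[R]_d -> R) (M : R) : continuous f ->
  (forall q, `|f q| <= M * decay_weight q) -> integrable_rV f.
Proof.
move=> cf fM.
apply: (@le_integrable _ _ _ _ _ measurableT _ (fun t : d.-tuple mR => (M%:E * (decay_weight (to_row t))%:E)%E)).
- by apply/measurable_EFinP; exact: continuous_measurable_tuple.
- by move=> t _; rewrite -EFinM /= lee_fin (le_trans (fM _))// ler_norm.
- by apply: integrableZl => //; exact: integrable_decay_weight.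
Qed.

Lemma Rintegral_rV_bound d (f : 'rV[R]_d -> R) (M : R) : integrable_rV f ->
  (forall q, `|f q| <= M * decay_weight q) -> `|Rintegral_rV f| <= M * pi ^+ d.
Proof.
move=> fi fM; apply: le_trans (le_normr_Rintegral measurableT fi) _.
have -> : M * pi ^+ d = \int[lebesgue_tuple d]_t (M * decay_weight (to_row t)).
  by rewrite RintegralZl//; [rewrite /Rintegral integral_decay_weight|exact: integrable_decay_weight].
apply: le_Rintegral => //.
- exact: (integrable_abse fi).
- exact: (integrableZl measurableT M (integrable_decay_weight d)).
Qed.

(** The factor [(1 + `|q|) ^ (2 d)] compensates the weight by [decay_weight_ge], so that
    it suffices to bound [(1 + `|q|) ^ (N + 2 d) * `|sigma q|], for [`|q| <= 1] and [`|q| > 1]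
    separately. *)
Lemma schwartz_dominated d (sigma : 'rV[R]_d -> R) N : rschwartz sigma ->
  exists2 M : R, 0 <= M & forall q, (1 + `|q|) ^+ N * `|sigma q| <= M * decay_weight q.
Proof.
move=> sS.
have [M1 M10 H1] := rschwartz_decay 0 [::] sS.
have [M2 M20 H2] := rschwartz_decay (N + (d + d)) [::] sS.
exists (2 ^+ (N + (d + d)) * (M1 + M2)).
  by rewrite mulr_ge0 ?addr_ge0// exprn_ge0.
move=> q; apply: (@le_trans _ _ (((1 + `|q|) ^+ N * `|sigma q|) * ((1 + `|q|) ^+ (d + d) * decay_weight q))).
  by rewrite ler_peMr ?decay_weight_ge// mulr_ge0// exprn_ge0// addr_ge0.
rewrite (_ : _ * (_ * decay_weight q) = decay_weight q * (`|sigma q| * (1 + `|q|) ^+ (N + (d + d)))); last first.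
  by rewrite [in RHS](exprD _ N); ring.
rewrite [X in _ <= X]mulrC ler_wpM2l ?decay_weight_ge0//.
have [q1|q1] := leP `|q| 1.
  apply: (@le_trans _ _ (`|sigma q| * 2 ^+ (N + (d + d)))).
    rewrite ler_wpM2l// lerXn2r ?nnegrE ?addr_ge0//.
    by rewrite -[2]/(1 + 1) lerD2l.
  rewrite mulrC ler_wpM2l ?exprn_ge0//.
  by have := H1 q; rewrite expr0 mul1r /=; move: M20; lra.
apply: (@le_trans _ _ (`|sigma q| * (2 * `|q|) ^+ (N + (d + d)))).
  rewrite ler_wpM2l// lerXn2r ?nnegrE ?addr_ge0// ?mulr_ge0//.
  by rewrite mulr_natl mulr2n lerD2r ltW.
rewrite exprMn mulrCA ler_wpM2l ?exprn_ge0// mulrC.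
by have := H2 q; rewrite /=; move: M10; lra.
Qed.

End TupleMeasure.

(** * Taylor expansion along a segment *)

Section Taylor.
Context {R : realType} {d : nat}.
Local Notation E := 'rV[R]_d.

(** The [k]-th derivative at [0] of [e |-> F (p + e w)]; the recursion avoids multi-indices. *)
Fixpoint dir_deriv k (F : E -> R) (p w : E) : R :=
  if k is k'.+1 then \sum_j w 0 j * dir_deriv k' (rpartial j F) p w else F p.

Fixpoint taylor_poly N (F : E -> R) (p w : E) (e : R) : R :=
  if N is N'.+1 then taylor_poly N' F p w e + (N'`!%:R)^-1 * e ^+ N' * dir_deriv N' F p w else 0.

Lemma taylor_poly_derive N F p w (e : R) :
  is_derive e 1 (taylor_poly N.+1 F p w) (\sum_j w 0 j * taylor_poly N (rpartial j F) p w e).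
Proof.
elim: N => [|N IH].
  rewrite [X in is_derive _ _ _ X](_ : _ = 0) /=; last by rewrite big1// => j _; rewrite mulr0.
  rewrite (_ : (fun e => _) = cst (F p)); first exact: is_derive_cst.
  by apply/funext => x; rewrite /= expr0 fact0 invr1 add0r !mul1r.
rewrite [X in is_derive _ _ _ X](_ : _ = \sum_j w 0 j * taylor_poly N (rpartial j F) p w e +
   ((N.+1)`!%:R)^-1 * (N.+1%:R * e ^+ N) * dir_deriv N.+1 F p w).
  apply: (@is_deriveD _ _ _ (taylor_poly N.+1 F p w) (fun e => ((N.+1)`!%:R)^-1 * e ^+ N.+1 * dir_deriv N.+1 F p w)).
  have H : is_derive e 1 (fun e : R => e ^+ N.+1) (N.+1%:R * e ^+ N).
    apply: DeriveDef; first exact: exprn_derivable.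
    by rewrite exp_derive /= /GRing.scale /= mulr1.
  rewrite (_ : (fun e => _) = (((N.+1)`!%:R)^-1 * dir_deriv N.+1 F p w) *: (fun e : R => e ^+ N.+1)); last first.
    by apply/funext => x; rewrite /GRing.scale /= mulrAC.
  apply: is_derive_eq.
  by rewrite /GRing.scale /= mulrAC.
rewrite /= mulr_sumr -big_split /=; apply: eq_bigr => j _.
rewrite mulrDr; congr (_ + _).
rewrite factS natrM invfM; field.
by rewrite pnatr_eq0 -lt0n fact_gt0 /= nat1r pnatr_eq0.
Qed.

Lemma taylor_poly0 N F p w : taylor_poly N.+1 F p w 0 = F p.
Proof.
elim: N => [|N IH]; first by rewrite /= expr0 fact0 invr1 add0r !mul1r.
by rewrite -[LHS]/(taylor_poly N.+1 F p w 0 + _) IH expr0n /= mulr0 mul0r addr0.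
Qed.

(** The derivative in [e] of the error is a combination of the errors of order one less for
    the partial derivatives of [F]. *)
Lemma taylor_bound N (F : E -> R) (B : R) p w (e : R) : rsmooth setT F -> 0 <= B ->
  (forall s x, size s = N -> `|rpartials s F x| <= B) -> 0 <= e ->
  `|F (p + e *: w) - taylor_poly N F p w e| <= B * (d%:R * `|w| * e) ^+ N.
Proof.
elim: N F e => [|N IH] F e Fs B0 FB e0.
  by rewrite /= subr0 expr0 mulr1; exact: (FB [::]).
pose g (e : R) := F (p + e *: w) - taylor_poly N.+1 F p w e.
pose dg (e : R) := \sum_j w 0 j * (rpartial j F (p + e *: w) - taylor_poly N (rpartial j F) p w e).
have gd (x : R) : is_derive x 1 g (dg x).
  rewrite /dg; under eq_bigr do rewrite mulrBr; rewrite sumrB.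
  apply: is_deriveB; last exact: taylor_poly_derive.
  have F1 : Ck 1 setT F by exact: Fs.
  have := @derive_sum_basis _ _ setT F (p + x *: w) w openT F1 I.
  move=> <-; apply: line_is_derive.
  exact/diff_derivable/(C1_differentiable openT F1 I).
have [] := @MVT_segment R g dg 0 e e0.
- by apply: derivable_within_continuous => x _; case: (gd x).
move=> x; rewrite in_itv /= => /andP[x0 xe].
rewrite /g taylor_poly0 scale0r addr0 subrr !subr0 => ->.
have Y0 : 0 <= d%:R * `|w| by rewrite mulr_ge0.
rewrite normrM (ger0_norm e0) [leRHS](_ : _ = B * (d%:R * `|w| * e) ^+ N * (d%:R * `|w|) * e); last first.
  by rewrite exprSr !mulrA.
rewrite ler_wpM2r//.
rewrite [X in _ <= X](_ : _ = \sum_(j < d) `|w| * (B * (d%:R * `|w| * e) ^+ N)); last first.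
  rewrite sumr_const card_ord; move: (B * _ ^+ N) => Z.
  by rewrite [LHS]mulrC mulr_natl mulrnAl.
apply: (le_trans (ler_norm_sum _ _ _)); apply: ler_sum => j _.
rewrite normrM ler_pM//; first exact: coord_le_norm.
apply: (@le_trans _ _ (B * (d%:R * `|w| * x) ^+ N)).
  apply: IH => //; first exact: rsmooth_partial.
  move=> s y sN; rewrite -[rpartials s _]/(rpartials s (rpartials [:: j] F)) -rpartials_cat.
  by apply: FB; rewrite size_cat sN addn1.
by rewrite ler_wpM2l// lerXn2r ?nnegrE ?mulr_ge0// ler_wpM2l.
Qed.

End Taylor.

(** * Vanishing moments *)

Section Moments.
Context {R : realType} {d : nat}.
Local Notation E := 'rV[R]_d.
Variable sigma : E -> R.
Hypothesis sS : rschwartz sigma.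
Hypothesis smom : forall alpha : 'I_d -> nat, (exists i, alpha i <> 0%N) ->
  Rintegral_rV (fun q => (\prod_i q 0 i ^+ alpha i) * sigma q) = 0.

(** [g] is orthogonal to [sigma]; integrability is part of the notion to make it linear. *)
Definition null_moment (g : E -> R) :=
  integrable_rV (fun q => g q * sigma q) /\ Rintegral_rV (fun q => g q * sigma q) = 0.

Lemma null_moment_eq g h : g =1 h -> null_moment g -> null_moment h.
Proof. by move=> /funext ->. Qed.

Lemma null_momentD g h : null_moment g -> null_moment h -> null_moment (fun q => g q + h q).
Proof.
move=> [g1 g2] [h1 h2]; rewrite /null_moment; under eq_fun do rewrite mulrDl.
split; first exact: integrable_rVD.
by rewrite Rintegral_rVD// g2 h2 addr0.
Qed.

Lemma null_momentZ c g : null_moment g -> null_moment (fun q => c * g q).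
Proof.
move=> [g1 g2]; rewrite /null_moment; under eq_fun do rewrite -mulrA.
split; first exact: integrable_rVZ.
by rewrite Rintegral_rVZ// g2 mulr0.
Qed.

Lemma null_moment0 : null_moment (fun=> 0).
Proof.
rewrite /null_moment; under eq_fun do rewrite mul0r.
split; first exact: integrable0.
by rewrite /Rintegral_rV Rintegral_cst// mul0r.
Qed.

Lemma null_moment_sum (I : Type) (r : seq I) (g : I -> E -> R) :
  (forall i, null_moment (g i)) -> null_moment (fun q => \sum_(i <- r) g i q).
Proof.
move=> H; elim: r => [|i r IH].
  by apply: null_moment_eq null_moment0 => q; rewrite big_nil.
by apply: null_moment_eq (null_momentD (H i) IH) => q; rewrite big_cons.
Qed.

Lemma integrable_rV_schwartz (f : E -> R) M N : continuous f ->
  (forall q, `|f q| <= M * (1 + `|q|) ^+ N) -> integrable_rV (fun q => f q * sigma q).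
Proof.
move=> cf fM.
have [B B0 HB] := schwartz_dominated N sS.
have M0 : 0 <= M by have := le_trans (normr_ge0 _) (fM 0); rewrite normr0 addr0 expr1n mulr1.
apply: (@integrable_rV_dominated _ _ _ (M * B)).
  by move=> q; exact: (cvgM (cf q) (rsmooth_cont sS.1 I)).
move=> q; rewrite normrM -mulrA.
apply: (@le_trans _ _ (M * (1 + `|q|) ^+ N * `|sigma q|)); first by rewrite ler_wpM2r.
by rewrite -mulrA ler_wpM2l.
Qed.

Lemma null_moment_monomial (alpha : 'I_d -> nat) : (exists i, alpha i <> 0%N) ->
  null_moment (fun q => \prod_i q 0 i ^+ alpha i).
Proof.
move=> a0; split; last exact: smom.
apply: (@integrable_rV_schwartz _ 1 (\sum_i alpha i)).
  have H : rsmooth setT (fun q : E => \prod_i q 0 i ^+ alpha i).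
    apply: rsmooth_prod; first exact: openT.
    by move=> i; apply: rsmoothX; [exact: openT|exact: rsmooth_coord].
  by move=> q; exact: rsmooth_cont H I.
move=> q; rewrite mul1r normr_prod -prodrXr ler_prod// => i _.
rewrite normr_ge0 /= normrX lerXn2r ?nnegrE ?addr_ge0//.
by rewrite (le_trans (coord_le_norm _ _))// lerDr.
Qed.

(** Each step of the recursion multiplies the monomial by a coordinate, so that its
    exponent is nonzero in the end. *)
Lemma null_moment_dir_deriv k (F : E -> R) p (m : 'I_d -> 'I_d -> R) (alpha : 'I_d -> nat) :
  (k != 0%N \/ exists i, alpha i <> 0%N) ->
  null_moment (fun q => (\prod_i q 0 i ^+ alpha i) * dir_deriv k F p (\row_j \sum_i m j i * q 0 i)).
Proof.
elim: k F alpha => [|k IH] F alpha.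
  case=> // a0; apply: null_moment_eq (null_momentZ (F p) (null_moment_monomial a0)) => q.
  by rewrite mulrC.
move=> _; (* The exponent of [x_i x^alpha]. *)
pose beta i (j : 'I_d) := (alpha j + (j == i))%N.
have B i : exists j, beta i j <> 0%N by exists i; rewrite /beta eqxx addn1.
apply: (@null_moment_eq (fun q => \sum_j \sum_i m j i *
  ((\prod_l q 0 l ^+ beta i l) * dir_deriv k (rpartial j F) p (\row_j \sum_i m j i * q 0 i)))).
  move=> q; rewrite /= mulr_sumr; apply: eq_bigr => j _.
  rewrite [X in X * dir_deriv _ _ _ _]mxE mulr_suml mulr_sumr; apply: eq_bigr => i _.
  have -> : \prod_l q 0 l ^+ beta i l = q 0 i * \prod_l q 0 l ^+ alpha l.
    rewrite (bigD1 i)//= [in RHS](bigD1 i)//= /beta eqxx addn1 exprS -mulrA.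
    by congr (_ * (_ * _)); apply: eq_bigr => l /negbTE ->; rewrite addn0.
  by rewrite [in RHS]mulrCA -!mulrA; congr (_ * _); rewrite [RHS]mulrCA.
apply: null_moment_sum => j; apply: null_moment_sum => i; apply: null_momentZ.
by apply: IH; right.
Qed.

Lemma null_moment_taylor_poly N (F : E -> R) p (m : 'I_d -> 'I_d -> R) (e : R) :
  null_moment (fun q => taylor_poly N.+1 F p (\row_j \sum_i m j i * q 0 i) e - F p).
Proof.
elim: N => [|N IH].
  apply: null_moment_eq null_moment0 => q.
  by rewrite /= expr0 fact0 invr1 add0r !mul1r subrr.
have H := @null_moment_dir_deriv N.+1 F p m (fun=> 0%N) (or_introl isT).
apply: null_moment_eq (null_momentD IH (null_momentZ (((N.+1)`!%:R)^-1 * e ^+ N.+1) H)) => q.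
rewrite big1 => [|i _]; last by rewrite expr0.
rewrite mul1r -[taylor_poly N.+2 _ _ _ _]/(taylor_poly N.+1 F p _ e + (N.+1`!%:R)^-1 * e ^+ N.+1 * dir_deriv N.+1 F p _).
by rewrite addrAC.
Qed.

(** The terms of the Taylor polynomial of positive degree integrate to [0] against [sigma];
    the remainder is bounded by [taylor_bound], and its growth in [q] is absorbed by
    [schwartz_dominated]. *)
Lemma moment_expansion N : exists2 A : R, 0 <= A &
  forall (F : E -> R) (B C c : R) (p : E) (m : 'I_d -> 'I_d -> R) (e : R),
  rsmooth setT F -> 0 <= B -> 0 <= C ->
  (forall (s : seq 'I_d) (x : E), (size s <= N.+1)%N -> `|rpartials s F x| <= B) ->
  (forall q : E, `|\row_j \sum_i m j i * q 0 i : E| <= C * `|q|) ->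
  Rintegral_rV sigma = c -> 0 <= e ->
  `|Rintegral_rV (fun q => F (p + e *: \row_j \sum_i m j i * q 0 i) * sigma q) - c * F p|
    <= A * (B * (C * e) ^+ N.+1).
Proof.
have [M M0 HM] := schwartz_dominated N.+1 sS.
exists (d%:R ^+ N.+1 * M * pi ^+ d).
  by rewrite !mulr_ge0 ?exprn_ge0 ?pi_ge0.
move=> F B C c p m e Fs B0 C0 FB mC sc e0.
pose L (q : E) : E := \row_j \sum_i m j i * q 0 i.
have sI : integrable_rV sigma.
  have := @integrable_rV_schwartz (fun=> 1) 1 0.
  rewrite (_ : (fun q => 1 * sigma q) = sigma); last by apply/funext => q; rewrite mul1r.
  by apply; [move=> q; exact: rsmooth_cont (rsmooth_cst setT 1) I|move=> q; rewrite normr1 mulr1].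
have fI : integrable_rV (fun q => F (p + e *: L q) * sigma q).
  apply: (@integrable_rV_schwartz _ B 0) => [|q]; last first.
    by rewrite expr0 mulr1; exact: (FB [::]).
  have H : rsmooth setT (fun q => F (p + e *: L q)).
    apply: (rsmooth_comp openT openT _ Fs) => // j.
    under eq_fun do rewrite !mxE.
    apply: rsmoothD; [exact: openT|exact: rsmooth_cst|].
    apply: rsmoothZ; first exact: openT.
    apply: rsmooth_sum => [|i]; first exact: openT.
    by apply: rsmoothZ; [exact: openT|exact: rsmooth_coord].
  by move=> q; exact: rsmooth_cont H I.
have [tI t0] := null_moment_taylor_poly N F p m e.
(* The integrand is [sigma] times the Taylor remainder. *)
pose f q := F (p + e *: L q) * sigma q - ((taylor_poly N.+1 F p (L q) e - F p) * sigma q) - F p * sigma q.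
have -> : Rintegral_rV (fun q => F (p + e *: L q) * sigma q) - c * F p = Rintegral_rV f.
  rewrite /f (Rintegral_rVB (integrable_rVB fI tI) (integrable_rVZ _ sI)) (Rintegral_rVB fI tI).
  by rewrite t0 (Rintegral_rVZ _ sI) sc subr0 [X in _ - X]mulrC.
rewrite (_ : _ * _ * _ * _ = (d%:R ^+ N.+1 * M * (B * (C * e) ^+ N.+1)) * pi ^+ d); last by rewrite mulrAC.
apply: Rintegral_rV_bound; first by apply: integrable_rVB; [exact: integrable_rVB|exact: integrable_rVZ].
move=> q; rewrite /f -!mulrBl (_ : _ - _ - _ = F (p + e *: L q) - taylor_poly N.+1 F p (L q) e); last by ring.
rewrite normrM.
have T := @taylor_bound R d N.+1 F B p (L q) e Fs B0 (fun s x sN => FB s x (eq_leq sN)) e0.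
apply: (@le_trans _ _ (B * (d%:R * (C * (1 + `|q|)) * e) ^+ N.+1 * `|sigma q|)).
  rewrite ler_wpM2r// (le_trans T)// ler_wpM2l// lerXn2r ?nnegrE ?mulr_ge0 ?addr_ge0//.
  rewrite ler_wpM2r// ler_wpM2l// (le_trans (mC q))// ler_wpM2l//.
  by rewrite lerDr.
rewrite (_ : _ * _ = d%:R ^+ N.+1 * (B * (C * e) ^+ N.+1) * ((1 + `|q|) ^+ N.+1 * `|sigma q|)).
  rewrite (_ : _ * M * _ * _ = d%:R ^+ N.+1 * (B * (C * e) ^+ N.+1) * (M * decay_weight q)).
    by rewrite ler_wpM2l// !mulr_ge0 ?exprn_ge0 ?mulr_ge0.
  move: (_ ^+ _) (_ ^+ _) (decay_weight q) => a b x; ring.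
rewrite !exprMn; move: (_ ^+ _) (_ ^+ _) (_ ^+ _) (_ ^+ _) => a b x y; ring.
Qed.

End Moments.

(** * Mollification of smooth functions *)

Section Mollification.
Context {R : realType} {n : nat}.
Local Notation d := (n + n + 1)%N.
Local Notation H := 'rV[R]_d.

(** The partial derivatives of a function supported in [L] are supported in [L]. *)
Lemma bounded_partials m (F : 'rV[R]_m -> R) (L : set 'rV[R]_m) N : rsmooth setT F ->
  compact L -> (forall x, ~ L x -> F x = 0) ->
  exists2 B : R, 0 <= B & forall s x, (size s <= N)%N -> `|rpartials s F x| <= B.
Proof.
move=> Fs cL FL.
have cl : closed L by apply: compact_closed cL; exact: row_hausdorff.
elim: N F Fs FL => [|N IH] F Fs FL; have [B B0 HB] := compact_bound Fs cL (@subsetT _ L);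
    have HB' x : `|F x| <= B by have [/HB//|/FL->] := pselect (L x); rewrite normr0.
  by exists B => // -[].
have PL i x : ~ L x -> rpartial i F x = 0.
  move=> Lx; rewrite (@eq_on_rpartial _ _ (~` L) F (cst 0) i _ FL)//; last exact: closed_openC.
  by rewrite /rpartial derive_cst.
have /choice[C HC] : forall i, exists C : R, 0 <= C /\
    forall s x, (size s <= N)%N -> `|rpartials s (rpartial i F) x| <= C.
  by move=> i; have [C C0 HC] := IH _ (rsmooth_partial i Fs) (PL i); exists C.
have C0 i : 0 <= C i by case: (HC i).
exists (B + \sum_i C i); first by rewrite addr_ge0// sumr_ge0.
move=> s x; case/lastP: s => [_|s i].
  by rewrite (le_trans (HB' x))// lerDl sumr_ge0.
rewrite size_rcons ltnS -cats1 rpartials_cat => sN.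
rewrite (le_trans ((HC i).2 s x sN))// (bigD1 i)//= addrCA lerDl.
by rewrite addr_ge0// sumr_ge0.
Qed.

(** The linear map [q |-> L q] with [(e q)^-1 p = p + e L q]. *)
Definition trans_mx (p : H) (j i : 'I_d) : R :=
  - (j == i)%:R + (j == t_idx)%:R * (2^-1 * (hpoint (- hxi p) (hx p) 0) 0 i).

Lemma trans_mxE (p q : H) (j : 'I_d) : \sum_i trans_mx p j i * q 0 i =
  - q 0 j + (j == t_idx)%:R * (2^-1 * \sum_i (p 0 (x_idx i) * q 0 (xi_idx i) - q 0 (x_idx i) * p 0 (xi_idx i))).
Proof.
rewrite /trans_mx; under eq_bigr do rewrite mulrDl; rewrite big_split /=; congr (_ + _).
  rewrite (bigD1 j)//= eqxx mulN1r big1 ?addr0// => i; rewrite eq_sym => /negbTE ->.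
  by rewrite oppr0 mul0r.
under eq_bigr do rewrite -!mulrA; rewrite -!mulr_sumr; congr (_ * (_ * _)).
rewrite big_split_ord /= big_ord1 big_split_ord /= /hpoint.
under eq_bigr do rewrite row_mxEl row_mxEl.
under [X in _ + X + _]eq_bigr do rewrite row_mxEl row_mxEr.
rewrite row_mxEr mxE /= mul0r addr0 -big_split /=; apply: eq_bigr => i _.
by rewrite !mxE /x_idx /xi_idx mulNr addrC [X in _ - X]mulrC.
Qed.

Lemma hinvE (p : H) j : hinv p 0 j = - p 0 j.
Proof. by rewrite /hinv mxE. Qed.

Lemma hinv_scale_mul (e : R) (p q : H) :
  hmul (hinv (e *: q)) p = p + e *: \row_j \sum_i trans_mx p j i * q 0 i.
Proof.
apply/rowP => j; rewrite hmulE hinvE !mxE trans_mxE.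
rewrite mulrDr mulrN [X in X + _ = _]addrC -addrA; congr (_ + (_ + _)).
rewrite [in RHS]mulrCA; congr (_ * _); rewrite [in RHS]mulrCA; congr (_ * _); rewrite mulr_sumr.
by apply: eq_bigr => i _; rewrite !hinvE !mxE; ring.
Qed.

Lemma hmul_quotK (p r : H) : hmul (hinv (hmul p (hinv r))) p = r.
Proof.
have xt (i : 'I_n) : (x_idx i == t_idx) = false by rewrite /x_idx /t_idx eq_lrshift.
have yt (i : 'I_n) : (xi_idx i == t_idx) = false by rewrite /xi_idx /t_idx eq_lrshift.
apply/rowP => j; rewrite hmulE hinvE hmulE hinvE.
rewrite (_ : \sum_i (hinv _ 0 _ * _ - _) = \sum_i (p 0 (x_idx i) * (hinv r) 0 (xi_idx i) - (hinv r) 0 (x_idx i) * p 0 (xi_idx i))).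
  by ring.
apply: eq_bigr => i _.
by rewrite !hinvE !hmulE !hinvE xt yt !mul0r !addr0; ring.
Qed.

Lemma trans_mx_bound K : compact K -> exists2 C : R, 0 <= C &
  forall p (q : H), K p -> `|\row_j \sum_i trans_mx p j i * q 0 i : H| <= C * `|q|.
Proof.
move=> /compact_bounded[M [_ HM]]; pose P := `|M + 1|.
have HP (p : H) : K p -> `|p| <= P.
  by move=> Kp; apply: (@le_trans _ _ (M + 1)); [apply: HM => //; rewrite ltrDl|exact: ler_norm].
have P0 : 0 <= P by exact: normr_ge0.
exists (1 + n%:R * (P * 2)); first by rewrite addr_ge0// !mulr_ge0.
move=> p q Kp; apply: row_norm_le => [|j]; first by rewrite mulr_ge0// addr_ge0// !mulr_ge0.
rewrite mxE trans_mxE mulrDl mul1r (le_trans (ler_normD _ _))// lerD//.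
  by rewrite normrN coord_le_norm.
rewrite normrM (@le_trans _ _ (1 * `|2^-1 * \sum_i (p 0 (x_idx i) * q 0 (xi_idx i) - q 0 (x_idx i) * p 0 (xi_idx i))|))//.
  by rewrite ler_wpM2r//; case: (j == t_idx); rewrite ?normr1 ?normr0.
rewrite mul1r normrM ger0_norm// (@le_trans _ _ (1 * (n%:R * (P * 2) * `|q|)))//; last by rewrite mul1r.
rewrite ler_pM//; first by rewrite invf_le1// ler1n.
apply: (le_trans (ler_norm_sum _ _ _)).
rewrite [leRHS](_ : _ = \sum_(i < n) (P * `|q| + `|q| * P)); last first.
  by rewrite sumr_const card_ord -mulr_natl; ring.
apply: ler_sum => i _; rewrite (le_trans (ler_normB _ _))// lerD// normrM ler_pM// ?coord_le_norm//.
  by rewrite (le_trans (coord_le_norm _ _))// HP.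
by rewrite (le_trans (coord_le_norm _ _))// HP.
Qed.

Lemma quot_tri_affine (p : H) (e : R) :
  exists b c k, forall t : d.-tuple R,
   to_row (tri_affine (- e^-1) b c k t) = e^-1 *: hmul p (hinv (to_row t)).
Proof.
(* Coordinates indexed by all naturals, as [tri_affine] wants them. *)
pose ext (v : H) (i : nat) : R := if insub i is Some j then v 0 j else 0.
have extE v (j : 'I_d) : ext v j = v 0 j by rewrite /ext (valK j).
exists (ext (e^-1 *: p)), (ext (e^-1 *: (2^-1 *: hpoint (hxi p) (- hx p) 0))), 0 => t.
apply/rowP => j; rewrite mxE tri_affine_tnth extE [RHS]mxE hmulE hinvE [to_row t 0 j]mxE.
have -> : (j.+1 == d) = (j == t_idx).
  have h2 := addn1 (n + n).
  apply/eqP/eqP => [h|->]; last by rewrite /= addn0 h2.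
  by apply/val_inj; rewrite /= addn0; case: (etrans h h2).
rewrite add0r mulrDr mulrDr mulrN [e^-1 * p 0 j + _]addrC mxE mulNr; congr (_ + _).
rewrite mulrCA; congr (_ * _).
rewrite big_mkcond /= big_split_ord /= big_ord1 /= addn0.
rewrite ifF; last by rewrite addn1 ltnn.
rewrite addr0 big_split_ord /= -big_split /= !mulr_sumr; apply: eq_bigr => i _.
have -> : ((i.+1 < d)%N) by rewrite addn1 ltnS ltn_addr.
have -> : (((n + i).+1 < d)%N) by rewrite addn1 ltnS ltn_add2l.
have -> : ext (e^-1 *: (2^-1 *: hpoint (hxi p) (- hx p) 0)) i = e^-1 * (2^-1 * p 0 (xi_idx i)).
  by rewrite (extE _ (x_idx i)) 2!mxE /hpoint row_mxEl row_mxEl !mxE.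
have -> : ext (e^-1 *: (2^-1 *: hpoint (hxi p) (- hx p) 0)) (n + i)%N = e^-1 * (2^-1 * - p 0 (x_idx i)).
  by rewrite (extE _ (xi_idx i)) 2!mxE /hpoint row_mxEl row_mxEr !mxE.
by rewrite !hinvE !mxE /x_idx /xi_idx; ring.
Qed.

(** The change of variables [q = e^-1 (p r^-1)], that is [r = (e q)^-1 p]. *)
Lemma mollifier_integral (sigma F : H -> R) (p : H) (e B : R) : 0 < e ->
  rschwartz sigma -> rsmooth setT F -> (forall x, `|F x| <= B) ->
  Rintegral_rV (fun r => F r * (e^-1 ^+ d * sigma (e^-1 *: hmul p (hinv r)))) =
  Rintegral_rV (fun q => F (p + e *: \row_j \sum_i trans_mx p j i * q 0 i) * sigma q).
Proof.
move=> e0 sS Fs FB; have [b [c [k E]]] := quot_tri_affine p e.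
pose G (q : H) := F (p + e *: \row_j \sum_i trans_mx p j i * q 0 i) * sigma q.
have Hs : rsmooth setT (fun q => F (p + e *: \row_j \sum_i trans_mx p j i * q 0 i)).
  apply: (rsmooth_comp openT openT _ Fs) => // j.
  under eq_fun do rewrite !mxE.
  apply: rsmoothD; [exact: openT|exact: rsmooth_cst|].
  apply: rsmoothZ; first exact: openT.
  apply: rsmooth_sum => [|i]; first exact: openT.
  by apply: rsmoothZ; [exact: openT|exact: rsmooth_coord].
have GI : integrable_rV G.
  apply: (@integrable_rV_schwartz _ _ _ sS _ B 0) => [|q]; last by rewrite expr0 mulr1.
  by move=> q; exact: rsmooth_cont Hs I.
have Gc : continuous (fun q => e^-1 ^+ d * G q).
  have H : rsmooth setT (fun q => e^-1 ^+ d * G q).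
    apply: rsmoothZ; first exact: openT.
    by apply: rsmoothM => //; [exact: openT|exact: sS.1].
  by move=> q; exact: rsmooth_cont H I.
have a0 : - e^-1 != 0 by rewrite oppr_eq0 invr_eq0 gt_eqF.
have := Rintegral_tri_affine b c k a0 (continuous_measurable_tuple Gc).
rewrite normrN normfV (gtr0_norm e0) invrK.
have -> : \int[lebesgue_tuple d]_t (e^-1 ^+ d * G (to_row t)) = e^-1 ^+ d * Rintegral_rV G.
  exact: (Rintegral_rVZ _ GI).
rewrite mulrA -exprMn mulfV ?gt_eqF// expr1n mul1r -/G => <-.
apply: eq_Rintegral => t _.
rewrite E /G -hinv_scale_mul scalerA divff ?gt_eqF// scale1r hmul_quotK.
by rewrite mulrCA.
Qed.

(** The error of order [N + 1] of [moment_expansion], after the change of variables. *)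
Lemma mollifier_approx (sigma F : H -> R) (c : R) (L K : set H) N : rschwartz sigma ->
  (forall alpha : 'I_d -> nat, (exists i, alpha i <> 0%N) ->
    Rintegral_rV (fun q => (\prod_i q 0 i ^+ alpha i) * sigma q) = 0) ->
  Rintegral_rV sigma = c -> rsmooth setT F -> compact L -> (forall x, ~ L x -> F x = 0) ->
  compact K -> exists2 C : R, 0 <= C & forall (p : H) (e : R), K p -> 0 < e < 1 ->
  `|Rintegral_rV (fun r => F r * (e^-1 ^+ d * sigma (e^-1 *: hmul p (hinv r)))) - c * F p|
    <= C * e ^+ N.
Proof.
move=> sS smom sc Fs cL FL cK.
have [A A0 HA] := moment_expansion sS smom N.
have [C C0 HC] := trans_mx_bound cK.
have [B B0 HB] := bounded_partials N.+1 Fs cL FL.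
exists (A * (B * C ^+ N.+1)); first by rewrite !mulr_ge0// exprn_ge0.
move=> p e Kp /andP[e0 e1]; rewrite (@mollifier_integral _ _ _ _ B)//; last first.
  by move=> x; exact: (HB [::] x).
apply: (le_trans (HA F B C c p _ e Fs B0 C0 HB (fun q => HC p q Kp) sc (ltW e0))).
rewrite exprMn -!mulrA !ler_wpM2l// ?exprn_ge0// exprS ler_piMl ?exprn_ge0 ?ltW//.
Qed.

End Mollification.

(** * Classes of nets *)

Section NetClasses.
Context {R : realType} {d : nat}.
Local Notation E := 'rV[R]_d.
Local Notation C := R[i].
Local Notation net := (@net R d).
Implicit Types (U : set E) (f g h : net).

Lemma reD (x y : C) : complex.Re (x + y) = complex.Re x + complex.Re y.
Proof. by case: x y => [? ?] []. Qed.
Lemma imD (x y : C) : complex.Im (x + y) = complex.Im x + complex.Im y.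
Proof. by case: x y => [? ?] []. Qed.
Lemma reNN (x : C) : complex.Re (- x) = - complex.Re x.
Proof. by case: x. Qed.
Lemma imNN (x : C) : complex.Im (- x) = - complex.Im x.
Proof. by case: x. Qed.
Lemma reM (x y : C) : complex.Re (x * y) = complex.Re x * complex.Re y - complex.Im x * complex.Im y.
Proof. by case: x y => [? ?] []. Qed.
Lemma imM (x y : C) : complex.Im (x * y) = complex.Re x * complex.Im y + complex.Im x * complex.Re y.
Proof. by case: x y => [? ?] []. Qed.

Lemma complex_parts (x y : C) : complex.Re x = complex.Re y -> complex.Im x = complex.Im y -> x = y.
Proof. by case: x y => [? ?] [? ?] /= -> ->. Qed.

(** [cbound true] is negligibility and [cbound false] moderateness. *)
Definition cbound b U f := bounded_net b U (reN f) /\ bounded_net b U (imN f).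

Lemma cbound_eq b U f (u v : R -> E -> R) : bounded_net b U u -> bounded_net b U v ->
  (forall e x, complex.Re (f e x) = u e x) -> (forall e x, complex.Im (f e x) = v e x) ->
  cbound b U f.
Proof.
move=> ub vb fu fv; split.
- by rewrite (_ : reN f = u)//; apply/funext => e; apply/funext => x; exact: fu.
- by rewrite (_ : imN f = v)//; apply/funext => e; apply/funext => x; exact: fv.
Qed.

Lemma cboundD b U f g : open U -> cbound b U f -> cbound b U g ->
  cbound b U (fun e x => f e x + g e x).
Proof.
move=> oU [f1 f2] [g1 g2].
apply: (cbound_eq (bounded_netD oU f1 g1) (bounded_netD oU f2 g2)) => e x; [exact: reD|exact: imD].
Qed.

Lemma cboundM b U f g : open U -> cbound b U f -> cbound false U g ->
  cbound b U (fun e x => f e x * g e x).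
Proof.
move=> oU [f1 f2] [g1 g2].
apply: (cbound_eq (bounded_netB oU (bounded_netM oU f1 g1) (bounded_netM oU f2 g2))
  (bounded_netD oU (bounded_netM oU f1 g2) (bounded_netM oU f2 g1))) => e x; [exact: reM|exact: imM].
Qed.

Lemma cboundZ b U (a : C) f : open U -> cbound b U f -> cbound b U (fun e x => a * f e x).
Proof.
move=> oU [f1 f2].
apply: (cbound_eq (bounded_netB oU (bounded_netZ (complex.Re a) oU f1) (bounded_netZ (complex.Im a) oU f2))
  (bounded_netD oU (bounded_netZ (complex.Re a) oU f2) (bounded_netZ (complex.Im a) oU f1))) => e x; [exact: reM|exact: imM].
Qed.

Lemma cboundN b U f : open U -> cbound b U f -> cbound b U (fun e x => - f e x).
Proof.
move=> oU [f1 f2].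
by apply: (cbound_eq (bounded_netN oU f1) (bounded_netN oU f2)) => e x; [exact: reNN|exact: imNN].
Qed.

Lemma cboundB b U f g : open U -> cbound b U f -> cbound b U g ->
  cbound b U (fun e x => f e x - g e x).
Proof. by move=> oU fb gb; apply: cboundD => //; exact: cboundN. Qed.

Lemma cbound_sub b U V f : V `<=` U -> cbound b U f -> cbound b V f.
Proof. by move=> VU [? ?]; split; apply: bounded_net_sub VU _. Qed.

Lemma cbound_zero b U : open U -> cbound b U (fun _ _ => 0).
Proof. by move=> oU; apply: (cbound_eq (bounded_net_zero b oU) (bounded_net_zero b oU)). Qed.

Lemma cbound_cst U (f : E -> C) : open U -> smooth U f -> cbound false U (fun=> f).
Proof. by move=> oU /smoothP[f1 f2]; split; exact: bounded_net_cst. Qed.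

Lemma gs_classP U f g : open U -> gs_class U f g <->
  cbound false U g /\ cbound true U (fun e x => f e x - g e x).
Proof.
move=> oU; split=> [[/(moderateP _ oU) m /(negligibleP _ oU)//]|[m n]].
by split; [apply/(moderateP _ oU)|apply/(negligibleP _ oU)].
Qed.

Lemma moderate_cbound U f : open U -> moderate U f <-> cbound false U f.
Proof. exact: moderateP. Qed.

Lemma net_eq (f g : net) : (forall e x, f e x = g e x) -> f = g.
Proof. by move=> fg; apply/funext => e; apply/funext => x. Qed.

Lemma cbound_net_eq b U f g : (forall e x, f e x = g e x) -> cbound b U f -> cbound b U g.
Proof. by move=> /net_eq ->. Qed.

Lemma gs_class_refl U f : open U -> cbound false U f -> gs_class U f f.
Proof.
move=> oU fm; apply/gs_classP => //; split => //.
by apply: cbound_net_eq (cbound_zero true oU) => e x; rewrite subrr.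
Qed.

Lemma gs_class_trans U f g h : open U -> cbound true U (fun e x => f e x - g e x) ->
  gs_class U g h -> gs_class U f h.
Proof.
move=> oU fg /(gs_classP _ _ oU)[hm gh]; apply/gs_classP => //; split => //.
by apply: cbound_net_eq (cboundD oU fg gh) => e x; rewrite addrA subrK.
Qed.

Lemma gs_class_eq U f g : open U -> cbound true U (fun e x => f e x - g e x) ->
  gs_class U f = gs_class U g.
Proof.
move=> oU fg; apply/seteqP; split => h; apply: gs_class_trans => //.
by apply: cbound_net_eq (cboundN oU fg) => e x; rewrite opprB.
Qed.

Lemma gs_bigcup1 (I : Type) (A : set I) (i0 : I) (F : I -> set net) (B : set net) :
  A i0 -> (forall i, A i -> F i = B) -> \bigcup_(i in A) F i = B.
Proof.
move=> Ai H; apply/seteqP; split => [x [i Ai' Fx]|x Bx].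
  by rewrite -(H i Ai').
by exists i0 => //; rewrite H.
Qed.

Lemma gs_scaleE U (a : C) f : open U -> cbound false U f ->
  gs_scale U a (gs_class U f) = gs_class U (fun e x => a * f e x).
Proof.
move=> oU fm; apply: (gs_bigcup1 (gs_class_refl oU fm)) => g /(gs_classP _ _ oU)[_ fg].
apply/esym/gs_class_eq => //; apply: cbound_net_eq (cboundZ a oU fg) => e x.
by rewrite mulrBr.
Qed.

Lemma gs_addE U f g : open U -> cbound false U f -> cbound false U g ->
  gs_add U (gs_class U f) (gs_class U g) = gs_class U (fun e x => f e x + g e x).
Proof.
move=> oU fm gm; apply: (gs_bigcup1 (gs_class_refl oU fm)) => f' /(gs_classP _ _ oU)[_ ff].
apply: (gs_bigcup1 (gs_class_refl oU gm)) => g' /(gs_classP _ _ oU)[_ gg].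
apply/esym/gs_class_eq => //; apply: cbound_net_eq (cboundD oU ff gg) => e x.
by rewrite opprD addrACA.
Qed.

Lemma gs_mulE U f g : open U -> cbound false U f -> cbound false U g ->
  gs_mul U (gs_class U f) (gs_class U g) = gs_class U (fun e x => f e x * g e x).
Proof.
move=> oU fm gm; apply: (gs_bigcup1 (gs_class_refl oU fm)) => f' /(gs_classP _ _ oU)[fm' ff].
apply: (gs_bigcup1 (gs_class_refl oU gm)) => g' /(gs_classP _ _ oU)[_ gg].
apply/esym/gs_class_eq => //.
(* [f g - f' g' = (f - f') g + (g - g') f'] *)
apply: cbound_net_eq (cboundD oU (cboundM oU ff gm) (cboundM oU gg fm')) => e x.
by rewrite mulrBl mulrBl [g' e x * _]mulrC addrA [g e x * f' e x]mulrC subrK.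
Qed.

Lemma gs_resE U V f : open U -> open V -> V `<=` U -> cbound false U f ->
  gs_res V (gs_class U f) = gs_class V f.
Proof.
move=> oU oV VU fm; apply: (gs_bigcup1 (gs_class_refl oU fm)) => g /(gs_classP _ _ oU)[_ fg].
by apply/esym/gs_class_eq => //; exact: cbound_sub VU fg.
Qed.

Lemma cbound_landau U f : open U -> cbound false U f ->
  (forall K, compact K -> K `<=` U -> unif_bound true K (reN f) /\ unif_bound true K (imN f)) -> cbound true U f.
Proof.
by move=> oU [f1 f2] H; split; apply: landau => // K cK KU; have [] := H K cK KU.
Qed.

Lemma cbound_unif_bound b U f K : compact K -> K `<=` U -> cbound b U f ->
  unif_bound b K (reN f) /\ unif_bound b K (imN f).
Proof. by move=> cK KU [[_ f1] [_ f2]]; split; [exact: (f1 K cK KU [::])|exact: (f2 K cK KU [::])]. Qed.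

End NetClasses.

(** * Test functions through real and imaginary parts *)

Section TestFunctions.
Context {R : realType} {d : nat}.
Local Notation E := 'rV[R]_d.
Local Notation C := R[i].
Implicit Types (U K : set E).

Definition cplx (f g : E -> R) : E -> C := fun x => f x +i* g x.

Lemma cplx_test U K f g : compact K -> K `<=` U -> rtest K f -> rtest K g ->
  test_fun U (cplx f g) /\ supp (cplx f g) `<=` K.
Proof.
move=> cK KU [fs f0] [gs g0].
have cl : closed K by apply: compact_closed cK; exact: row_hausdorff.
have sK : supp (cplx f g) `<=` K.
  rewrite /supp closureE; apply: bigcap_inf; split => // x /=.
  by apply: contra_neqP => Kx; rewrite /cplx (f0 x)// (g0 x).
split => //; split; first by apply/smoothP.
  by apply: (subclosed_compact _ cK sK); exact: closed_closure.
exact: subset_trans KU.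
Qed.

Lemma rtest0 K : rtest K (fun=> 0).
Proof. by split => //; exact: rsmooth_cst. Qed.

Lemma rtestS K K' (f : E -> R) : K `<=` K' -> rtest K f -> rtest K' f.
Proof. by move=> KK [fs f0]; split => // x Kx; apply: f0 => /KK. Qed.

Lemma rtestB K (f g : E -> R) : rtest K f -> rtest K g -> rtest K (fun x => f x - g x).
Proof.
move=> [fs f0] [gs g0]; split; first exact: rsmoothB openT fs gs.
by move=> x Kx; rewrite f0// g0// subr0.
Qed.

Lemma test_rtest U f : test_fun U f -> rtest (supp f) (reF f) /\ rtest (supp f) (imF f).
Proof.
move=> [/smoothP[f1 f2] _ _]; have H x : ~ supp f x -> f x = 0.
  by move=> nx; apply/eqP; apply: contrapT => /negP fx; apply: nx; apply: subset_closure.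
by split; split => // x /H; rewrite /reF /imF => ->.
Qed.

Section Functional.
Variables (U K : set E) (u : (E -> C) -> C).
Hypotheses (uD : Defs.distribution U u) (cK : compact K) (KU : K `<=` U).

(** By complex linearity [u (f + i g) = u f + i u g]. *)
Lemma distribution_parts f g : rtest K f -> rtest K g ->
  u (cplx f g) = u (cplx f (fun=> 0)) + (0 +i* 1) * u (cplx g (fun=> 0)).
Proof.
move=> fK gK; have [uL _ _] := uD.
have T h : rtest K h -> test_fun U (cplx h (fun=> 0)).
  by move=> hK; have [] := cplx_test cK KU hK (rtest0 K).
rewrite addrC -(uL _ _ _ (T _ gK) (T _ fK)); congr (u _); apply/funext => x.
by apply: complex_parts; rewrite /= ?reD ?imD ?reM ?imM /=; ring.
Qed.

(** This reduces statements on distributions to real functionals of finite order. *)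
Lemma distribution_functional : rfunctional K (fun f => complex.Re (u (cplx f (fun=> 0)))) /\
  rfunctional K (fun f => complex.Im (u (cplx f (fun=> 0)))).
Proof.
have [uL uC _] := uD.
have T h : rtest K h -> test_fun U (cplx h (fun=> 0)) /\ supp (cplx h (fun=> 0)) `<=` K.
  by move=> hK; exact: cplx_test (rtest0 K).
have L (a : R) f g : rtest K f -> rtest K g ->
    u (cplx (fun x => a * f x + g x) (fun=> 0)) = a%:C * u (cplx f (fun=> 0)) + u (cplx g (fun=> 0)).
  move=> fK gK; rewrite -(uL _ _ _ (T _ fK).1 (T _ gK).1); congr (u _); apply/funext => x.
  by apply: complex_parts; rewrite /= ?reD ?imD ?reM ?imM /=; ring.
have [k [M HM]] := uC K cK KU.
have Bd f (B : R) : rtest K f -> 0 <= B ->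
    (forall s x, (size s <= k)%N -> K x -> `|rpartials s f x| <= B) ->
    cmod (u (cplx f (fun=> 0))) <= `|M| * B.
  move=> fK B0 fB; have [fT fS] := T f fK.
  have S0 : 0 <= Ck_seminorm K k (cplx f (fun=> 0)).
    by have [fs _ _] := fT; exact: (Ck_ge0 k fs cK (@subsetT _ K)).
  apply: (le_trans (HM _ fT fS)).
  apply: (@le_trans _ _ (`|M| * Ck_seminorm K k (cplx f (fun=> 0)))).
    by rewrite ler_wpM2r// ler_norm.
  rewrite ler_wpM2l//; apply: Ck_le => // s x sk Kx.
  rewrite cpartialsE (le_trans (cmod_le _))//=.
  have -> : rpartials s (imF (cplx f (fun=> 0))) = fun=> 0.
    rewrite (_ : imF _ = fun=> 0)//; elim: s {sk} => //= i s ->.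
    by apply/funext => y; rewrite /rpartial derive_cst.
  by rewrite normr0 addr0; exact: fB.
split; split.
- move=> a f g fK gK; rewrite L// reD reM /=; ring.
- exists k, `|M|; split => // f B fK B0 fB.
  by apply: le_trans (Bd f B fK B0 fB); exact: Re_le_cmod.
- move=> a f g fK gK; rewrite L// imD imM /=; ring.
- exists k, `|M|; split => // f B fK B0 fB.
  by apply: le_trans (Bd f B fK B0 fB); exact: Im_le_cmod.
Qed.

End Functional.

End TestFunctions.

(** * Regularizations of a distribution *)

Section Regularization.
Context {R : realType} {n : nat}.
Local Notation d := (n + n + 1)%N.
Local Notation H := 'rV[R]_d.
Local Notation C := R[i].
Local Notation net := (@net R d).
Implicit Types (U K L : set H).

Lemma compact_norm_bound m (K : set 'rV[R]_m) : compact K ->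
  exists2 B : R, 0 <= B & forall x, K x -> `|x| <= B.
Proof.
move=> /compact_bounded[M [_ HM]]; exists `|M + 1| => // x Kx.
by apply: (@le_trans _ _ (M + 1)); [apply: HM => //; rewrite ltrDl|exact: ler_norm].
Qed.

Lemma compact_separation m (K L : set 'rV[R]_m) : compact K -> compact L ->
  (forall x, K x -> ~ L x) ->
  exists2 delta : R, 0 < delta & forall p r, K p -> L r -> delta <= `|r - p|.
Proof.
move=> cK cL KL.
have oL : open (~` L) by apply: closed_openC; apply: compact_closed cL; exact: row_hausdorff.
have : \forall e \near (0 : R)^'+, K `<=` (fun x => forall r, L r -> e <= `|r - x|).
  apply: ((compact_near_coveringP _).1 cK _ ((0 : R)^'+) (fun (e : R) x => forall r, L r -> e <= `|r - x|)) => x Kx.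
  have /nbhs_ballP[s /= s0 Hs] := near_openP oL (KL _ Kx).
  have s2 : 0 < s / 2 by rewrite divr_gt0.
  exists (ball x (s / 2), [set e : R | e < s / 2]) => /=.
    split; first exact: nbhsx_ballx.
    by near=> e; rewrite /=; near: e; apply: nbhs_right_lt.
  move=> [x' e] /=; rewrite -!ball_normE /ball_ /= => -[xx es] r Lr.
  rewrite leNgt; apply/negP => re; apply: (Hs r) => //; rewrite -ball_normE /ball_ /=.
  rewrite (_ : x - r = (x - x') - (r - x')); last by rewrite opprB addrA subrK.
  by rewrite (le_lt_trans (ler_normB _ _))// [s]splitr ltrD// (lt_trans re).
move=> H0; have [e [He e0]] : exists e : R, (K `<=` (fun x => forall r, L r -> e <= `|r - x|)) /\ 0 < e.
  near (0 : R)^'+ => e; exists e; split; first by near: e.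
  by near: e; exact: nbhs_right_gt.
by exists e => // p r Kp; exact: He.
Unshelve. all: by end_near. Qed.

(** [r - p] is the image of [p r^-1] under the linear map of [trans_mx], which is bounded
    for [p] in [K]. *)
Lemma quot_separation K L : compact K -> compact L -> (forall x, K x -> ~ L x) ->
  exists2 delta : R, 0 < delta & forall p r : H, K p -> L r -> delta <= `|hmul p (hinv r)|.
Proof.
move=> cK cL KL; have [delta d0 Hd] := compact_separation cK cL KL.
have [B B0 HB] := @trans_mx_bound R n K cK.
have B1 : 0 < B + 1 by rewrite ltr_wpDl.
exists (delta / (B + 1)) => [|p r Kp Lr]; first by rewrite divr_gt0.
rewrite ler_pdivrMr// mulrC; apply: (le_trans (Hd p r Kp Lr)).
have E : r - p = \row_j \sum_i trans_mx p j i * hmul p (hinv r) 0 i.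
  have := hinv_scale_mul 1 p (hmul p (hinv r)); rewrite !scale1r hmul_quotK => {1}->.
  by rewrite addrAC subrr add0r.
rewrite E; apply: (le_trans (HB p _ Kp)).
by rewrite ler_wpM2r// lerDl.
Qed.

Definition joint_point (e : R) (p : H) : 'rV[R]_(1 + d) := row_mx (epoint e) p.

Lemma joint_point_e e p r : row_mx (joint_point e p) r 0 e_idx = e.
Proof. by rewrite /e_idx row_mxEl /joint_point row_mxEl mxE. Qed.

Lemma kernel_point (sigma : H -> R) e p r :
  kernel sigma (row_mx (joint_point e p) r) = e^-1 ^+ d * sigma (e^-1 *: hmul p (hinv r)).
Proof. by rewrite /kernel joint_point_e /quot row_mxKl /joint_point !row_mxKr. Qed.

Variable rho : H -> C.
Hypothesis rhoS : schwartz rho.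

Lemma schwartz_parts : rschwartz (reF rho) /\ rschwartz (imF rho).
Proof.
have [/smoothP[r1 r2] rB] := rhoS.
split; split => // alpha s; have [M HM] := rB alpha s; exists M => x; apply: le_trans (HM x);
  rewrite cpartialsE /monomial.
  by apply: le_trans (Re_le_cmod _); rewrite reM /= mul0r subr0.
by apply: le_trans (Im_le_cmod _); rewrite imM /= mul0r addr0.
Qed.

(** The convolution of the mollifier with [chi u]. *)
Definition regularized (u : (H -> C) -> C) (chi : H -> R) : net :=
  fun e p => u (fun r => (chi r)%:C * mollifier rho e (hmul p (hinv r))).

Definition cut (chi : H -> R) (sigma : H -> R) z : H -> R :=
  fun r => cut_kernel chi sigma (row_mx z r).

Lemma reg_integrand chi e p :
  (fun r => (chi r)%:C * mollifier rho e (hmul p (hinv r))) =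
  cplx (cut chi (reF rho) (joint_point e p)) (cut chi (imF rho) (joint_point e p)).
Proof.
apply/funext => r; rewrite /cplx /cut /cut_kernel !kernel_point row_mxKr exprVn.
by apply: complex_parts; rewrite /mollifier !(reM, imM) /=; rewrite /reF /imF; ring.
Qed.

Section OneCutoff.
Variables (U L : set H) (u : (H -> C) -> C) (chi : H -> R).
Hypotheses (uD : Defs.distribution U u) (cL : compact L) (LU : L `<=` U) (chiL : rtest L chi).

Local Notation ep := (fun z : 'rV[R]_(1 + d) => z 0 (lshift d ord0)).
Let Om : set 'rV[R]_(1 + d) := joint_dom setT.
Let oOm : open Om. Proof. exact: open_joint_dom openT. Qed.

Lemma cut_joint sigma : rsmooth setT sigma -> joint_test Om L (cut_kernel chi sigma).
Proof.
move=> ss; split.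
  apply: rsmoothS (cut_kernel_smooth chiL.1 ss) => w /= -[/andP[+ _] _].
  by rewrite mxE.
by move=> z r _ Lr; rewrite /cut_kernel row_mxKr chiL.2// mul0r.
Qed.

Let lam1 (f : H -> R) := complex.Re (u (cplx f (fun=> 0))).
Let lam2 (f : H -> R) := complex.Im (u (cplx f (fun=> 0))).

(** The real and imaginary parts of the regularization as functions of the point [(e, p)], to
    which the results on jointly smooth families apply. *)
Definition regRe z := lam1 (cut chi (reF rho) z) + lam2 (cut chi (imF rho) z) * (-1).
Definition regIm z := lam1 (cut chi (imF rho) z) + lam2 (cut chi (reF rho) z).

Let S1 := schwartz_parts.1.
Let S2 := schwartz_parts.2.

Lemma cut_rtest sigma e p : rsmooth setT sigma -> 0 < e < 1 -> rtest L (cut chi sigma (joint_point e p)).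
Proof.
move=> ss e01; apply: (joint_test_slice oOm (cut_joint ss)).
exact: joint_dom_mem.
Qed.

Lemma reg_parts e p : 0 < e < 1 ->
  complex.Re (regularized u chi e p) = regRe (joint_point e p) /\ complex.Im (regularized u chi e p) = regIm (joint_point e p).
Proof.
move=> e01; rewrite /regularized reg_integrand.
rewrite (distribution_parts uD cL LU (cut_rtest p S1.1 e01) (cut_rtest p S2.1 e01)).
by rewrite reD imD reM imM /regRe /regIm /lam1 /lam2 /=; split; ring.
Qed.

Lemma regRe_smooth : rsmooth Om regRe.
Proof.
have [l1 l2] := distribution_functional uD cL LU.
apply: rsmoothD => //; first exact: (pairing_smooth oOm cL l1 (cut_joint S1.1)).
apply: rsmoothM => //; last exact: rsmooth_cst.
exact: (pairing_smooth oOm cL l2 (cut_joint S2.1)).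
Qed.

Lemma regIm_smooth : rsmooth Om regIm.
Proof.
have [l1 l2] := distribution_functional uD cL LU.
apply: rsmoothD => //; first exact: (pairing_smooth oOm cL l1 (cut_joint S2.1)).
exact: (pairing_smooth oOm cL l2 (cut_joint S1.1)).
Qed.

(** The bounds of the kernel, [cut_kernel_mbnd], pass through the distribution by
    [pairing_mbnd]; away from [L] the quotients [p r^-1] stay away from [0]. *)
Lemma reg_mbnd K (b : bool) : compact K -> (b -> forall x, K x -> ~ L x) ->
  let Z := [set z : 'rV[R]_(1 + d) | 0 < z 0 (lshift d ord0) < 1 /\ K (rsubmx z)] in
  mbnd ep Z b regRe /\ mbnd ep Z b regIm.
Proof.
move=> cK KL Z; have [l1 l2] := distribution_functional uD cL LU.
have ZOm : Z `<=` Om by move=> z [].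
have Z0 z : Z z -> 0 < z 0 (lshift d ord0) <= 1 by move=> [/andP[-> /ltW]].
have [B1 B10 HB1] := compact_norm_bound cK.
have [B2 B20 HB2] := compact_norm_bound cL.
have P lam sigma : rfunctional L lam -> rschwartz sigma ->
    mbnd ep Z b (fun z => lam (cut chi sigma z)).
  move=> lamL sS; apply: (pairing_mbnd oOm cL lamL (cut_joint sS.1) ZOm Z0).
  apply: (eq_prop (P := fun f => mbnd f _ b _) (f := fun w => w 0 e_idx)).
    by move=> w; rewrite mxE.
  apply: (@cut_kernel_mbnd _ _ _ (1 + B1 + B2) L) => //.
  - by move=> w [/Z0 + _]; rewrite mxE.
  - move=> w j [[/andP[w0 w1] Kw] Lw].
    have Ee : lsubmx w 0 (lshift d ord0) = w 0 (lshift d (lshift d ord0)) by rewrite mxE.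
    rewrite Ee in w0 w1.
    case: (fintype.split_ordP j) => [k ->|k ->].
      case: (fintype.split_ordP k) => [l ->|l ->].
        by rewrite (ord1 l) (ger0_norm (ltW w0)) (le_trans (ltW w1))// -addrA lerDl addr_ge0.
      have -> : w 0 (lshift d (rshift 1 l)) = rsubmx (lsubmx w) 0 l by rewrite !mxE.
      apply: (le_trans (coord_le_norm _ _)); apply: (le_trans (HB1 _ Kw)).
      by rewrite addrAC lerDr addr_ge0.
    have -> : w 0 (rshift (1 + d) k) = rsubmx w 0 k by rewrite !mxE.
    apply: (le_trans (coord_le_norm _ _)); apply: (le_trans (HB2 _ Lw)).
    by rewrite lerDr addr_ge0.
  - by move=> w [].
  - exact: chiL.1.
  move=> /KL KL'; have [delta d0 Hd] := quot_separation cK cL KL'.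
  by exists delta => // w [[_ Kw] Lw]; exact: Hd.
have J1 lam sigma : rfunctional L lam -> rschwartz sigma -> rsmooth Om (fun z => lam (cut chi sigma z)).
  by move=> lamL sS; exact: (pairing_smooth oOm cL lamL (cut_joint sS.1)).
split.
  apply: (mbndD oOm ZOm Z0); [exact: J1| |exact: P|].
    by apply: rsmoothM => //; [exact: J1|exact: rsmooth_cst].
  apply: (mbndM oOm ZOm Z0); [exact: J1|exact: rsmooth_cst|exact: P|].
  by have [] := nice_cst ep Om Z (-1).
by apply: (mbndD oOm ZOm Z0); [exact: J1|exact: J1|exact: P|exact: P].
Qed.

Lemma reg_moderate V : open V -> cbound false V (regularized u chi).
Proof.
move=> oV; apply: (@cbound_sub _ _ _ setT) => //.
split; split.
- apply: (joint_net openT regRe_smooth) => e x e01 _; exact: (reg_parts x e01).1.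
- apply: (joint_derivs_bound openT (Phi := regRe)) => [e x e01 _|K cK _]; first exact: (reg_parts x e01).1.
  by have [] := @reg_mbnd K false cK.
- apply: (joint_net openT regIm_smooth) => e x e01 _; exact: (reg_parts x e01).2.
- apply: (joint_derivs_bound openT (Phi := regIm)) => [e x e01 _|K cK _]; first exact: (reg_parts x e01).2.
  by have [] := @reg_mbnd K false cK.
Qed.

(** Away from the support of the cutoff, the rapid decay of [rho] makes the
    regularization negligible. *)
Lemma reg_null K : compact K -> (forall x, K x -> ~ L x) ->
  unif_bound true K (reN (regularized u chi)) /\ unif_bound true K (imN (regularized u chi)).
Proof.
move=> cK KL.
have oL : open (~` L) by apply: closed_openC; apply: compact_closed cL; exact: row_hausdorff.
have [H1 H2] : derivs_bound true (~` L) (reN (regularized u chi)) /\ derivs_bound true (~` L) (imN (regularized u chi)).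
  split.
    apply: (joint_derivs_bound oL (Phi := regRe)) => [e x e01 _|K' cK' KL']; first exact: (reg_parts x e01).1.
    by have [] := @reg_mbnd K' true cK' (fun _ => KL').
  apply: (joint_derivs_bound oL (Phi := regIm)) => [e x e01 _|K' cK' KL']; first exact: (reg_parts x e01).2.
  by have [] := @reg_mbnd K' true cK' (fun _ => KL').
by split; [exact: (H1 K cK KL [::])|exact: (H2 K cK KL [::])].
Qed.

End OneCutoff.

Lemma reg_linear U L u chi chi' e p : Defs.distribution U u -> compact L -> L `<=` U ->
  rtest L chi -> rtest L chi' -> 0 < e < 1 ->
  regularized u (fun x => chi x - chi' x) e p = regularized u chi e p - regularized u chi' e p.
Proof.
move=> uD cL LU cT cT' e01; have [S1 S2] := schwartz_parts.
have [uL _ _] := uD.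
have T h : rtest L h -> test_fun U (fun r => (h r)%:C * mollifier rho e (hmul p (hinv r))).
  move=> hL; rewrite reg_integrand.
  by have [] := cplx_test cL LU (cut_rtest hL p S1.1 e01) (cut_rtest hL p S2.1 e01).
rewrite {1}/regularized -[RHS]addrC -mulN1r -(uL _ _ _ (T _ cT') (T _ cT)).
congr (u _); apply/funext => r /=.
by rewrite rmorphB /= mulrBl mulN1r addrC.
Qed.

(** Two cutoffs that agree near [K] give regularizations that agree on [K] up to
    a negligible error. *)
Lemma reg_agree U L W u chi chi' K : Defs.distribution U u -> compact L -> L `<=` U ->
  rtest L chi -> rtest L chi' -> open W -> K `<=` W -> (forall x, W x -> chi x = chi' x) ->
  compact K ->
  unif_bound true K (fun e p => complex.Re (regularized u chi e p) - complex.Re (regularized u chi' e p)) /\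
  unif_bound true K (fun e p => complex.Im (regularized u chi e p) - complex.Im (regularized u chi' e p)).
Proof.
move=> uD cL LU cT cT' oW KW cc cK.
have clW : closed (~` W) by exact: open_closedC.
(* The difference of the cutoffs is supported in a compact set disjoint from [K]. *)
pose L' := L `\` W.
have cL' : compact L'.
  apply: (subclosed_compact _ cL); last by move=> x [].
  by apply: closedI => //; apply: compact_closed cL; exact: row_hausdorff.
have dT : rtest L' (fun x => chi x - chi' x).
  split; first exact: (rtestB cT cT').1.
  move=> x nx; have [Wx|Wx] := pselect (W x); first by rewrite cc// subrr.
  by rewrite (cT.2 x) ?(cT'.2 x) ?subr0// => Lx; apply: nx.
have L'U : L' `<=` U by move=> x [/LU].
have [|N1 N2] := reg_null uD cL' L'U dT cK; first by move=> x /KW Wx [].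
split.
  apply: unif_bound_eq N1; apply: near0S near_e01 => e e01 x _.
  by rewrite /reN /reF (reg_linear _ uD cL LU cT cT' e01) reD reNN.
apply: unif_bound_eq N2; apply: near0S near_e01 => e e01 x _.
by rewrite /imN /imF (reg_linear _ uD cL LU cT cT' e01) imD imNN.
Qed.

End Regularization.

(** * Nets associated with a distribution *)

Section Association.
Context {R : realType} {n : nat}.
Local Notation d := (n + n + 1)%N.
Local Notation H := 'rV[R]_d.
Local Notation C := R[i].
Local Notation net := (@net R d).
Implicit Types (U K L : set H) (f g : net).
Variable rho : H -> C.
Hypothesis rhoS : schwartz rho.
Local Notation reg := (regularized rho).

Lemma cutoff_rtest U K chi L W : cutoff_spec U K chi L W -> rtest L chi.
Proof. by move=> [[? ? ? ? ?] [? ?]]; split. Qed.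

(** Closeness of the values only; by [close_negligible] it determines the class of a
    moderate net. *)
Definition close_on K f g :=
  unif_bound true K (fun e p => complex.Re (f e p) - complex.Re (g e p)) /\
  unif_bound true K (fun e p => complex.Im (f e p) - complex.Im (g e p)).

Lemma close_on_trans K f g h : close_on K f g -> close_on K g h -> close_on K f h.
Proof.
move=> [f1 f2] [g1 g2]; split.
  by apply: unif_bound_eq (unif_boundD f1 g1); apply: near0S near_e01 => e _ x _; rewrite addrA subrK.
by apply: unif_bound_eq (unif_boundD f2 g2); apply: near0S near_e01 => e _ x _; rewrite addrA subrK.
Qed.

Lemma unif_boundN b K (A : R -> H -> R) : unif_bound b K A -> unif_bound b K (fun e x => - A e x).
Proof.
have E e x : `|- A e x| = `|A e x| by rewrite normrN.
by case: b => H0; [move=> N; have [c Hc] := H0 N; exists c|have [N [c Hc]] := H0; exists N, c];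
  apply: near0S Hc => e He x Kx; rewrite E; exact: He.
Qed.

Lemma close_on_sym K f g : close_on K f g -> close_on K g f.
Proof.
move=> [f1 f2]; split.
  by apply: unif_bound_eq (unif_boundN f1); apply: near0S near_e01 => e _ x _; rewrite opprB.
by apply: unif_bound_eq (unif_boundN f2); apply: near0S near_e01 => e _ x _; rewrite opprB.
Qed.

Lemma unif_bound_zero K : unif_bound true K (fun (_ : R) (_ : H) => 0).
Proof. by move=> N; exists 0; apply: near0S near_e01 => e _ x _; rewrite normr0 mul0r. Qed.

Lemma close_on_eq K f g : (forall e p, 0 < e < 1 -> K p -> f e p = g e p) -> close_on K f g.
Proof.
move=> fg; split; apply: unif_bound_eq (unif_bound_zero K); apply: near0S near_e01 => e e01 x Kx;
  by rewrite (fg e x e01 Kx) subrr.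
Qed.

(** [f] represents the distribution [u]: on each compact it is, up to a
    negligible error, the convolution of the mollifier with [chi u]. *)
Definition associated U (u : (H -> C) -> C) f := cbound false U f /\
  forall K chi L W, compact K -> K `<=` U -> cutoff_spec U K chi L W ->
    close_on K f (reg u chi).

(** Derivatives are taken care of by [landau]. *)
Lemma close_negligible U f g : open U -> cbound false U f -> cbound false U g ->
  (forall K, compact K -> K `<=` U -> close_on K f g) -> cbound true U (fun e x => f e x - g e x).
Proof.
move=> oU fm gm H0; apply: cbound_landau => //; first exact: cboundB.
move=> K cK KU; have [h1 h2] := H0 K cK KU; split.
  by apply: unif_bound_eq h1; apply: near0S near_e01 => e _ x _; rewrite /reN /reF reD reNN.
by apply: unif_bound_eq h2; apply: near0S near_e01 => e _ x _; rewrite /imN /imF imD imNN.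
Qed.

Lemma negligible_close U f g K : cbound true U (fun e x => f e x - g e x) ->
  compact K -> K `<=` U -> close_on K f g.
Proof.
move=> fg cK KU; have [h1 h2] := cbound_unif_bound cK KU fg; split.
  by apply: unif_bound_eq h1; apply: near0S near_e01 => e _ x _; rewrite /reN /reF reD reNN.
by apply: unif_bound_eq h2; apply: near0S near_e01 => e _ x _; rewrite /imN /imF imD imNN.
Qed.

(** Both nets are close to the same regularizations. *)
Lemma associated_unique U u f g : open U -> associated U u f -> associated U u g ->
  cbound true U (fun e x => f e x - g e x).
Proof.
move=> oU [fm fa] [gm ga]; apply: close_negligible => // K cK KU.
have [chi [L [W chiP]]] := cutoff oU cK KU.
exact: close_on_trans (fa _ _ _ _ cK KU chiP) (close_on_sym (ga _ _ _ _ cK KU chiP)).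
Qed.

Lemma associated_class U u f g : open U -> associated U u f -> gs_class U f g -> associated U u g.
Proof.
move=> oU [fm fa] /(gs_classP _ _ oU)[gm fg]; split => // K chi L W cK KU chiP.
apply: close_on_trans (fa _ _ _ _ cK KU chiP).
exact: close_on_sym (negligible_close fg cK KU).
Qed.

(** By [phiE] this set of nets is a single class of [G^s(U)], the one of any net
    associated with [u]; membership is a condition on each compact set and is linear
    in [u], which is what compatibility with restrictions and linearity need. *)
Definition phi U (u : (H -> C) -> C) : set net := [set f | associated U u f].

Lemma phiE U u f : open U -> associated U u f -> phi U u = gs_class U f.
Proof.
move=> oU fa; apply/seteqP; split => g ga; last exact: associated_class fa ga.
by apply/gs_classP => //; split; [exact: ga.1|exact: associated_unique fa ga].
Qed.

Lemma cutoff_specS U V K chi L W : V `<=` U -> cutoff_spec V K chi L W -> cutoff_spec U K chi L W.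
Proof. by move=> VU [[? ? LV ? ?] [? ?]]; split => //; split => //; exact: subset_trans VU. Qed.

Lemma reg_test U L chi e p : compact L -> L `<=` U -> rtest L chi -> 0 < e < 1 ->
  test_fun U (fun r => (chi r)%:C * mollifier rho e (hmul p (hinv r))).
Proof.
move=> cL LU cT e01; have [S1 S2] := schwartz_parts rhoS; rewrite reg_integrand.
by have [] := cplx_test cL LU (cut_rtest cT p S1.1 e01) (cut_rtest cT p S2.1 e01).
Qed.

Lemma associated_res U V u f : V `<=` U -> associated U u f -> associated V (dist_res V u) f.
Proof.
move=> VU [fm fa]; split; first exact: cbound_sub fm.
move=> K chi L W cK KV chiP.
apply: close_on_trans (fa _ _ _ _ cK (subset_trans KV VU) (cutoff_specS VU chiP)) _.
apply: close_on_eq => e p e01 _; rewrite /regularized /dist_res asboolT//.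
have [[_ cL LV _ _] _] := chiP.
exact: reg_test cL LV (cutoff_rtest chiP) e01.
Qed.

Lemma associated_lin U (a : C) u v f g : open U -> associated U u f -> associated U v g ->
  associated U ((a \*o u) \+ v) (fun e x => a * f e x + g e x).
Proof.
move=> oU [fm fa] [gm ga]; split; first by apply: cboundD => //; exact: cboundZ.
move=> K chi L W cK KU chiP.
have [f1 f2] := fa _ _ _ _ cK KU chiP; have [g1 g2] := ga _ _ _ _ cK KU chiP.
have Cst (c : R) : unif_bound false K (fun (_ : R) (_ : H) => c).
  by apply: (@unif_bound_bounded _ _ K _ `|c|).
split.
  apply: unif_bound_eq (unif_boundD (unif_boundD (unif_boundM f1 (Cst (complex.Re a))) (unif_boundM f2 (Cst (- complex.Im a)))) g1).
  apply: near0S near_e01 => e _ x _; rewrite /regularized /= !(reD, reM); ring.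
apply: unif_bound_eq (unif_boundD (unif_boundD (unif_boundM f2 (Cst (complex.Re a))) (unif_boundM f1 (Cst (complex.Im a)))) g2).
apply: near0S near_e01 => e _ x _; rewrite /regularized /= !(imD, imM); ring.
Qed.

Lemma rsmooth_local m (U : set 'rV[R]_m) (f : 'rV[R]_m -> R) :
  (forall x, U x -> exists2 V, V x & rsmooth V f) -> rsmooth U f.
Proof.
by move=> H0; apply/rsmoothP => s x /H0[V Vx /rsmoothP]; apply.
Qed.

Lemma truncated_sum (V : nmodType) (g : nat -> V) m m' :
  (forall j, (m < j)%N -> g j = 0) -> (forall j, (m' < j)%N -> g j = 0) ->
  \sum_(j < m.+1) g j = \sum_(j < m'.+1) g j.
Proof.
wlog mm : m m' / (m <= m')%N.
  by move=> W H1 H2; have [/W|/ltnW/W] := leqP m m'; [apply|move=> ->].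
move=> H1 _; rewrite -!(big_mkord xpredT g) [RHS](big_cat_nat _ (n := m.+1))//=.
by rewrite [X in _ = _ + X]big_nat [X in _ = _ + X]big1 ?addr0// => j /andP[/H1].
Qed.

(** * Gluing regularizations *)

Section Existence.
Variables (U : set H) (u : (H -> C) -> C).
Hypotheses (oU : open U) (uD : Defs.distribution U u).
Variables (K : nat -> set H) (psi eta : nat -> H -> R) (M N V : nat -> set H).
Hypothesis Kexh : forall A, compact A -> A `<=` U -> exists j, A `<=` interior (K j).
Hypothesis psiS : forall j, rsmooth setT (psi j).
Hypothesis psiK : forall m j p, K m p -> (m < j)%N -> psi j p = 0.
Hypothesis psi1 : forall m p, K m p -> \sum_(j < m.+1) psi j p = 1.
Hypothesis psiM : forall j p, ~ M j p -> psi j p = 0.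
Hypothesis cM : forall j, compact (M j).
Hypothesis etaP : forall j, cutoff_spec U (M j) (eta j) (N j) (V j).

Definition level (p : H) : nat := xget 0%N [set m | K m p].

Lemma levelP m p : K m p -> K (level p) p.
Proof. by move=> Km; rewrite /level; case: xgetP => [k _ //|/(_ m)]; case. Qed.

(** A locally finite sum: [psi] is a partition of unity such that [psi j] vanishes on [K m]
    for [j > m], and [eta j] is a cutoff equal to [1] near the support of [psi j]. The level of
    [p] tells how many terms to take, and any larger number gives the same value. *)
Definition glued : net := fun e p =>
  \sum_(j < (level p).+1) (psi j p)%:C * reg u (eta j) e p.

Lemma level_sum (W : nmodType) (g : nat -> W) m p : K m p ->
  (forall j, psi j p = 0 -> g j = 0) ->
  \sum_(j < (level p).+1) g j = \sum_(j < m.+1) g j.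
Proof.
move=> Km g0; apply: truncated_sum => j mj; apply: g0.
  exact: psiK (levelP Km) mj.
exact: psiK Km mj.
Qed.

Lemma gluedE m e p : K m p -> glued e p = \sum_(j < m.+1) (psi j p)%:C * reg u (eta j) e p.
Proof.
move=> Km; pose g j := (psi j p)%:C * reg u (eta j) e p.
by apply: (@level_sum _ g m p Km) => j p0; rewrite /g p0 mul0r.
Qed.

(** Near a point the number of terms may be taken constant. *)
Lemma glued_joint (G : nat -> 'rV[R]_(1 + d) -> R) :
  (forall j, rsmooth (joint_dom setT) (G j)) ->
  rsmooth (joint_dom U) (fun z => \sum_(j < (level (rsubmx z)).+1) psi j (rsubmx z) * G j z).
Proof.
move=> Gs; apply: rsmooth_local => z [z01 Uz].
have [m Hm] := Kexh (@compact_set1 _ _) (fun x (e : x = rsubmx z) => eq_ind_r U Uz e).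
have oV : open (joint_dom (interior (K m))).
  by apply: open_joint_dom; exact: open_interior.
exists (joint_dom (interior (K m))); first by split => //; exact: Hm.
have VT : joint_dom (interior (K m)) `<=` joint_dom setT by move=> w [].
apply: (rsmooth_eq oV (f := fun z => \sum_(j < m.+1) psi j (rsubmx z) * G j z)).
  move=> w [_ /interior_subset Kw]; apply/esym.
  pose g j := psi j (rsubmx w) * G j w.
  by apply: (@level_sum _ g m _ Kw) => j p0; rewrite /g p0 mul0r.
apply: rsmooth_sum => // j; apply: rsmoothM => //; last exact: rsmoothS (Gs j).
apply: (rsmooth_comp openT oV _ (psiS j)) => // i.
by under eq_fun do rewrite mxE; exact: rsmooth_coord.
Qed.

Lemma glued_net : rsmooth_net U (reN glued) /\ rsmooth_net U (imN glued).
Proof.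
have etaT j := cutoff_rtest (etaP j).
have cN j : compact (N j) by have [[]] := etaP j.
have NU j : N j `<=` U by have [[]] := etaP j.
split.
  apply: (joint_net oU (glued_joint (fun j => regRe_smooth rhoS uD (cN j) (@NU j) (etaT j)))).
  move=> e x e01 Ux; rewrite /reN /reF /glued row_mxKr -[complex.Re _]/(_).
  elim/big_rec2: _ => // j y1 y2 _ <-; rewrite reD reM /= mul0r subr0.
  by have [-> _] := reg_parts rhoS uD (cN j) (@NU j) (etaT j) x e01.
apply: (joint_net oU (glued_joint (fun j => regIm_smooth rhoS uD (cN j) (@NU j) (etaT j)))).
move=> e x e01 Ux; rewrite /imN /imF /glued row_mxKr -[complex.Im _]/(_).
elim/big_rec2: _ => // j y1 y2 _ <-; rewrite imD imM /= mul0r addr0.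
by have [_ ->] := reg_parts rhoS uD (cN j) (@NU j) (etaT j) x e01.
Qed.

Lemma finite_glued_moderate m W : open W ->
  cbound false W (fun e p => \sum_(j < m) (psi j p)%:C * reg u (eta j) e p).
Proof.
move=> oW; elim: m => [|m IH].
  by apply: cbound_net_eq (cbound_zero false oW) => e p; rewrite big_ord0.
apply: cbound_net_eq (cboundD oW IH (cboundM oW _ _)); last 2 first.
- apply: (cbound_cst oW (f := fun p => (psi m p)%:C)); apply/smoothP; split.
    by apply: rsmoothS (psiS m).
  exact: rsmooth_cst.
- have [[_ cN NU _ _] _] := etaP m.
  exact: (reg_moderate rhoS uD cN NU (cutoff_rtest (etaP m)) oW).
by move=> e p; rewrite big_ord_recr.
Qed.

Lemma glued_moderate : cbound false U glued.
Proof.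
have [g1 g2] := glued_net.
have Loc A : compact A -> A `<=` U -> exists2 W, open W /\ A `<=` W &
    exists m, forall e p, W p -> glued e p = \sum_(j < m.+1) (psi j p)%:C * reg u (eta j) e p.
  move=> cA AU; have [m Hm] := Kexh cA AU; exists (interior (K m)).
    by split => //; exact: open_interior.
  by exists m => e p /interior_subset; exact: gluedE.
split; split => // A cA AU s; have [W [oW AW] [m Em]] := Loc A cA AU;
    have [[_ f1] [_ f2]] := finite_glued_moderate m.+1 oW.
  apply: unif_bound_eq (f1 A cA AW s); apply: near0S near_e01 => e _ x Ax.
  apply: (eq_on_rpartials s oW) => [y Wy|]; last exact: AW.
  by rewrite /reN /reF Em.
apply: unif_bound_eq (f2 A cA AW s); apply: near0S near_e01 => e _ x Ax.
apply: (eq_on_rpartials s oW) => [y Wy|]; last exact: AW.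
by rewrite /imN /imF Em.
Qed.

Lemma unif_bound_supported A (B : set H) (f : H -> R) (T : R -> H -> R) : rsmooth setT f ->
  compact A -> (forall p, ~ B p -> f p = 0) -> unif_bound true (A `&` B) T ->
  unif_bound true A (fun e p => f p * T e p).
Proof.
move=> fs cA fB TB m; have [c c0 Hc] := unif_bound_pos TB m.
have [b b0 Hb] := compact_bound fs cA (@subsetT _ A).
exists (b * c); apply: near0S (near0I near_e01 Hc) => e [/andP[e0 _] He] x Ax.
have [Bx|nBx] := pselect (B x); last first.
  by rewrite fB// mul0r normr0 !mulr_ge0// exprn_ge0// ltW.
by rewrite normrM -mulrA ler_pM//; [exact: Hb|exact: He].
Qed.

Lemma unif_bound_sum A (T : nat -> R -> H -> R) m : (forall j, unif_bound true A (T j)) ->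
  unif_bound true A (fun e p => \sum_(j < m) T j e p).
Proof.
move=> HT; elim: m => [|m IH].
  by apply: unif_bound_eq (unif_bound_zero A); apply: near0S near_e01 => e _ x _; rewrite big_ord0.
by apply: unif_bound_eq (unif_boundD IH (HT m)); apply: near0S near_e01 => e _ x _; rewrite big_ord_recr.
Qed.

(** On the support of [psi j] the regularization by [eta j] is close to the one by [chi],
    and the functions [psi j] add up to [1]. *)
Lemma glued_associated : associated U u glued.
Proof.
split; first exact: glued_moderate.
move=> A chi L W cA AU chiP; have [m Hm] := Kexh cA AU.
have KA p : A p -> K m p by move=> /Hm /interior_subset.
have [[_ cL LU oW AW] [chi1 _]] := chiP.
have D j : close_on (A `&` M j) (reg u (eta j)) (reg u chi).
  have [[_ cN NU oV MV] [eta1 _]] := etaP j.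
  apply: (@reg_agree _ _ _ rhoS U (N j `|` L) (V j `&` W)) => //.
  - exact: compactU.
  - by move=> x [/NU|/LU].
  - by apply: rtestS (cutoff_rtest (etaP j)) => x; left.
  - by apply: rtestS (cutoff_rtest chiP) => x; right.
  - exact: openI.
  - by move=> x [Ax Mx]; split; [exact: MV|exact: AW].
  - by move=> x [/eta1 -> /chi1 ->].
  - apply: (subclosed_compact _ cA); last by move=> x [].
    by apply: closedI; apply: compact_closed => //; exact: row_hausdorff.
split.
  apply: unif_bound_eq (unif_bound_sum m.+1 (fun j => unif_bound_supported (psiS j) cA (@psiM j) (D j).1)).
  apply: near0S near_e01 => e _ x Ax; rewrite (gluedE _ (KA x Ax)).
  under eq_bigr do rewrite mulrBr.
  rewrite sumrB -mulr_suml psi1 ?mul1r; last exact: KA.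
  congr (_ - _); elim/big_rec2: _ => // j y1 y2 _ ->; by rewrite reD reM /= mul0r subr0.
apply: unif_bound_eq (unif_bound_sum m.+1 (fun j => unif_bound_supported (psiS j) cA (@psiM j) (D j).2)).
apply: near0S near_e01 => e _ x Ax; rewrite (gluedE _ (KA x Ax)).
under eq_bigr do rewrite mulrBr.
rewrite sumrB -mulr_suml psi1 ?mul1r; last exact: KA.
congr (_ - _); elim/big_rec2: _ => // j y1 y2 _ ->; by rewrite imD imM /= mul0r addr0.
Qed.

End Existence.

(** For cutoffs [chi j] equal to [1] near the sets [K j] of an exhaustion, the functions
    [psi j = chi j - chi (j - 1)] form a partition of unity: the sums telescope. *)
Lemma associated_exists U u : open U -> Defs.distribution U u -> exists f, associated U u f.
Proof.
move=> oU uD; have [K [cK KU Kmono Kexh]] := exhaustion oU.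
have /choice[chi0 Hchi] : forall j, exists c : (H -> R) * set H * set H,
    cutoff_spec U (K j) c.1.1 c.1.2 c.2.
  by move=> j; have [chi [L [W ?]]] := cutoff oU (cK j) (@KU j); exists (chi, L, W).
pose chi j := (chi0 j).1.1; pose L j := (chi0 j).1.2.
pose psi j p := chi j p - (if j is j'.+1 then chi j' p else 0).
pose M j := L j `|` (if j is j'.+1 then L j' else set0).
have cM j : compact (M j).
  apply: compactU; first by have [[]] := Hchi j.
  by case: j => [|j]; [exact: compact0|have [[]] := Hchi j].
have MU j : M j `<=` U.
  have LU i : L i `<=` U by have [[]] := Hchi i.
  by move=> x [/LU//|]; case: j => // j /LU.
have /choice[eta0 Heta] : forall j, exists c : (H -> R) * set H * set H,
    cutoff_spec U (M j) c.1.1 c.1.2 c.2.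
  by move=> j; have [c [A [W ?]]] := cutoff oU (cM j) (@MU j); exists (c, A, W).
have chi1 m j p : K m p -> (m <= j)%N -> chi j p = 1.
  move=> Km mj; have [[_ _ _ _ KW] [H1 _]] := Hchi j.
  by apply: H1; apply: KW; exact: Kmono mj _ Km.
exists (glued u K psi (fun j => (eta0 j).1.1)).
apply: (glued_associated oU uD Kexh _ _ _ _ cM Heta).
- move=> j; apply: rsmoothB; [exact: openT|by have [[]] := Hchi j|].
  by case: j => [|j]; [exact: rsmooth_cst|have [[]] := Hchi j].
- move=> m [//|j] p Km mj; rewrite /psi (chi1 m)//; last exact: ltnW.
  by rewrite (chi1 m) ?subrr.
- move=> m p Km; rewrite -(chi1 m m p Km (leqnn m)) {Km}.
  elim: m => [|m IH]; first by rewrite big_ord1 /psi subr0.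
  by rewrite big_ord_recr /= IH /psi addrC subrK.
- move=> j p nM; rewrite /psi.
  have c0 i : ~ L i p -> chi i p = 0 by have [_ [_ c0]] := Hchi i; exact: c0.
  rewrite c0; last by move=> Lp; apply: nM; left.
  case: j nM => [|j] nM; first by rewrite subrr.
  by rewrite c0 ?subrr// => Lp; apply: nM; right.
Qed.

(** Each clause is checked on associated nets, which exist by [associated_exists]. *)
Lemma phi_sheaf_morphism : sheaf_morphism phi.
Proof.
split.
- move=> U oU u uD; have [f fa] := associated_exists oU uD.
  by exists f; [apply/moderate_cbound => //; exact: fa.1|exact: phiE].
- move=> U oU a u v uD vD; have [f fa] := associated_exists oU uD; have [g ga] := associated_exists oU vD.
  rewrite (phiE oU (associated_lin a oU fa ga)) (phiE oU fa) (phiE oU ga).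
  by rewrite gs_scaleE//; [rewrite gs_addE//; [exact: cboundZ fa.1|exact: ga.1]|exact: fa.1].
- move=> U V oU oV VU u uD; have [f fa] := associated_exists oU uD.
  by rewrite (phiE oV (associated_res VU fa)) (phiE oU fa) gs_resE//; exact: fa.1.
Qed.

End Association.

(** * Compactly supported distributions *)

Section CompactDistributions.
Context {R : realType} {d : nat}.
Local Notation H := 'rV[R]_d.
Local Notation C := R[i].
Implicit Types (K W : set H) (f g : H -> R).

Lemma rtestM K f g : rsmooth setT f -> rtest K g -> rtest K (fun x => f x * g x).
Proof.
move=> fs [gs g0]; split; first exact: rsmoothM openT fs gs.
by move=> x Kx; rewrite g0// mulr0.
Qed.

Lemma compactD K W : compact K -> open W -> compact (K `\` W).
Proof.
move=> cK oW; apply: (subclosed_compact _ cK); last by move=> x [].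
by apply: closedI; [apply: compact_closed cK; exact: row_hausdorff|exact: open_closedC].
Qed.

Variable u : (H -> C) -> C.
Hypothesis uD : Defs.distribution setT u.

Lemma distribution_cplxD K (f f' g g' : H -> R) : compact K ->
  rtest K f -> rtest K g -> rtest K f' -> rtest K g' ->
  u (cplx (fun x => f x + f' x) (fun x => g x + g' x)) = u (cplx f g) + u (cplx f' g').
Proof.
move=> cK fT gT fT' gT'; have [uL _ _] := uD.
have T a b : rtest K a -> rtest K b -> test_fun setT (cplx a b).
  by move=> aT bT; have [] := cplx_test cK (@subsetT _ K) aT bT.
rewrite -[u (cplx f g)]mul1r -(uL _ _ _ (T _ _ fT gT) (T _ _ fT' gT')).
by congr (u _); apply/funext => x; apply: complex_parts; rewrite /= ?reD ?imD ?reM ?imM /=; ring.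
Qed.

Lemma distribution0 : u (cplx (fun=> 0) (fun=> 0)) = 0.
Proof.
have := distribution_cplxD (@compact0 _) (rtest0 set0) (rtest0 set0) (rtest0 set0) (rtest0 set0).
have -> : (fun x : H => 0 + 0) = (fun=> 0 : R) by apply/funext => x; rewrite addr0.
by move=> h; apply: (addrI (u (cplx (fun=> 0) (fun=> 0)))); rewrite addr0.
Qed.

(** Split the test function with a cutoff equal to [1] near the part of [K] outside the
    later open sets; the remaining part is supported in the later sets. *)
Lemma null_cover (I : Type) (s : seq I) (V : I -> set H) :
  (forall i, open (V i) /\ forall h : H -> C, test_fun (V i) h -> u h = 0) ->
  open (\big[setU/set0]_(i <- s) V i) /\
  forall K f g, compact K -> K `<=` \big[setU/set0]_(i <- s) V i -> rtest K f -> rtest K g ->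
    u (cplx f g) = 0.
Proof.
move=> VN; elim: s => [|i s [oS IH]].
  rewrite big_nil; split; first exact: open0.
  move=> K f g _ K0 [_ f0] [_ g0]; rewrite -[RHS]distribution0; congr (u _).
  by apply/funext => x; rewrite /cplx f0 ?g0// => /K0.
rewrite big_cons; have [oV uV] := VN i.
split; first exact: openU.
move=> K f g cK KV fT gT.
set S := \big[setU/set0]_(j <- s) V j in oS IH KV.
have KSV : K `\` S `<=` V i by move=> x [/KV[]].
have [chi [L [W [[cs cL LV oW KW] [chi1 chi0]]]]] := cutoff oV (compactD cK oS) KSV.
pose c1 x := 1 - chi x.
have c1s : rsmooth setT c1 by apply: rsmoothB openT _ cs; exact: rsmooth_cst.
have chiL : rtest L chi by [].
have T h : rtest K h -> rtest L (fun x => h x * chi x).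
  by move=> [hs _]; exact: rtestM.
have TK h : rtest K h -> rtest (K `\` W) (fun x => c1 x * h x).
  move=> hT; split; first exact: (rtestM c1s hT).1.
  move=> x nx; have [Wx|nW] := pselect (W x); first by rewrite /c1 chi1// subrr mul0r.
  by rewrite hT.2 ?mulr0// => Kx; apply: nx.
have u1 : u (cplx (fun x => f x * chi x) (fun x => g x * chi x)) = 0.
  by apply: uV; have [] := cplx_test cL LV (T _ fT) (T _ gT).
have u2 : u (cplx (fun x => c1 x * f x) (fun x => c1 x * g x)) = 0.
  apply: (IH (K `\` W)); [exact: compactD| |exact: TK|exact: TK].
  move=> x [Kx nW]; apply: contrapT => nS; apply: nW; apply: KW; split => //.
have E h : rtest K h -> h = fun x => h x * chi x + c1 x * h x.
  by move=> _; apply/funext => x; rewrite /c1; ring.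
rewrite (E f fT) (E g gT) (@distribution_cplxD (L `|` K)) ?u1 ?u2 ?addr0//.
- exact: compactU.
- by apply: rtestS (T _ fT) => x; left.
- by apply: rtestS (T _ gT) => x; left.
- by apply: rtestS (TK _ fT) => x [Kx _]; right.
- by apply: rtestS (TK _ gT) => x [Kx _]; right.
Qed.

(** By compactness finitely many open sets on which [u] vanishes cover [K]. *)
Lemma null_off_supp K f g : compact K -> (forall x, K x -> ~ dist_supp u x) ->
  rtest K f -> rtest K g -> u (cplx f g) = 0.
Proof.
move=> cK KS fT gT.
have /choice[V HV] : forall x, exists V : set H, (open V /\ forall h : H -> C, test_fun V h -> u h = 0) /\
    (K x -> V x).
  move=> x; have [Kx|nK] := pselect (K x); last first.
    exists set0; split => //; split; first exact: open0.
    move=> h [_ _ h0]; rewrite -distribution0; congr (u _); apply/funext => y.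
    rewrite /cplx; apply/eqP; apply: contrapT => /negP hy.
    by apply: (h0 y); apply: subset_closure.
  have : ~ ~ (\bigcup_(V in [set V | open V /\ forall h : H -> C, test_fun V h -> u h = 0]) V) x by exact: KS.
  by move=> /contrapT[V [oV VN] Vx]; exists V.
move: (cK); rewrite compact_cover => cK'.
have [D DK KD] := cK' _ K V (fun x _ => (HV x).1.1) (fun x Kx => ex_intro2 _ _ x Kx ((HV x).2 Kx)).
rewrite /cover bigcup_fset in KD.
exact: (null_cover (finmap.enum_fset D) (fun x => (HV x).1)).2 KD fT gT.
Qed.

(** Two cutoffs equal to [1] near the support of [u] differ by a function that vanishes
    near this support. *)
Lemma dist_pair_cutoff (g : H -> C) chi L W : smooth setT g -> cutoff_spec setT (dist_supp u) chi L W ->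
  dist_pair u g = u (fun x => (chi x)%:C * g x).
Proof.
move=> /smoothP[g1 g2] chiP; have [[cs cL _ oW SW] [chi1 chi0]] := chiP.
have chiL : rtest L chi by [].
have z0 : [set z | exists chi : H -> C, exists W : set H,
    [/\ test_fun setT chi, open W, dist_supp u `<=` W,
        (forall x, W x -> chi x = 1) & z = u (chi \* g)]] (u (fun x => (chi x)%:C * g x)).
  exists (fun x => (chi x)%:C), W; split => //; last by move=> x /chi1 ->.
  by have [] := cplx_test cL (@subsetT _ L) chiL (rtest0 L).
rewrite /dist_pair; case: xgetP => [z _|/(_ _ z0)//].
move=> [c [V [cT oV SV c1 ->]]].
have [cT1 cT2] := test_rtest cT.
pose K := L `|` supp c.
have cK : compact K by apply: compactU => //; case: cT.
pose F1 x := complex.Re (c x) * reF g x - complex.Im (c x) * imF g x.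
pose F2 x := complex.Re (c x) * imF g x + complex.Im (c x) * reF g x.
pose G1 x := chi x * reF g x.
pose G2 x := chi x * imF g x.
have rM (a b : H -> R) A : A `<=` K -> rtest A a -> rsmooth setT b -> rtest K (fun x => a x * b x).
  move=> AK aT bs; apply: rtestS AK _; split; first exact: (rsmoothM openT aT.1 bs).
  by move=> x Ax; rewrite aT.2// mul0r.
have LK : L `<=` K by move=> x; left.
have SK : supp c `<=` K by move=> x; right.
have F1T : rtest K F1 by apply: rtestB; [exact: rM SK cT1 g1|exact: rM SK cT2 g2].
have F2T : rtest K F2.
  split; first exact: (rsmoothD openT (rM _ _ _ SK cT1 g2).1 (rM _ _ _ SK cT2 g1).1).
  move=> x Kx; have /= e1 := (rM _ _ _ SK cT1 g2).2 _ Kx; have /= e2 := (rM _ _ _ SK cT2 g1).2 _ Kx.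
  by rewrite /F2 -/(reF c x) -/(imF c x) e1 e2 addr0.
have G1T : rtest K G1 by exact: rM LK chiL g1.
have G2T : rtest K G2 by exact: rM LK chiL g2.
have -> : c \* g = cplx (fun x => G1 x + (F1 x - G1 x)) (fun x => G2 x + (F2 x - G2 x)).
  by apply/funext => x; apply: complex_parts; rewrite /= ?reM ?imM /F1 /F2 /reF /imF; ring.
have -> : (fun x => (chi x)%:C * g x) = cplx G1 G2.
  by apply/funext => x; apply: complex_parts; rewrite /= ?reM ?imM /G1 /G2 /reF /imF /=; ring.
rewrite (distribution_cplxD cK)//; [|exact: rtestB..].
rewrite (@null_off_supp (K `\` (V `&` W)) (fun x => F1 x - G1 x) (fun x => F2 x - G2 x)) ?addr0//.
- by apply: compactD => //; exact: openI.
- by move=> x [_ nVW] Sx; apply: nVW; split; [exact: SV|exact: SW].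
- split; first exact: (rtestB F1T G1T).1.
  move=> x nx; have [[Vx Wx]|nVW] := pselect ((V `&` W) x).
    by rewrite /F1 /G1 c1// chi1//= mul0r subr0 subrr.
  by rewrite (rtestB F1T G1T).2// => Kx; apply: nx.
- split; first exact: (rtestB F2T G2T).1.
  move=> x nx; have [[Vx Wx]|nVW] := pselect ((V `&` W) x).
    by rewrite /F2 /G2 c1// chi1//= mul0r addr0 subrr.
  by rewrite (rtestB F2T G2T).2// => Kx; apply: nx.
Qed.

End CompactDistributions.

(** * Convolutions and smooth functions *)

Section Convolution.
Context {R : realType} {n : nat}.
Local Notation d := (n + n + 1)%N.
Local Notation H := 'rV[R]_d.
Local Notation C := R[i].
Variable rho : H -> C.
Hypothesis rhoS : schwartz rho.

Lemma mollifier_smooth e (p : H) : 0 < e < 1 ->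
  smooth setT (fun r => mollifier rho e (hmul p (hinv r))).
Proof.
move=> /andP[e0 e1]; have [S1 S2] := schwartz_parts rhoS.
have K sigma : rsmooth setT sigma -> rsmooth setT (fun r => kernel sigma (row_mx (joint_point e p) r)).
  move=> ss; apply: (rsmooth_rslice open_W0 openT _ (kernel_smooth0 ss)) => r _.
  by rewrite /W0 /= joint_point_e.
apply/smoothP; split.
  apply: (rsmooth_eq openT _ (K _ S1.1)) => r _.
  by rewrite kernel_point /reF /mollifier reM /= mul0r subr0 exprVn.
apply: (rsmooth_eq openT _ (K _ S2.1)) => r _.
by rewrite kernel_point /imF /mollifier imM /= mul0r addr0 exprVn.
Qed.

Lemma hconv_reg u chi L W e p : Defs.distribution setT u ->
  cutoff_spec setT (dist_supp u) chi L W -> 0 < e < 1 ->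
  hconv (mollifier rho e) u p = regularized rho u chi e p.
Proof.
by move=> uD chiP e01; rewrite /hconv (dist_pair_cutoff uD (mollifier_smooth p e01) chiP).
Qed.

(** The convolution is the regularization by any cutoff equal to [1] near the support of
    [u]. To compare with a cutoff equal to [1] near [K], choose one equal to [1] near both. *)
Lemma hconv_associated u : compact_distribution u ->
  associated rho setT u (fun e => hconv (mollifier rho e) u).
Proof.
move=> [uD cS].
have [chi [L [W chiP]]] := cutoff openT cS (@subsetT _ _).
have [[_ cL LU _ _] _] := chiP; have chiL := cutoff_rtest chiP.
have P e p (e01 : 0 < e < 1) := reg_parts rhoS uD cL LU chiL p e01.
have M := reg_moderate rhoS uD cL LU chiL openT.
split.
  split; split.
  - apply: (joint_net openT (regRe_smooth rhoS uD cL LU chiL)) => e x e01 _.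
    by rewrite /reN /reF (hconv_reg x uD chiP e01) (P e x e01).1.
  - move=> K cK KU s; apply: unif_bound_eq (M.1.2 K cK KU s); apply: near0S near_e01 => e e01 x _.
    by congr rpartials; apply/funext => y; rewrite /reN /reF (hconv_reg y uD chiP e01).
  - apply: (joint_net openT (regIm_smooth rhoS uD cL LU chiL)) => e x e01 _.
    by rewrite /imN /imF (hconv_reg x uD chiP e01) (P e x e01).2.
  - move=> K cK KU s; apply: unif_bound_eq (M.2.2 K cK KU s); apply: near0S near_e01 => e e01 x _.
    by congr rpartials; apply/funext => y; rewrite /imN /imF (hconv_reg y uD chiP e01).
move=> K chi' L' W' cK KU chiP'.
(* A cutoff equal to [1] near the support of [u] and near [K]. *)
have [chi1 [L1 [W1 chiP1]]] := cutoff openT (compactU cS cK) (@subsetT _ _).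
have chiP1S : cutoff_spec setT (dist_supp u) chi1 L1 W1.
  by have [[? ? ? ? h] ?] := chiP1; split => //; split => // x Sx; apply: h; left.
apply: (@close_on_trans _ _ K _ (regularized rho u chi1)).
  by apply: close_on_eq => e p e01 _; exact: hconv_reg chiP1S e01.
have [[_ cL1 _ oW1 K1] [e1 _]] := chiP1; have [[_ cL' _ oW' K'] [e' _]] := chiP'.
apply: (@reg_agree _ _ _ rhoS setT (L1 `|` L') (W1 `&` W')) => //.
- exact: compactU.
- by apply: rtestS (cutoff_rtest chiP1) => x; left.
- by apply: rtestS (cutoff_rtest chiP') => x; right.
- exact: openI.
- by move=> x Kx; split; [apply: K1; right|exact: K'].
- by move=> x [/e1 -> /e' ->].
Qed.

Hypothesis rho_int : Cintegral rho = 1.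
Hypothesis rho_moments : forall alpha : 'I_d -> nat,
  (exists i, alpha i <> 0%N) -> Cintegral (monomial alpha \* rho) = 0.

Lemma real_moments alpha : (exists i, alpha i <> 0%N) ->
  Rintegral_rV (fun q : H => (\prod_i q 0 i ^+ alpha i) * reF rho q) = 0 /\
  Rintegral_rV (fun q : H => (\prod_i q 0 i ^+ alpha i) * imF rho q) = 0.
Proof.
move=> /rho_moments E; have := congr1 (@complex.Re R) E; have := congr1 (@complex.Im R) E => /=.
rewrite (_ : (fun x => complex.Im _) = (fun q : H => (\prod_i q 0 i ^+ alpha i) * imF rho q)); last first.
  by apply/funext => q; rewrite /= /monomial imM /= mul0r addr0.
rewrite (_ : (fun x => complex.Re _) = (fun q : H => (\prod_i q 0 i ^+ alpha i) * reF rho q)) //.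
by apply/funext => q; rewrite /= /monomial reM /= mul0r subr0.
Qed.

Lemma integrable_rV_compact (G : H -> R) L : compact L -> rtest L G -> integrable_rV G.
Proof.
move=> cL [Gs G0]; have [B B0 HB] := compact_bound Gs cL (@subsetT _ L).
have [P P0 HP] := compact_norm_bound cL.
apply: (@integrable_rV_dominated _ _ _ (B * (1 + P) ^+ (d + d))).
  by move=> x; exact: rsmooth_cont Gs I.
move=> q; have [Lq|nL] := pselect (L q); last first.
  by rewrite G0// normr0 !mulr_ge0 ?exprn_ge0 ?addr_ge0 ?decay_weight_ge0.
rewrite (le_trans (HB q Lq))// -mulrA ler_peMr//.
apply: (le_trans (decay_weight_ge q)); rewrite ler_wpM2r ?decay_weight_ge0//.
by rewrite lerXn2r ?nnegrE ?addr_ge0// lerD2l HP.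
Qed.

Lemma approx_unif_bound (sigma F : H -> R) c L K : rschwartz sigma ->
  (forall alpha : 'I_d -> nat, (exists i, alpha i <> 0%N) ->
    Rintegral_rV (fun q => (\prod_i q 0 i ^+ alpha i) * sigma q) = 0) ->
  Rintegral_rV sigma = c -> compact L -> rtest L F -> compact K ->
  unif_bound true K (fun e p => Rintegral_rV (fun r => F r * kernel sigma (row_mx (joint_point e p) r)) - c * F p).
Proof.
move=> sS sm sc cL [Fs F0] cK N; have [B _ HB] := mollifier_approx N sS sm sc Fs cL F0 cK.
exists B; apply: near0S near_e01 => e e01 p Kp.
by under eq_fun do rewrite kernel_point; exact: HB.
Qed.

(** The regularization of [f] is the integral of [chi f] against the mollifier, which
    approximates [chi f], hence [f] on [K], to every order in [e] by [mollifier_approx]. *)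
Lemma smooth_associated (f : H -> C) : smooth setT f -> associated rho setT (dist_of setT f) (fun=> f).
Proof.
move=> fs; have [f1 f2] := (smoothP _ _).1 fs.
split; first by apply: cbound_cst; first exact: openT.
move=> K chi L W cK KU chiP; have chiL := cutoff_rtest chiP.
have [[_ cL LU _ KW] [chi1 _]] := chiP; have [S1 S2] := schwartz_parts rhoS.
have := congr1 (@complex.Re R) rho_int; rewrite /= => i1.
have := congr1 (@complex.Im R) rho_int; rewrite /= => i2.
have m1 alpha a0 := (@real_moments alpha a0).1.
have m2 alpha a0 := (@real_moments alpha a0).2.
pose F1 x := reF f x * chi x; pose F2 x := imF f x * chi x.
have F1T : rtest L F1 by exact: rtestM.
have F2T : rtest L F2 by exact: rtestM.
have kI F sigma e p : 0 < e < 1 -> rtest L F -> rsmooth setT sigma ->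
    integrable_rV (fun r => F r * kernel sigma (row_mx (joint_point e p) r)).
  move=> /andP[e0 _] FT ss; apply: (integrable_rV_compact cL).
  have ks : rsmooth setT (fun r => kernel sigma (row_mx (joint_point e p) r)).
    apply: (rsmooth_rslice open_W0 openT _ (kernel_smooth0 ss)) => r _.
    by rewrite /W0 /= joint_point_e.
  by split; [exact: rsmoothM openT FT.1 ks|move=> x Lx; rewrite FT.2// mul0r].
have A11 := approx_unif_bound S1 m1 i1 cL F1T cK.
have A12 := approx_unif_bound S2 m2 i2 cL F1T cK.
have A21 := approx_unif_bound S1 m1 i1 cL F2T cK.
have A22 := approx_unif_bound S2 m2 i2 cL F2T cK.
have regE e p : 0 < e < 1 -> regularized rho (dist_of setT f) chi e p =
    Cintegral (f \* cplx (cut chi (reF rho) (joint_point e p)) (cut chi (imF rho) (joint_point e p))).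
  move=> e01; rewrite /regularized /dist_of asboolT; last exact: (reg_test rhoS p cL LU chiL e01).
  by rewrite reg_integrand.
split.
  apply: unif_bound_eq (unif_boundD (unif_boundN A11) A22); apply: near0S near_e01 => e e01 p Kp.
  rewrite regE//=.
  have -> : (fun x => complex.Re (f x * cplx (cut chi (reF rho) (joint_point e p)) (cut chi (imF rho) (joint_point e p)) x)) =
    fun r => F1 r * kernel (reF rho) (row_mx (joint_point e p) r) - F2 r * kernel (imF rho) (row_mx (joint_point e p) r).
    by apply/funext => r; rewrite reM /= /cut /cut_kernel !row_mxKr /F1 /F2 /reF /imF; ring.
  rewrite Rintegral_rVB; [|exact: kI S1.1|exact: kI S2.1].
  have -> : F1 p = complex.Re (f p) by rewrite /F1 chi1 ?mulr1//; exact: KW.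
  ring.
apply: unif_bound_eq (unif_boundD (unif_boundN A12) (unif_boundN A21)); apply: near0S near_e01 => e e01 p Kp.
rewrite regE//=.
have -> : (fun x => complex.Im (f x * cplx (cut chi (reF rho) (joint_point e p)) (cut chi (imF rho) (joint_point e p)) x)) =
  fun r => F1 r * kernel (imF rho) (row_mx (joint_point e p) r) + F2 r * kernel (reF rho) (row_mx (joint_point e p) r).
  by apply/funext => r; rewrite imM /= /cut /cut_kernel !row_mxKr /F1 /F2 /reF /imF; ring.
rewrite Rintegral_rVD; [|exact: kI S2.1|exact: kI S1.1].
have -> : F2 p = complex.Im (f p) by rewrite /F2 chi1 ?mulr1//; exact: KW.
ring.
Qed.

Lemma phi_smooth f : smooth setT f -> phi rho setT (dist_of setT f) = gs_class setT (fun=> f).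
Proof. by move=> fs; apply: phiE; [exact: openT|exact: smooth_associated]. Qed.

Lemma smoothM U (f g : H -> C) : open U -> smooth U f -> smooth U g -> smooth U (f \* g).
Proof.
move=> oU /smoothP[f1 f2] /smoothP[g1 g2]; apply/smoothP; split.
  apply: (rsmooth_eq oU _ (rsmoothB oU (rsmoothM oU f1 g1) (rsmoothM oU f2 g2))) => x _.
  by rewrite /reF /= reM.
apply: (rsmooth_eq oU _ (rsmoothD oU (rsmoothM oU f1 g2) (rsmoothM oU f2 g1))) => x _.
by rewrite /imF /= imM.
Qed.

(** Constant nets multiply like functions. *)
Lemma phi_algebra_hom : algebra_hom_smooth setT (fun f => phi rho setT (dist_of setT f)).
Proof.
have M (f : H -> C) : smooth setT f -> cbound false setT (fun=> f) by apply: cbound_cst; exact: openT.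
split.
- move=> f fs; rewrite phi_smooth//; exists (fun=> f) => //.
  by apply/moderate_cbound; [exact: openT|exact: M].
- move=> a f g fs gs; have afs := smoothZ a openT fs.
  rewrite (phi_smooth fs) (phi_smooth gs) (phi_smooth (smoothD openT afs gs)).
  by rewrite (gs_scaleE _ openT (M _ fs)) (gs_addE openT (M _ afs) (M _ gs)).
- move=> f g fs gs; rewrite (phi_smooth fs) (phi_smooth gs) (phi_smooth (smoothM openT fs gs)).
  by rewrite (gs_mulE openT (M _ fs) (M _ gs)).
- by apply: phi_smooth; apply/smoothP; split; exact: rsmooth_cst.
Qed.

End Convolution.

Theorem proposition3p12 (R : realType) (n : nat)
    (rho : 'rV[R]_(n + n + 1) -> R[i])
    (rho_schwartz : schwartz rho)
    (rho_int : Cintegral rho = 1)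
    (rho_moments : forall alpha : 'I_(n + n + 1) -> nat,
      (exists i, alpha i <> 0%N) ->
      Cintegral (monomial alpha \* rho) = 0) :
  exists phi : set 'rV[R]_(n + n + 1) ->
      (('rV[R]_(n + n + 1) -> R[i]) -> R[i]) -> set (@net R (n + n + 1)),
    [/\ sheaf_morphism phi,
        forall u, compact_distribution u ->
          moderate setT (fun e => hconv (mollifier rho e) u) /\
          phi setT u = gs_class setT (fun e => hconv (mollifier rho e) u) &
        algebra_hom_smooth setT (fun f => phi setT (dist_of setT f))].
Proof.
exists (phi rho); split.
- exact: phi_sheaf_morphism.
- move=> u uC; have ua := hconv_associated rho_schwartz uC.
  split; last by apply: phiE; first exact: openT.
  by apply/moderate_cbound; [exact: openT|exact: ua.1].
- exact: phi_algebra_hom.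
Qed.
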